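(* Let $n\ge1$ and let $L,L'$ be two $n$-component welded string links. The following are equivalent. (1) $L$ and $L'$ are $w_3$-equivalent. (2) For every finite type invariant $\nu$ of welded string links of degree at most $2$, $\nu(L)=\nu(L')$. (3) $L$ and $L'$ have the same welded linking numbers $\mu(ij)$ for all $i\neq j$, and the same closure invariants: $\mathcal{I}_{(i);2}$ for all $i$; $\mathcal{I}_{(j,i);2}$, $\mathcal{I}_{(i,\overline{j});2}$ and $\mathcal{I}_{(\overline{i},j);2}$ for all $i<j$; and $\mathcal{I}_{(\overline{j},i,\overline{k});2}$ for all pairwise distinct $i,j,k$ such that $j<k$.
   Context: **Welded string links.** A virtual diagram is a planar immersed 1-manifold with finitely many transverse double points, each decorated as a classical or a virtual crossing. Welded objects are virtual diagrams up to the three usual Reidemeister moves on classical crossings, the Detour move (an arc having only virtual crossings may be replaced by any arc with the same endpoints and only virtual crossings), and the OC move (two consecutive over-passages of classical crossings on a strand may be exchanged). An $n$-component welded string link is the welded class of $n$ properly immersed intervals in $[0,1]^2$, with $n$ fixed points on each of $[0,1]\times\{0\}$ and $[0,1]\times\{1\}$, the $i$th interval running from the $i$th point of $[0,1]\times\{0\}$ to the $i$th point of $[0,1]\times\{1\}$. They form a monoid $wSL(n)$ under stacking, with unit the crossingless diagram $\mathbf 1$. A welded long knot is the case $n=1$. The welded group $G(L)$ is the Wirtinger-type group generated by arcs (cut at under-passages only), with one conjugation relation per classical crossing. **w-trees.** A $w$-tree for a diagram $L$ is a connected unitrivalent tree immersed in the plane, with pairwise disjoint trivalent vertices, disjoint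 from $L$, each cyclically ordered; with univalent vertices on $L$ away from crossings; with oriented edges, exactly one outgoing edge at each trivalent vertex (so there is exactly one head and the other endpoints are tails); edges have only virtual crossings (with $L$ or other edges), and may carry twists $\bullet$ (two consecutive twists cancel). A $w_l$-tree is a $w$-tree with $l$ tails. Surgery along a $w_1$-tree on $L$ creates exactly one classical crossing, where the strand at the tail passes over the strand at the head; every other new crossing is virtual. Its sign is $+1$ if the head reaches its strand from the right and $-1$ if from the left, each twist changing the sign. Twists on the edge at a head can be traded for attaching the head from the other side of the strand. For $l\ge2$, surgery along a $w_l$-tree is surgery along its expansion, defined recursively: at the trivalent vertex adjacent to the head, facing the head, let $X$ and $Y$ be the left and right incoming subtrees; replace the tree by four parallel $w$-trees with adjacent heads at the former head, in the order $Y,X,Y^\bullet,X^\bullet$ from left to right, where $^\bullet$ denotes a twist next to the head. **$w_k$-equivalence.** $L$ and $L'$ are $w_k$-equivalent if they are related by a finite sequence of surgeries along $w_l$-trees with $l\ge k$ and welded moves (generalized Reidemeister and OC moves). **Finite type invariants.** A virtualization move replaces a classical crossing by a virtual one. An invariant $\nu$ of welded string links with values in an abelian group is of finite type of degree $\le d$ if $\sum_{S'\subset S}(-1)^{|S'|}\nu(L_{S'})=0$ for every diagram $L$ and every set $S$ of $d+1$ classical crossings of $L$, where $L_{S'}$ is obtained by virtualizing the crossings in $S'$. **Linking numbers.** $\mu_L(ij)$ is the sum of the signs of the classical crossings of $L$ at which component $i$ passes over component $j$. **Closure invariants.** A list $R$ is a sequence of pairwise distinct, possibly overlined, integers in $\{1,\dots,n\}$.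 For $L\in wSL(n)$, $Cl_R(L)$ is the welded long knot obtained by deleting the components not in $R$, reversing the orientation of overlined components, and connecting the oriented components in the order of $R$ (starting from $(\frac12,0)$ and ending at $(\frac12,1)$) by arcs crossing everything virtually. The normalized Alexander polynomial $\tilde\Delta_K(t)$ of a welded long knot $K$ is the Alexander polynomial (generator of the first elementary ideal of the Alexander module of $G(K)$, all meridians mapped to $t$) normalized among its multiples by $\pm t^m$ by $\tilde\Delta_K(1)=1$, $\tilde\Delta_K'(1)=0$; write $\tilde\Delta_K(t)=1+\sum_{m\ge2}\alpha_m(K)(1-t)^m$. Set $\mathcal I_{R;m}(L)=\alpha_m(Cl_R(L))$. *)

(* Defs.v *)
From HB Require Import structures.
From Stdlib Require Import Relations.
From mathcomp Require Import all_boot all_order all_algebra.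
From mathcomp Require Import boolp classical_sets.

Set Implicit Arguments.
Unset Strict Implicit.
Unset Printing Implicit Defensive.

Import GRing.Theory.
Local Open Scope ring_scope.

(* Virtual diagrams are encoded by their Gauss diagrams.  By Goussarov, Polyak
   and Viro, two virtual diagrams have the same Gauss diagram exactly when they
   differ by planar isotopy and Detour moves, and every Gauss diagram arises;
   virtual crossings therefore carry no data.
   A component is the word of its passages through the classical crossings:
   [lbl] names the crossing, [pos] tells whether its sign is +1, and [over]
   whether the strand passes over there. *)
Record passage := Passage { lbl : nat; pos : bool; over : bool }.

Definition passage_code (p : passage) := (lbl p, pos p, over p).
Definition code_passage (x : nat * bool * bool) := Passage x.1.1 x.1.2 x.2.
Lemma passage_codeK : cancel passage_code code_passage.
Proof. by case. Qed.
HB.instance Definition _ := Equality.copy passage (can_type passage_codeK).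

Definition word := seq passage.
Definition code n := {ffun 'I_n -> word}.

(* The other passage through the same crossing. *)
Definition mate (p : passage) := Passage (lbl p) (pos p) (~~ over p).

Definition passages n (C : code n) : word := flatten (codom C).

Definition wf_code n (C : code n) :=
  uniq [seq (lbl p, over p) | p <- passages C]
  && all (fun p => mate p \in passages C) (passages C).

(* Diagrams of n-component string links, and of long knots when n = 1. *)
Record diagram n := Diagram { dcode :> code n; wf_dcode : wf_code dcode }.

Section Contexts.
Variables (n : nat) (H : finType).

(* A diagram with marked points ("holes"), named by H, on its strands. *)
Definition context := {ffun 'I_n -> seq (passage + H)}.

Definition linear_context (T : context) :=
  [forall h : H, count_mem (inr h) (flatten (codom T)) == 1%N].

Definition fill (T : context) (w : H -> word) : code n :=
  [ffun i => flatten
     [seq match x with inl p => [:: p] | inr h => w h end | x <- T i]].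
End Contexts.

Definition relabel n (g : nat -> nat) (C : code n) : code n :=
  [ffun i => [seq Passage (g (lbl p)) (pos p) (over p) | p <- C i]].

Definition order2 (b : bool) (p q : passage) : word :=
  if b then [:: p; q] else [:: q; p].

(* The words on the top, middle and bottom strands of a Reidemeister III
   triangle.  The crossings are a (top over middle), b (top over bottom) and
   c (middle over bottom).  Three oriented lines of the plane form such a
   triangle exactly when, on each strand, the order of its two crossings (top:
   a before b; middle: a before c; bottom: b before c) agrees with the sign of
   the third crossing for all three strands or for none; for instance s1 s2 s1
   has three positive crossings and all three orders as listed.  The move
   exchanges the two cases. *)
Definition R3_word (a b c : nat) (sa sb sc d : bool) (h : 'I_3) : word :=
  nth [::]
    [:: order2 (sc == d) (Passage a sa true) (Passage b sb true);
        order2 (sb == d) (Passage a sa false) (Passage c sc true);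
        order2 (sa == d) (Passage b sb false) (Passage c sc false)] h.

Inductive welded_move n : code n -> code n -> Prop :=
| Relabel (C : code n) (g : nat -> nat) :
    injective g -> welded_move C (relabel g C)
| Reid1 (T : context n 'I_1) (a : nat) (s o : bool) :
    linear_context T ->
    welded_move (fill T (fun=> [:: Passage a s o; Passage a s (~~ o)]))
                (fill T (fun=> [::]))
| Reid2 (T : context n bool) (a b : nat) (s d : bool) :
    linear_context T ->
    welded_move
      (fill T (fun o =>
         if o then [:: Passage a s true; Passage b (~~ s) true]
         else order2 d (Passage a s false) (Passage b (~~ s) false)))
      (fill T (fun=> [::]))
| Reid3 (T : context n 'I_3) (a b c : nat) (sa sb sc d : bool) :
    linear_context T ->
    welded_move (fill T (R3_word a b c sa sb sc d))
                (fill T (R3_word a b c sa sb sc (~~ d)))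
| OverCommute (T : context n 'I_1) (a b : nat) (sa sb : bool) :
    linear_context T ->
    welded_move (fill T (fun=> [:: Passage a sa true; Passage b sb true]))
                (fill T (fun=> [:: Passage b sb true; Passage a sa true])).

(* Both ends of a move are diagrams, so labels of created crossings are fresh. *)
Definition welded_equiv n : diagram n -> diagram n -> Prop :=
  clos_refl_sym_trans (diagram n) (fun L L' => welded_move L L').

(* A w-tree without its head, oriented towards it: the boolean is the parity of
   the number of twists on the outgoing edge.  In [Vertex tw X Y], X and Y are
   the incoming subtrees on the left and on the right when facing the head.
   Edges cross everything virtually, so their routing carries no data. *)
Inductive wtree (H : Type) :=
| Tail (tw : bool) (h : H)
| Vertex (tw : bool) (X Y : wtree H).

Fixpoint tails H (t : wtree H) : seq H :=
  match t with
  | Tail _ h => [:: h]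
  | Vertex _ X Y => tails X ++ tails Y
  end.

(* The w_1-trees in the expansion of t, in the order of their heads along the
   strand, as pairs (tail, sign); [r] tells whether the head of t is attached
   from the right of its strand.  The twist next to the head is first traded
   for a change of side.  An observer facing a head attached from the right
   sees the strand running from left to right. *)
Fixpoint expansion H (r : bool) (t : wtree H) : seq (H * bool) :=
  match t with
  | Tail tw h => [:: (h, r (+) tw)]
  | Vertex tw X Y =>
      let r := r (+) tw in
      if r then expansion r Y ++ expansion r X
                ++ expansion (~~ r) Y ++ expansion (~~ r) X
      else expansion (~~ r) X ++ expansion (~~ r) Y
           ++ expansion r X ++ expansion r Y
  end.

(* Surgery creates the crossings E_0, E_1, ..., with labels g 0, g 1, ...;
   the head is the hole [None] and the tails are the holes [Some h]. *)
Definition surgery_word (H : eqType) (E : seq (H * bool)) (g : nat -> nat)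
    (h : option H) : word :=
  if h is Some x
  then [seq Passage (g q.1) q.2.2 true
       | q <- zip (iota 0 (size E)) E & q.2.1 == x]
  else [seq Passage (g q.1) q.2.2 false | q <- zip (iota 0 (size E)) E].

(* D' is the result of surgery on D along some w_l-tree. *)
Definition surgery n (l : nat) (D D' : code n) : Prop :=
  exists (T : context n (option 'I_l)) (r : bool) (t : wtree 'I_l)
         (g : nat -> nat),
    [/\ linear_context T, perm_eq (tails t) (enum 'I_l),
        D = fill T (fun=> [::])
      & D' = fill T (surgery_word (expansion r t) g)].

Definition w_equiv n (k : nat) : diagram n -> diagram n -> Prop :=
  clos_refl_sym_trans (diagram n) (fun L L' =>
    welded_move L L' \/ exists2 l, (k <= l)%N & surgery l L L').

(* Virtualizing a crossing deletes its chord from the Gauss diagram. *)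
Definition virtualize_code n (S : seq nat) (C : code n) : code n :=
  [ffun i => [seq p <- C i | lbl p \notin S]].

Lemma mem_passages n (C : code n) p :
  reflect (exists i, p \in C i) (p \in passages C).
Proof.
apply: (iffP flattenP) => [[w /codomP [i ->]] ?|[i ?]]; first by exists i.
by exists (C i); rewrite ?codom_f.
Qed.

Lemma passages_virtualize n S (C : code n) :
  passages (virtualize_code S C) = [seq p <- passages C | lbl p \notin S].
Proof.
rewrite /passages filter_flatten /codom /image_mem; congr flatten.
by rewrite -[RHS]map_comp; apply: eq_map => i; rewrite /= ffunE.
Qed.

Lemma wf_virtualize n S (L : diagram n) : wf_code (virtualize_code S L).
Proof.
case: L => C /andP [uC mC] /=; rewrite /wf_code passages_virtualize.
apply/andP; split.
  exact: subseq_uniq (map_subseq _ (filter_subseq _ _)) uC.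
apply/allP => p; rewrite !mem_filter => /andP [-> /=].
exact: (allP mC).
Qed.

Definition virtualize n (S : seq nat) (L : diagram n) : diagram n :=
  Diagram (wf_virtualize S L).

Definition crossings n (L : diagram n) : seq nat :=
  [seq lbl p | p <- passages L].

Definition welded_invariant n (A : Type) (nu : diagram n -> A) : Prop :=
  forall L L', welded_equiv L L' -> nu L = nu L'.

Definition finite_type n (d : nat) (A : zmodType) (nu : diagram n -> A) : Prop :=
  forall (L : diagram n) (S : d.+1.-tuple nat),
    uniq S -> {subset S <= crossings L} ->
    \sum_(J : {set 'I_d.+1})
       nu (virtualize [seq tnth S j | j in J] L) *~ (-1) ^+ #|J| = 0.

Definition linking n (L : code n) (i j : 'I_n) : int :=
  \sum_(p <- L i | over p && (mate p \in L j)) (if pos p then 1 else -1).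

(* [(i, b)] in a list stands for the component i, overlined when b holds. *)
Definition complist n := seq ('I_n * bool).

Section Closure.
Variables (n : nat) (R : complist n) (C : code n).

Definition kept (p : passage) := has (fun x => p \in C x.1) R.
Definition reversed (p : passage) := has (fun x => x.2 && (p \in C x.1)) R.

(* Reversing one of the two strands of a crossing changes its sign. *)
Definition closure_strand (x : 'I_n * bool) : word :=
  let w := [seq Passage (lbl p) (pos p (+) reversed p (+) reversed (mate p))
                        (over p)
           | p <- C x.1 & kept (mate p)] in
  if x.2 then rev w else w.

Definition closure : code 1 := [ffun=> flatten (map closure_strand R)].
End Closure.

Lemma mateK : involutive mate.
Proof. by case=> l s o; rewrite /mate /= negbK. Qed.

(* Closures are diagrams of long knots. *)
Lemma wf_closure n (R : complist n) (L : diagram n) :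
  uniq [seq x.1 | x <- R] -> wf_code (closure R L).
Proof.
case: L => C /andP [uC mC] /= uR.
have -> : wf_code (closure R C) =
    uniq [seq (lbl p, over p) | p <- flatten (map (closure_strand R C) R)]
    && all (fun p => mate p \in flatten (map (closure_strand R C) R))
           (flatten (map (closure_strand R C) R)).
  by rewrite /wf_code /passages /codom /image_mem enum_ordSl enum_ord0 /=
             cats0 ffunE.
pose key p := (lbl p, over p).
pose img p := Passage (lbl p) (pos p (+) reversed R C p (+) reversed R C (mate p))
                      (over p).
have memS x q : reflect (exists p, [/\ p \in C x.1, kept R C (mate p) & q = img p])
                        (q \in closure_strand R C x).
  have -> : (q \in closure_strand R C x)
            = (q \in [seq img p | p <- C x.1 & kept R C (mate p)]).
    by rewrite /closure_strand; case: x.2; rewrite ?mem_rev.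
  apply: (iffP mapP) => [[p] | [p [pC kp ->]]].
    by rewrite mem_filter => /andP [kp pC] ->; exists p.
  by exists p; rewrite // mem_filter kp.
have uK : uniq (flatten [seq [seq key p | p <- C i] | i <- enum 'I_n]).
  have -> : flatten [seq [seq key p | p <- C i] | i <- enum 'I_n]
            = [seq key p | p <- passages C].
    rewrite /passages /codom /image_mem map_flatten; congr flatten.
    by rewrite -[RHS]map_comp.
  exact: uC.
have disj i j p q : p \in C i -> q \in C j -> key p = key q -> i = j.
  have gen (s : seq 'I_n) k : uniq (flatten [seq [seq key p | p <- C i] | i <- s]) ->
      i \in s -> j \in s -> k \in [seq key p | p <- C i] ->
      k \in [seq key p | p <- C j] -> i = j.
    elim: s => //= a s IH; rewrite cat_uniq => /and3P [_ /hasPn no us].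
    rewrite !inE => /orP [/eqP -> | is_] /orP [/eqP -> | js] // ki kj.
    - suff /no : k \in flatten [seq [seq key p | p <- C i] | i <- s] by rewrite ki.
      by apply/flatten_mapP; exists j.
    - suff /no : k \in flatten [seq [seq key p | p <- C i] | i <- s] by rewrite kj.
      by apply/flatten_mapP; exists i.
    - exact: IH.
  move=> pi qj e; apply: (gen _ (key p) uK); rewrite ?mem_enum //; first exact: map_f.
  by rewrite e; apply: map_f.
apply/andP; split; last first.
  apply/allP => q /flatten_mapP [x xR /memS [p [px /hasP [y yR py] ->]]].
  apply/flatten_mapP; exists y => //; apply/memS; exists (mate p).
  split=> //; first by apply/hasP; exists x; rewrite // mateK.
  by rewrite /img /mate /= negbK -addbA (addbC (reversed _ _ _)) addbA; case: p {px py}.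
have uS x : uniq [seq key p | p <- closure_strand R C x].
  have us : uniq [seq key p | p <- C x.1].
    have: x.1 \in enum 'I_n by rewrite mem_enum.
    move: uK; elim: (enum 'I_n) => //= a s IH; rewrite inE cat_uniq.
    by case/and3P => ua _ us /orP [/eqP -> | ] //; apply: IH.
  have u' : uniq [seq key p | p <- [seq img p | p <- C x.1 & kept R C (mate p)]].
    by rewrite -map_comp; apply: subseq_uniq (map_subseq _ (filter_subseq _ _)) us.
  by rewrite /closure_strand; case: x.2 => //; rewrite map_rev rev_uniq.
have gen s : uniq [seq x.1 | x <- s] ->
    uniq [seq key p | p <- flatten [seq closure_strand R C x | x <- s]].
  elim: s => //= x s IH /andP [xs us]; rewrite map_cat cat_uniq uS IH // andbT.
  apply/hasPn => k /mapP [q /flatten_mapP [y ys /memS [p [py _ ->]]] ->].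
  apply/mapP => -[q' /memS [p' [px _ ->]] /(disj _ _ p p' py px) yx].
  by case/negP: xs; apply/mapP; exists y.
exact: gen.
Qed.

(* The word (i, e) :: ... has first letter x_i if e holds and x_i^-1 otherwise. *)
Definition gword := seq (nat * bool).

Section WeldedGroup.
Variable K : code 1.
Let w := K ord0.

(* The arcs of a long knot are numbered 0, 1, ... along the knot: the arc at
   some point is the number of under-passages before it. *)
Definition arc_at (i : nat) : nat := count (fun p => ~~ over p) (take i w).

Definition unders : word := [seq p <- w | ~~ over p].

(* At a crossing of sign e with overpassing arc o, where the underpassing
   strand goes from the arc k to the arc k+1:  x_(k+1) = x_o^-e x_k x_o^e. *)
Definition wirtinger (k : nat) : gword :=
  let p := nth (Passage 0 true false) unders k in
  let o := arc_at (index (mate p) w) in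
  [:: (k.+1, false); (o, ~~ pos p); (k, true); (o, pos p)].
End WeldedGroup.

(* Laurent polynomials are taken inside the field Q(t). *)
Definition ratfun := {fraction {poly int}}.
Definition tvar : ratfun := tofrac 'X.

Definition laurent (x : ratfun) : Prop :=
  exists (p : {poly int}) (k : nat), x = tofrac p / tvar ^+ k.

(* The image of the Fox derivative d/dx_j of a word when all generators are
   mapped to t. *)
Fixpoint fox (j : nat) (u : gword) : ratfun :=
  match u with
  | [::] => 0
  | (i, true) :: v => (i == j)%:R + tvar * fox j v
  | (i, false) :: v => tvar^-1 * (fox j v - (i == j)%:R)
  end.

(* The k-th elementary ideal of the module over Laurent polynomials with g
   generators and relation matrix A: it is spanned by the (g - k)-minors. *)
Definition elementary_ideal (k r g : nat) (A : 'M[ratfun]_(r, g)) : set ratfun :=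
  [set x | exists c : {ffun 'I_(g - k) -> 'I_r} -> {ffun 'I_(g - k) -> 'I_g} ->
                      ratfun,
     (forall f h, laurent (c f h))
     /\ x = \sum_f \sum_h c f h * \det (mxsub f h A)]%classic.

Definition alexander_matrix (K : code 1) :
    'M[ratfun]_(size (unders K), (size (unders K)).+1) :=
  \matrix_(r, j) fox j (wirtinger K r).

Definition alexander_polynomial (K : code 1) (D : ratfun) : Prop :=
  laurent D /\
  forall x, elementary_ideal 1 (alexander_matrix K) x
            <-> exists2 a, laurent a & x = a * D.

(* D(1) = 1 and D'(1) = 0, for D = p / t^k. *)
Definition normalized_at1 (D : ratfun) : Prop :=
  exists (p : {poly int}) (k : nat),
    [/\ D = tofrac p / tvar ^+ k, p.[1] = 1 & p^`().[1] - k%:R * p.[1] = 0].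

Definition normalized_alexander (K : code 1) : ratfun :=
  xget 0 [set D | alexander_polynomial K D /\ normalized_at1 D]%classic.

(* D is the formal series \sum_m a_m (1 - t)^m, in the (1 - t)-adic sense. *)
Definition expansion_at1 (D : ratfun) (a : nat -> int) : Prop :=
  forall N : nat, exists2 r, laurent r &
    D - \sum_(m < N) (a m)%:~R * (1 - tvar) ^+ m = (1 - tvar) ^+ N * r.

Definition alpha (m : nat) (K : code 1) : int :=
  xget (fun=> 0) [set a | expansion_at1 (normalized_alexander K) a]%classic m.

Definition closure_invariant n (R : complist n) (m : nat) (L : code n) : int :=
  alpha m (closure R L).

(* Main.v *)
(* Surgery along a tree is the insertion of a word of arrows, which is an iterated
   commutator.  It becomes trivial when the crossings at any of its tails are
   virtualized, so w_3-equivalence preserves invariants of degree 2.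

   In the Alexander matrix, deleting a column and rescaling rows leaves
   1 + (1 - t) M for an integer matrix M, and expanding the determinant to second
   order shows that alpha_2 of a long knot counts, with signs, the pairs of arrows
   met in the order O_l U_k U_l O_k.  Such a count has degree 2, as have the
   linking numbers.

   Conversely, string links with the same linking numbers are w_2-equivalent, hence
   differ, up to w_3-equivalence, by trees with two tails stacked at the ends of the
   strands.  These trees commute, and exchanging its tails inverts one.
   A tree with head on
   k and tails x, y changes the count of a closure by a sign exactly when k lies
   between x and y along the closure.  Exchanging the ends of two opposite arrows
   between two strands in two ways gives one relation between trees; the closure
   invariants determine the multiplicities of those that remain. *)
From HB Require Import structures.
From Stdlib Require Import Relations Setoid Morphisms.
From mathcomp Require Import all_boot all_order all_algebra.
From mathcomp Require Import boolp classical_sets zify ring.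
Require Import Defs.

Set Implicit Arguments.
Unset Strict Implicit.
Unset Printing Implicit Defensive.

(** Inserted words are treated as elements of a group: [aeq A B] says that the arrow words A and B
    are interchangeable in every context. Reidemeister II supplies inverses, OC lets adjacent tails
    commute, Reidemeister III becomes one commutation relation, and surgery along a tree kills an
    iterated commutator. The remaining difficulty is to compare words at different places of a
    diagram. Sliding an arrow or a tree past a passage costs only trees with one more tail. So
    arrows are mobile modulo trees with two tails, and trees with two tails are mobile modulo trees
    with three.

    The list of closures matches the trees at the ends of the strands: one type for each strand (a
    tail on each side of the head), three for each pair of strands, one for each head strand with
    two further strands. Without the relation between trees a pair would carry four types, against
    three closures. The linear system is then triangular with coefficients 1 and -1, provided the
    types are treated in the right order. *)

Section Words.
Variable H : eqType.
Implicit Types (s : seq (passage + H)) (w : H -> word).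

Definition fillw s w : word :=
  flatten [seq match x with inl p => [:: p] | inr h => w h end | x <- s].
Definition base s : word := pmap (fun x => if x is inl p then Some p else None) s.
Definition holes s : seq H := pmap (fun x => if x is inr h then Some h else None) s.

Lemma fillw_cat s s' w : fillw (s ++ s') w = fillw s w ++ fillw s' w.
Proof. by rewrite /fillw map_cat flatten_cat. Qed.
Lemma base_cat s s' : base (s ++ s') = base s ++ base s'.
Proof. exact: pmap_cat. Qed.
Lemma holes_cat s s' : holes (s ++ s') = holes s ++ holes s'.
Proof. exact: pmap_cat. Qed.
Lemma fillw_inl (u : word) w : fillw [seq inl p | p <- u] w = u.
Proof. by elim: u => //= p u IH; rewrite /fillw /= -/(fillw _ _) IH. Qed.
Lemma fillw_inr (u : seq H) w : fillw [seq inr p | p <- u] w = flatten (map w u).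
Proof. by elim: u => //= p u IH; rewrite /fillw /= -/(fillw _ _) IH. Qed.
Lemma holes_inl (u : word) : holes [seq inl p | p <- u] = [::].
Proof. by elim: u. Qed.
Lemma base_inl (u : word) : base [seq inl p | p <- u] = u.
Proof. by elim: u => //= p u ->. Qed.
Lemma holes_inr (u : seq H) : holes [seq inr p | p <- u] = u.
Proof. by elim: u => //= p u ->. Qed.
Lemma base_inr (u : seq H) : base [seq inr p | p <- u] = [::].
Proof. by elim: u. Qed.

Lemma mem_holes s h : (h \in holes s) = (inr h \in s).
Proof. by elim: s => //= -[p|h'] s IH; rewrite !inE IH. Qed.
Lemma mem_base s p : (p \in base s) = (inl p \in s).
Proof. by elim: s => //= -[q|h'] s IH; rewrite !inE IH. Qed.
Lemma count_holes s h : count_mem h (holes s) = count_mem (inr h) s.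
Proof. by elim: s => //= -[q|h'] s IH //=; rewrite IH. Qed.

Lemma perm_fillw s w : perm_eq (fillw s w) (base s ++ flatten (map w (holes s))).
Proof.
elim: s => //= -[p|h] s IH; rewrite /fillw /= -/(fillw _ _).
  by rewrite perm_cons.
by rewrite perm_sym perm_catCA perm_cat2l perm_sym.
Qed.

Lemma fillw_nil s : fillw s (fun=> [::]) = base s.
Proof. by elim: s => //= -[p|h] s IH; rewrite /fillw /= -/(fillw _ _) IH. Qed.

Lemma eq_fillw s w w' : {in holes s, w =1 w'} -> fillw s w = fillw s w'.
Proof.
elim: s => //= -[p|h] s IH ww; rewrite /fillw /= -/(fillw _ _) -/(fillw _ _).
  by rewrite IH.
by rewrite IH ?ww ?mem_head // => x xs; rewrite ww // inE xs orbT.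
Qed.

Lemma map_fillw (g : passage -> passage) s w :
  map g (fillw s w) =
  fillw (map (fun x => if x is inl p then inl (g p) else x) s) (fun h => map g (w h)).
Proof.
by elim: s => //= -[p|h] s IH; rewrite /fillw /= -!/(fillw _ _) -?map_cat ?IH // map_cat IH.
Qed.

End Words.

Section SubWords.
Variables H H' : eqType.
Definition subw (s : seq (passage + H)) (f : H -> seq (passage + H')) :=
  flatten [seq match x with inl p => [:: inl p] | inr h => f h end | x <- s].

Lemma fillw_sub s f w : fillw (subw s f) w = fillw s (fun h => fillw (f h) w).
Proof.
elim: s => //= -[p|h] s IH; rewrite /subw /= -/(subw _ _).
  by rewrite /fillw /= -!/(fillw _ _) IH.
by rewrite fillw_cat IH.
Qed.
Lemma holes_sub s f : holes (subw s f) = flatten [seq holes (f h) | h <- holes s].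
Proof.
elim: s => //= -[p|h] s IH; rewrite /subw /= -/(subw _ _) //.
by rewrite holes_cat IH.
Qed.
Lemma subw_cat s s' f : subw (s ++ s') f = subw s f ++ subw s' f.
Proof. by rewrite /subw map_cat flatten_cat. Qed.
Lemma base_sub s f : base (subw s f) = fillw s (fun h => base (f h)).
Proof.
elim: s => //= -[p|h] s IH; rewrite /subw /fillw /= -/(subw _ _) -/(fillw _ _) ?IH //.
by rewrite base_cat IH.
Qed.
End SubWords.

(** * Well-formedness *)

Definition key (p : passage) := (lbl p, over p).
Definition wfw (w : word) :=
  uniq (map key w) && all (fun p => mate p \in w) w.

Lemma perm_wfw w w' : perm_eq w w' -> wfw w = wfw w'.
Proof.
move=> e; rewrite /wfw (perm_uniq (perm_map _ e)); congr andb.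
rewrite (perm_all _ e); apply: eq_all => p; exact: perm_mem.
Qed.

Lemma key_inj w p q : uniq (map key w) -> p \in w -> q \in w -> key p = key q -> p = q.
Proof.
elim: w => //= r w IH /andP [rw uw]; rewrite !inE => /orP [/eqP ->|pw] /orP [/eqP ->|qw] //.
- by move=> e; rewrite e map_f in rw.
- by move=> e; rewrite -e map_f in rw.
- exact: IH.
Qed.

Lemma wfw_lbl w p q : wfw w -> p \in w -> q \in w -> lbl p = lbl q ->
  q = p \/ q = mate p.
Proof.
case/andP=> u m pw qw e; have mp := allP m _ pw.
case: (eqVneq (over p) (over q)) => o.
  by left; apply: (key_inj u) => //; rewrite /key e o.
right; apply: (key_inj u) => //; rewrite /key /= e; congr pair.
by case: (over p) (over q) o => [] [].
Qed.

Lemma wfw_cat_disj u v : {in u & v, forall p q, lbl p != lbl q} ->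
  wfw (u ++ v) = wfw u && wfw v.
Proof.
move=> d; rewrite /wfw map_cat cat_uniq all_cat.
have -> : ~~ has (in_mem^~ (mem (map key u))) (map key v).
  apply/hasPn => k /mapP [q qv ->]; apply/mapP => -[p pu [e _]].
  by have := d _ _ pu qv; rewrite e eqxx.
have -> : all (fun p => mate p \in u ++ v) u = all (fun p => mate p \in u) u.
  apply: eq_in_all => p pu; rewrite mem_cat.
  by case mv: (mate p \in v); rewrite ?orbF //; have := d _ _ pu mv; rewrite eqxx.
have -> : all (fun p => mate p \in u ++ v) v = all (fun p => mate p \in v) v.
  apply: eq_in_all => p pu; rewrite mem_cat.
  by case mv: (mate p \in u); rewrite ?orbF //; have := d _ _ mv pu; rewrite eqxx.
by case: (uniq _); case: (all _ _); case: (uniq _); case: (all _ _).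
Qed.

Lemma wf_codeE n (C : code n) : wf_code C = wfw (passages C).
Proof. by []. Qed.

(** * Contexts *)

Section Contexts.
Variables (n : nat).

Definition flatT (H : finType) (T : context n H) := flatten (codom T).

Lemma passages_fill (H : finType) (T : context n H) w :
  passages (fill T w) = fillw (flatT T) w.
Proof.
rewrite /passages /flatT /codom /image_mem.
elim: (enum 'I_n) => //= i s IH; by rewrite IH fillw_cat ffunE.
Qed.

Lemma linearP (H : finType) (T : context n H) :
  reflect (forall h, count_mem h (holes (flatT T)) = 1%N) (linear_context T).
Proof.
apply: (iffP forallP) => l h; first by rewrite count_holes; apply/eqP/l.
by apply/eqP; rewrite -count_holes l.
Qed.

Lemma linear_perm (H : finType) (T : context n H) :
  linear_context T -> perm_eq (holes (flatT T)) (enum H).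
Proof.
move/linearP=> l; apply/allP => h _ /=; apply/eqP.
by rewrite l (count_uniq_mem _ (enum_uniq _)) mem_enum.
Qed.

(** Refining holes by words with finer holes is how one diagram is presented as a filling of several
    contexts, in particular of those of the moves. *)
Definition subT (H H' : finType) (T : context n H) (f : H -> seq (passage + H')) :
  context n H' := [ffun i => subw (T i) f].

Lemma fill_sub (H H' : finType) (T : context n H) (f : H -> seq (passage + H')) w :
  fill (subT T f) w = fill T (fun h => fillw (f h) w).
Proof. by apply/ffunP => i; rewrite !ffunE -/(fillw _ _) -/(fillw _ _) fillw_sub. Qed.

Lemma flatT_sub (H H' : finType) (T : context n H) (f : H -> seq (passage + H')) :
  flatT (subT T f) = subw (flatT T) f.
Proof.
rewrite /flatT /codom /image_mem.
elim: (enum 'I_n) => //= i s IH; by rewrite IH subw_cat ffunE.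
Qed.

Lemma linear_sub (H H' : finType) (T : context n H) (f : H -> seq (passage + H')) :
  linear_context T ->
  (forall h', exists2 h, count_mem h' (holes (f h)) = 1%N &
      forall h0, h0 != h -> h' \notin holes (f h0)) ->
  linear_context (subT T f).
Proof.
move=> /linear_perm lT hf; apply/linearP => h'; rewrite flatT_sub holes_sub.
case: (hf h') => h h1 h0.
rewrite count_flatten -map_comp sumnE big_map (perm_big _ lT) /= big_enum /=.
rewrite (bigD1 h) //= h1 big1 // => h2 /h0.
by rewrite -has_pred1 has_count -leqNgt leqn0 => /eqP.
Qed.

Lemma eq_fill (H : finType) (T : context n H) w w' : w =1 w' -> fill T w = fill T w'.
Proof.
by move=> e; apply/ffunP=> i; rewrite !ffunE; apply: eq_fillw => h _; apply: e.
Qed.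

Lemma perm_passages_fill (H : finType) (T : context n H) w : linear_context T ->
  perm_eq (passages (fill T w)) (base (flatT T) ++ flatten [seq w h | h <- enum H]).
Proof.
move=> lT; rewrite passages_fill; apply: perm_trans (perm_fillw _ _) _.
by rewrite perm_cat2l; apply: perm_flatten; apply: perm_map; apply: linear_perm.
Qed.
End Contexts.

(** * Equivalence of codes *)

Section Equiv.
Variables (n : nat) (P : nat -> Prop).
Implicit Types (C D : code n).

Definition step C D := welded_move C D \/ exists2 l, P l & surgery l C D.

Definition dstep (L L' : diagram n) := step L L'.

(** Moves are stated for codes, but both ends must be diagrams. Hiding the proofs of well-formedness
    gives a relation between plain codes, where rewriting is unhindered. [P] holds of the numbers of
    tails allowed in surgeries. *)
Definition ceq C D := exists (h : wf_code C) (h' : wf_code D),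
  clos_refl_sym_trans (diagram n) dstep (Diagram h) (Diagram h').

Lemma ceq_wfl C D : ceq C D -> wf_code C.
Proof. by case. Qed.
Lemma ceq_wfr C D : ceq C D -> wf_code D.
Proof. by case=> ? []. Qed.
Lemma ceq_refl C : wf_code C -> ceq C C.
Proof. by move=> h; exists h, h; apply: rst_refl. Qed.
Lemma ceq_sym C D : ceq C D -> ceq D C.
Proof. by case=> h [h' e]; exists h', h; apply: rst_sym. Qed.
Lemma ceq_trans D C E : ceq C D -> ceq D E -> ceq C E.
Proof.
case=> h [h' e] [k [k' e']]; exists h, k'; apply: rst_trans e _.
by rewrite (bool_irrelevance h' k).
Qed.
Lemma ceq_step C D : wf_code C -> wf_code D -> step C D -> ceq C D.
Proof. by move=> h h' s; exists h, h'; apply: rst_step. Qed.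
Lemma ceq_move C D : wf_code C -> wf_code D -> welded_move C D -> ceq C D.
Proof. by move=> h h' s; apply: ceq_step => //; left. Qed.
Lemma ceqE (L L' : diagram n) :
  ceq L L' <-> clos_refl_sym_trans (diagram n) dstep L L'.
Proof.
case: L L' => [C h] [C' h']; split=> [[k [k']]|e]; last by exists h, h'.
by rewrite (bool_irrelevance k h) (bool_irrelevance k' h').
Qed.
End Equiv.

Section Relabel.
Variables (n : nat) (P : nat -> Prop).
Implicit Types (C D : code n).

Definition rlp (g : nat -> nat) (p : passage) := Passage (g (lbl p)) (pos p) (over p).

Lemma relabelE g C i : relabel g C i = map (rlp g) (C i).
Proof. by rewrite ffunE. Qed.

Lemma passages_relabel g C : passages (relabel g C) = map (rlp g) (passages C).
Proof.
rewrite /passages map_flatten /codom /image_mem; congr flatten.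
by rewrite -[RHS]map_comp; apply: eq_map => i; rewrite /= relabelE.
Qed.

Lemma eq_relabel g g' C :
  {in map lbl (passages C), g =1 g'} -> relabel g C = relabel g' C.
Proof.
move=> e; apply/ffunP => i; rewrite !relabelE; apply/eq_in_map => p pC.
rewrite /rlp e //; apply: map_f; apply/mem_passages; by exists i.
Qed.

Lemma wfw_relabel g w : {in map lbl w &, injective g} -> wfw (map (rlp g) w) = wfw w.
Proof.
move=> gi; rewrite /wfw; congr andb.
  rewrite -map_comp.
  have -> : map (key \o rlp g) w = map (fun k => (g k.1, k.2)) (map key w).
    by rewrite -map_comp.
  rewrite map_inj_in_uniq // => -[a o] [b o'] /mapP [p pw [-> ->]] /mapP [q qw [-> ->]] /=.
  case=> e ->; congr pair; apply: gi => //; exact: map_f.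
rewrite all_map; apply: eq_in_all => p pw /=.
apply/mapP/idP => [[q qw [e1 e2 e3]]|m]; last by exists (mate p).
suff -> : mate p = q by [].
case: q qw e1 e2 e3 => l s o qw /= e1 e2 e3; rewrite /mate e2 e3; congr Passage.
by apply: gi => //; [exact: map_f | exact: (map_f lbl qw)].
Qed.

(** [Relabel] asks for a globally injective map, while only the labels that occur are under control.
    Outside [s] the extension is a shift by a number exceeding all values of [g] on [s]. *)
Lemma inj_extend (s : seq nat) (g : nat -> nat) : {in s &, injective g} ->
  exists2 g', injective g' & {in s, g =1 g'}.
Proof.
move=> gi; pose N := (\max_(x <- map g s) x).+1.
exists (fun x => if x \in s then g x else (x + N)%N); last by move=> x /= ->.
have bd x : x \in s -> (g x < N)%N.
  by move=> xs; rewrite ltnS; apply: (leq_bigmax_seq (F := id)) => //; apply: map_f.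
move=> x y; case: ifP => xs; case: ifP => ys.
- exact: gi.
- by move=> e; have := bd _ xs; rewrite e ltnNge leq_addl.
- by move=> e; have := bd _ ys; rewrite -e ltnNge leq_addl.
- exact: addIn.
Qed.

Lemma ceq_relabel g C : wf_code C -> {in map lbl (passages C) &, injective g} ->
  ceq P C (relabel g C).
Proof.
move=> wC gi; have [g' g'i e] := inj_extend gi.
rewrite (eq_relabel e); apply: ceq_move => //; last exact: Relabel.
by rewrite wf_codeE passages_relabel wfw_relabel // => x y _ _; apply: g'i.
Qed.
End Relabel.

(** * Permuting adjacent tails *)

Section TailPerm.
Variables (n : nat) (P : nat -> Prop) (H : finType) (T : context n H).
Hypothesis lT : linear_context T.

Lemma perm_fill (w w' : H -> word) : (forall h, perm_eq (w h) (w' h)) ->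
  perm_eq (passages (fill T w)) (passages (fill T w')).
Proof.
move=> e; rewrite !passages_fill.
elim: (flatT T) => //= -[p|h] s IH; rewrite /fillw /= -!/(fillw _ _).
  by rewrite perm_cons.
exact: perm_cat.
Qed.

Let upd (w : H -> word) h0 u h := if h == h0 then u else w h.

Lemma oc_swap w h0 u p q v : wf_code (fill T (upd w h0 (u ++ p :: q :: v))) ->
  over p -> over q ->
  ceq P (fill T (upd w h0 (u ++ p :: q :: v))) (fill T (upd w h0 (u ++ q :: p :: v))).
Proof.
move=> wf op oq.
pose f h : seq (passage + 'I_1) := if h == h0 then map inl u ++ inr ord0 :: map inl v
  else map inl (w h).
have lT' : linear_context (subT T f).
  apply: linear_sub => // h'; exists h0.
    by rewrite /f eqxx holes_cat /= !holes_inl /= (ord1 h').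
  by move=> h /negbTE nh; rewrite /f nh holes_inl.
have E r : fill T (upd w h0 (u ++ r ++ v)) = fill (subT T f) (fun=> r).
  rewrite fill_sub; apply: eq_fill => h; rewrite /upd /f; case: eqP => _.
    by rewrite -cat1s !fillw_cat !fillw_inl /fillw /= cats0.
  by rewrite fillw_inl.
rewrite -[p :: q :: v]/([:: p; q] ++ v) -[q :: p :: v]/([:: q; p] ++ v) in wf *.
have wf' : wf_code (fill T (upd w h0 (u ++ [:: q; p] ++ v))).
  rewrite wf_codeE -(perm_wfw (w := passages (fill T (upd w h0 (u ++ [:: p; q] ++ v))))) //.
  apply: perm_fill => h; rewrite /upd; case: eqP => // _.
  by rewrite perm_cat2l perm_cat2r -[[:: p; q]]cat1s perm_catC.
apply: ceq_move => //; rewrite !E.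
case: p q op oq {wf wf' E} => a sa [] [b sb []] // _ _; exact: OverCommute.
Qed.

Lemma oc_front w h0 pre p a b :
  wf_code (fill T (upd w h0 (pre ++ a ++ p :: b))) -> over p -> all over a ->
  ceq P (fill T (upd w h0 (pre ++ a ++ p :: b))) (fill T (upd w h0 (pre ++ p :: a ++ b))).
Proof.
elim/last_ind: a b => [|a q IH] b wf op; first by move=> _; apply: ceq_refl.
rewrite all_rcons => /andP [oq oa].
have E : pre ++ rcons a q ++ p :: b = (pre ++ a) ++ q :: p :: b by rewrite cat_rcons catA.
rewrite E in wf *.
have hS := oc_swap wf oq op; apply: (ceq_trans hS); have := ceq_wfr hS.
by rewrite cat_rcons -catA => /IH; apply.
Qed.

Lemma oc_perm1 w h0 pre u u' :
  wf_code (fill T (upd w h0 (pre ++ u))) -> all over u -> perm_eq u u' ->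
  ceq P (fill T (upd w h0 (pre ++ u))) (fill T (upd w h0 (pre ++ u'))).
Proof.
elim: u u' pre => [|p u IH] u' pre wf ou e.
  by rewrite perm_sym in e; rewrite (perm_nilP e) in wf *; apply: ceq_refl.
have pu' : p \in u' by rewrite -(perm_mem e) mem_head.
have ou' : all over u' by rewrite -(perm_all _ e).
have : wf_code (fill T (upd w h0 (pre ++ u'))).
  rewrite wf_codeE -(perm_wfw (w := passages (fill T (upd w h0 (pre ++ p :: u))))) //.
  by apply: perm_fill => h; rewrite /upd; case: eqP => // _; rewrite perm_cat2l.
case: (path.splitPr pu') e ou' => a b e; rewrite all_cat /= => /and3P [oa op ob] wf'.
apply: ceq_sym; apply: ceq_trans (oc_front wf' op oa) _; apply: ceq_sym.
rewrite -!(cat_rcons p pre); apply: IH; first by rewrite cat_rcons.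
  by case/andP: ou.
by rewrite -(perm_cons p) (perm_trans e) // perm_catC /= perm_cons perm_catC.
Qed.

(** The holes are treated one at a time, by adjacent exchanges of over-passages. A hole containing a
    head must keep its word. *)
Lemma oc_perm (w w' : H -> word) : wf_code (fill T w) ->
  (forall h, perm_eq (w h) (w' h) /\ (w h = w' h \/ all over (w h))) ->
  ceq P (fill T w) (fill T w').
Proof.
move=> wf e.
suff G (s : seq H) : ceq P (fill T w) (fill T (fun h => if h \in s then w' h else w h)).
  by rewrite (_ : fill T w' = fill T (fun h => if h \in enum H then w' h else w h)) //;
    apply: eq_fill => h; rewrite mem_enum.
elim: s => [|h0 s IH]; first exact: ceq_refl.
apply: (ceq_trans IH); have wf' := ceq_wfr IH.
case h0s: (h0 \in s).
  rewrite (_ : fill T (fun h => if h \in h0 :: s then _ else _) =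
    fill T (fun h => if h \in s then w' h else w h)); first exact: ceq_refl.
  by apply: eq_fill => h; rewrite inE; case: eqP => // ->; rewrite h0s.
have [pe [E|ov]] := e h0.
  rewrite (_ : fill T (fun h => if h \in h0 :: s then _ else _) =
    fill T (fun h => if h \in s then w' h else w h)); first exact: ceq_refl.
  by apply: eq_fill => h; rewrite inE; case: eqP => // ->; rewrite h0s.
pose w1 h := if h \in s then w' h else w h.
rewrite (_ : fill T (fun h => if h \in s then w' h else w h) =
   fill T (upd w1 h0 ([::] ++ w h0))) in wf' *; last first.
  by apply: eq_fill => h; rewrite /upd /w1; case: eqP => // ->; rewrite h0s.
rewrite (_ : fill T (fun h => if h \in h0 :: s then w' h else w h) =
   fill T (upd w1 h0 ([::] ++ w' h0))); last first.
  by apply: eq_fill => h; rewrite /upd /w1 inE; case: eqP => // ->.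
exact: oc_perm1.
Qed.
End TailPerm.

(** * Arrow words *)

(* (x, h, s) is an arrow of sign s with its tail in the hole x and its head in
   the hole h; in [lw A h], the passages in a hole are ordered as in A. *)
Definition arrow (H : Type) := (H * H * bool)%type.

Section ArrowWords.
Variable H : finType.
Implicit Types (A B : seq (nat * arrow H)).

Definition piece (q : nat * arrow H) (h : H) : word :=
  (if q.2.1.1 == h then [:: Passage q.1 q.2.2 true] else [::]) ++
  (if q.2.1.2 == h then [:: Passage q.1 q.2.2 false] else [::]).
Definition lw A h : word := flatten [seq piece q h | q <- A].

Lemma lw_cat A B h : lw (A ++ B) h = lw A h ++ lw B h.
Proof. by rewrite /lw map_cat flatten_cat. Qed.

Lemma lw_cons q A h : lw (q :: A) h = piece q h ++ lw A h.
Proof. by []. Qed.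

Definition ends A : word :=
  flatten [seq [:: Passage q.1 q.2.2 true; Passage q.1 q.2.2 false] | q <- A].

Lemma lbl_ends A l : (l \in map lbl (ends A)) = (l \in unzip1 A).
Proof.
elim: A => //= q A IH.
by rewrite !inE -/(ends A) IH orbA orbb.
Qed.

Lemma flatten_delta (s : seq H) x (u : word) : uniq s -> x \in s ->
  flatten [seq if x == h then u else [::] | h <- s] = u.
Proof.
elim: s => //= h s IH /andP [hs us]; rewrite inE; case: eqVneq => [-> _|_ /= xs].
  rewrite -[RHS]cats0; congr cat; elim: s hs {us IH} => //= k s IH.
  by rewrite inE negb_or => /andP [/negbTE -> /IH ->].
by rewrite IH.
Qed.

Lemma perm_lw A : perm_eq (flatten [seq lw A h | h <- enum H]) (ends A).
Proof.
have pc (u v : H -> word) s : perm_eq (flatten [seq u h ++ v h | h <- s])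
    (flatten [seq u h | h <- s] ++ flatten [seq v h | h <- s]).
  elim: s => //= h s IH; rewrite -!catA perm_cat2l.
  by rewrite perm_sym perm_catCA perm_cat2l perm_sym.
elim: A => [|q A IH].
  by rewrite /lw /=; elim: (enum H).
rewrite (eq_map (lw_cons q A)); apply: perm_trans (pc _ _ _) _.
rewrite -[ends _]/([:: _; _] ++ ends A); apply: perm_cat => //.
apply: perm_trans (pc _ _ _) _.
by rewrite !flatten_delta ?enum_uniq ?mem_enum.
Qed.

Lemma wfw_ends A : wfw (ends A) = uniq (unzip1 A).
Proof.
have key_ends A' l o : ((l, o) \in map key (ends A')) = (l \in unzip1 A').
  elim: A' => //= q A' IH; rewrite !inE -/(ends A') IH /key /= !xpair_eqE.
  by case: (o); rewrite ?andbT ?andbF ?orbF.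
rewrite /wfw; have -> : all (fun p => mate p \in ends A) (ends A).
  apply/allP => p /flatten_mapP [q qA] pq; apply/flatten_mapP; exists q => //.
  by move: pq; rewrite !inE => /orP [] /eqP ->; rewrite eqxx ?orbT.
rewrite andbT; elim: A => //= q A <-.
by rewrite -/(ends A) inE !key_ends /key xpair_eqE /= andbF /= andbA andbb.
Qed.

Lemma lw_map_lbl (g : nat -> nat) A h :
  lw [seq (g q.1, q.2) | q <- A] h = map (rlp g) (lw A h).
Proof.
elim: A => //= q A IH; rewrite lw_cons IH map_cat; congr cat.
by rewrite /piece map_cat; congr cat; case: ifP.
Qed.
End ArrowWords.

Section Labels.
Variables (n : nat) (P : nat -> Prop) (H : finType).
Implicit Types (A B : seq (nat * arrow H)) (T : context n H).

Definition bT T := base (flatT T).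

Lemma mem_bT T i p : inl p \in T i -> p \in bT T.
Proof.
by move=> pT; rewrite mem_base; apply/flattenP; exists (T i); rewrite ?codom_f.
Qed.

Lemma wf_fillA T A : linear_context T ->
  wf_code (fill T (lw A)) =
  [&& wfw (bT T), uniq (unzip1 A) & all (fun l => l \notin map lbl (bT T)) (unzip1 A)].
Proof.
move=> lT; have pE : perm_eq (passages (fill T (lw A))) (bT T ++ ends A).
  apply: perm_trans (perm_passages_fill _ lT) _; rewrite perm_cat2l; exact: perm_lw.
rewrite wf_codeE (perm_wfw pE).
case al: (all _ (unzip1 A)); last first.
  rewrite !andbF; apply/negP => /andP [uk _].
  move/negbT: al => /allPn [l /mapP [q qA ->]]; rewrite negbK => /mapP [p pb e].
  move: uk; rewrite map_cat cat_uniq => /and3P [_ /hasPn nh _].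
  have /nh : key p \in map key (ends A).
    apply/mapP; exists (Passage q.1 q.2.2 (over p)); last by rewrite /key -e.
    by apply/flatten_mapP; exists q => //; rewrite !inE; case: (over p); rewrite eqxx ?orbT.
  by rewrite map_f.
rewrite wfw_cat_disj ?wfw_ends ?andbT // => p r pb re; apply/eqP => e.
have /(allP al) : lbl r \in unzip1 A by rewrite -lbl_ends map_f.
by rewrite -e map_f.
Qed.

Lemma map_index_nth (s : seq nat) (t : seq nat) : uniq s -> size s = size t ->
  map (fun l => nth 0%N t (index l s)) s = t.
Proof.
move=> us st; apply: (@eq_from_nth _ 0%N); first by rewrite size_map.
move=> i; rewrite size_map => li.
by rewrite (nth_map 0%N) // index_uniq.
Qed.

(** Labels of inserted arrows are immaterial: the map that sends each label of [A] to its
    counterpart in [B] and fixes the others need not be injective, but it is so on the labels that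
    occur. *)
Lemma relabel_fillA T A B : linear_context T -> unzip2 A = unzip2 B ->
  wf_code (fill T (lw A)) -> wf_code (fill T (lw B)) ->
  ceq P (fill T (lw A)) (fill T (lw B)).
Proof.
move=> lT e wA wB; move: (wA) (wB); rewrite !wf_fillA //.
move=> /and3P [wT uA aA] /and3P [_ uB aB].
pose g l := if l \in unzip1 A then nth 0%N (unzip1 B) (index l (unzip1 A)) else l.
have gA : map g (unzip1 A) = unzip1 B.
  rewrite -[RHS](map_index_nth uA); last by rewrite !size_map -(size_map snd A) -/(unzip2 A) e size_map.
  by apply/eq_in_map => l lA; rewrite /g lA.
have BE : B = [seq (g q.1, q.2) | q <- A].
  rewrite -(zip_unzip B) -gA -e /unzip1 /unzip2 -map_comp.
  by elim: (A) => //= q A' ->.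
have gT p : p \in bT T -> g (lbl p) = lbl p.
  by move=> pb; rewrite /g ifN //; apply/negP => /(allP aA); rewrite map_f.
have E : fill T (lw B) = relabel g (fill T (lw A)).
  apply/ffunP => i; rewrite relabelE !ffunE -!/(fillw _ _) map_fillw.
  have -> : [seq match x with inl p => inl (rlp g p) | inr _ => x end | x <- T i] = T i.
    apply: map_id_in => -[p|//] /mem_bT /gT; case: p => l s o /= gp.
    by rewrite /rlp /= gp.
  by apply: eq_fillw => h _; rewrite BE lw_map_lbl.
rewrite E; apply: ceq_relabel => //.
have mE l : l \in map lbl (passages (fill T (lw A))) ->
    (l \in map lbl (bT T)) || (l \in unzip1 A).
  case/mapP => p; rewrite (perm_mem (perm_passages_fill _ lT)) mem_cat => /orP [pb ->|].
    by rewrite map_f.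
  by rewrite (perm_mem (perm_lw A)) => pe ->; rewrite -(lbl_ends A) (map_f lbl pe) orbT.
have gB l : l \in unzip1 A -> g l \in unzip1 B by move=> lA; rewrite -gA map_f.
move=> x y /mE; case xA: (x \in unzip1 A) => /=.
  move=> _ /mE; case yA: (y \in unzip1 A) => /=.
    move=> _; rewrite /g xA yA => /eqP; rewrite nth_uniq //; last 2 first.
    - by rewrite -gA size_map index_mem.
    - by rewrite -gA size_map index_mem.
    by move/eqP => /(congr1 (nth 0%N (unzip1 A))); rewrite !nth_index.
  rewrite orbF => yb exy; have := allP aB _ (gB _ xA).
  by rewrite exy {1}/g yA yb.
rewrite orbF => xb /mE; case yA: (y \in unzip1 A) => /=.
  move=> _ exy; have := allP aB _ (gB _ yA).
  by rewrite -exy {1}/g xA xb.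
by move=> _; rewrite /g xA yA.
Qed.

Definition bound T := (\max_(l <- map lbl (bT T)) l).+1.
Definition labelled N (A : seq (arrow H)) := zip (iota N (size A)) A.
(** By [relabel_fillA] the choice of fresh labels does not matter; fixing one frees arrow words from
    labels. *)
Definition dg T (A : seq (arrow H)) := fill T (lw (labelled (bound T) A)).

Lemma labelledK N (A : seq (arrow H)) : unzip2 (labelled N A) = A.
Proof. by rewrite /labelled unzip2_zip // size_iota. Qed.
Lemma labelled1 N (A : seq (arrow H)) : unzip1 (labelled N A) = iota N (size A).
Proof. by rewrite /labelled unzip1_zip // size_iota. Qed.

Lemma bound_gt T l : l \in map lbl (bT T) -> (l < bound T)%N.
Proof. by move=> lT; rewrite ltnS; apply: (leq_bigmax_seq (F := id)). Qed.

Lemma wf_labelled T N (A : seq (arrow H)) : linear_context T -> wfw (bT T) -> (bound T <= N)%N ->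
  wf_code (fill T (lw (labelled N A))).
Proof.
move=> lT wT bN; rewrite wf_fillA // wT labelled1 iota_uniq /=.
apply/allP => l; rewrite mem_iota => /andP [Nl _]; apply/negP => /bound_gt.
by rewrite ltnNge (leq_trans bN).
Qed.

Lemma wf_dg T (A : seq (arrow H)) : linear_context T -> wfw (bT T) -> wf_code (dg T A).
Proof. by move=> *; apply: wf_labelled. Qed.

Lemma dgP T A : linear_context T -> wf_code (fill T (lw A)) ->
  ceq P (fill T (lw A)) (dg T (unzip2 A)).
Proof.
move=> lT wA; apply: relabel_fillA => //; first by rewrite labelledK.
by apply: wf_dg => //; move: wA; rewrite wf_fillA // => /andP [].
Qed.

Lemma dg_nil T : dg T [::] = fill T (fun=> [::]).
Proof. by []. Qed.
End Labels.

(** * The group of arrow words *)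

Section Aeq.
Variables (n : nat) (P : nat -> Prop) (H : finType).
Implicit Types (A B C : seq (arrow H)) (T : context n H).

(** Quantifying over all contexts makes this a congruence for concatenation, because the neighbours
    of a subword can be absorbed into the context. *)
Definition aeq A B :=
  forall T, linear_context T -> wfw (bT T) -> ceq P (dg T A) (dg T B).

Lemma aeq_refl A : aeq A A.
Proof. by move=> T lT wT; apply: ceq_refl; apply: wf_dg. Qed.
Lemma aeq_sym A B : aeq A B -> aeq B A.
Proof. by move=> e T lT wT; apply: ceq_sym; apply: e. Qed.
Lemma aeq_trans B A C : aeq A B -> aeq B C -> aeq A C.
Proof. by move=> e e' T lT wT; apply: (ceq_trans (e T lT wT)); apply: e'. Qed.

Hint Resolve aeq_refl : core.

#[export] Instance aeq_equiv : Equivalence aeq.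
Proof. split; [exact: aeq_refl | exact: aeq_sym | by move=> A B C; apply: aeq_trans]. Qed.

Lemma wf_bT T (A : seq (nat * arrow H)) :
  linear_context T -> wf_code (fill T (lw A)) -> wfw (bT T).
Proof. by move=> lT; rewrite wf_fillA // => /andP []. Qed.

Lemma aeq_use T (A B : seq (nat * arrow H)) : aeq (unzip2 A) (unzip2 B) ->
  linear_context T -> wf_code (fill T (lw A)) -> wf_code (fill T (lw B)) ->
  ceq P (fill T (lw A)) (fill T (lw B)).
Proof.
move=> e lT wA wB; apply: (ceq_trans (dgP P lT wA)).
apply: ceq_trans (ceq_sym (dgP P lT wB)); apply: e => //; exact: wf_bT wA.
Qed.

(** The canonical labels of [dg] rarely fit the two sides of a move. Here the labels are chosen by
    lists of indices, equal indices on the two sides naming the same crossing. *)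
Lemma aeqI (lA lB : seq nat) A B :
  uniq lA -> uniq lB -> size lA = size A -> size lB = size B ->
  (forall T g, linear_context T -> wf_code (fill T (lw (zip (map g lA) A))) ->
     wf_code (fill T (lw (zip (map g lB) B))) ->
     ceq P (fill T (lw (zip (map g lA) A))) (fill T (lw (zip (map g lB) B)))) ->
  aeq A B.
Proof.
move=> uA uB sA sB h T lT wT; set g := addn (bound T).
have w l (D : seq (arrow H)) : uniq l -> size l = size D ->
    wf_code (fill T (lw (zip (map g l) D))).
  move=> ul sl; rewrite wf_fillA // wT unzip1_zip ?size_map ?sl //.
  rewrite map_inj_uniq ?ul //=; last exact: addnI.
  apply/allP => x /mapP [y yl ->]; apply/negP => /bound_gt.
  by rewrite ltnNge leq_addr.
have d l (D : seq (arrow H)) : uniq l -> size l = size D ->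
    ceq P (dg T D) (fill T (lw (zip (map g l) D))).
  move=> ul sl; apply: ceq_sym; have := dgP P lT (w _ _ ul sl).
  by rewrite unzip2_zip // size_map sl.
apply: (ceq_trans (d _ _ uA sA)); apply: ceq_trans (ceq_sym (d _ _ uB sB)).
by apply: h => //; apply: w.
Qed.

Lemma aeq_ctx C1 C2 A B : aeq A B -> aeq (C1 ++ A ++ C2) (C1 ++ B ++ C2).
Proof.
move=> e T lT wT; set N := bound T.
(* The middle word is labelled last, so that the labels of its neighbours do not depend on its
   length. *)
pose c1 := labelled N C1; pose c2 := labelled (N + size C1) C2.
pose a := labelled (N + size C1 + size C2) A; pose b := labelled (N + size C1 + size C2) B.
have w D : wf_code (fill T (lw (c1 ++ labelled (N + size C1 + size C2) D ++ c2))).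
  have pe : perm_eq (unzip1 (c1 ++ labelled (N + size C1 + size C2) D ++ c2))
      (iota N (size C1 + size C2 + size D)).
    rewrite /unzip1 !map_cat -!/(unzip1 _) !labelled1 !iotaD -catA perm_cat2l.
    by rewrite perm_catC addnA.
  rewrite wf_fillA // wT (perm_uniq pe) iota_uniq (perm_all _ pe) /=.
  apply/allP => x; rewrite mem_iota => /andP [Nx _]; apply/negP => /bound_gt.
  by rewrite ltnNge Nx.
have d D : ceq P (dg T (C1 ++ D ++ C2))
    (fill T (lw (c1 ++ labelled (N + size C1 + size C2) D ++ c2))).
  apply: ceq_sym; have := dgP P lT (w D).
  by rewrite /unzip2 !map_cat -!/(unzip2 _) !labelledK.
apply: (ceq_trans (d A)); apply: ceq_trans (ceq_sym (d B)).
pose f h : seq (passage + H) := map inl (lw c1 h) ++ inr h :: map inl (lw c2 h).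
have lT' : linear_context (subT T f).
  apply: linear_sub => // h; exists h.
    by rewrite /f holes_cat /= !holes_inl /= eqxx.
  by move=> h0 ne; rewrite /f holes_cat /= !holes_inl /= inE eq_sym.
have E D : fill T (lw (c1 ++ D ++ c2)) = fill (subT T f) (lw D).
  rewrite fill_sub; apply: eq_fill => h; rewrite /f -cat1s !fillw_cat !fillw_inl.
  by rewrite !lw_cat /fillw /= cats0.
rewrite !E; apply: aeq_use => //; last 2 first.
- by rewrite -E; apply: w.
- by rewrite -E; apply: w.
by rewrite !labelledK.
Qed.

#[export] Instance aeq_cat : Proper (aeq ==> aeq ==> aeq) (@cat (arrow H)).
Proof.
move=> A A' eA B B' eB; apply: (@aeq_trans (A' ++ B)).
  exact: (aeq_ctx [::] B eA).
by have := aeq_ctx A' [::] eB; rewrite !cats0.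
Qed.

Definition flip (a : arrow H) : arrow H := (a.1, ~~ a.2).
Definition inv A : seq (arrow H) := rev (map flip A).

Lemma flipK : involutive flip.
Proof. by case=> xh s; rewrite /flip /= negbK. Qed.
Lemma invK : involutive inv.
Proof. by move=> A; rewrite /inv map_rev revK (mapK flipK). Qed.
Lemma inv_cat A B : inv (A ++ B) = inv B ++ inv A.
Proof. by rewrite /inv map_cat rev_cat. Qed.

(** Ends in the same hole are adjacent, so this is Reidemeister I. *)
Lemma aeq_self x s : aeq [:: (x, x, s)] [::].
Proof.
apply: (@aeqI [:: 0%N] [::]) => // T g lT; rewrite /=; set a := g 0%N.
pose f h : seq (passage + 'I_1) := if h == x then [:: inr ord0] else [::].
have lT' : linear_context (subT T f).
  apply: linear_sub => // h'; exists x; first by rewrite /f eqxx /= (ord1 h').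
  by move=> h /negbTE nh; rewrite /f nh.
have -> : fill T (lw [:: (a, (x, x, s))]) =
    fill (subT T f) (fun=> [:: Passage a s true; Passage a s false]).
  rewrite fill_sub; apply: eq_fill => h; rewrite /f /lw /piece /= eq_sym.
  by case: eqP.
have -> : fill T (lw [::]) = fill (subT T f) (fun=> [::]).
  rewrite fill_sub; apply: eq_fill => h; rewrite /f /lw /piece /=.
  by case: eqP.
move=> w w'; apply: ceq_move => //; exact: Reid1.
Qed.

Lemma aeq_cancel x h s : aeq [:: (x, h, s); (x, h, ~~ s)] [::].
Proof.
case: (eqVneq x h) => [->|xh].
  rewrite -[[:: _; _]]/([:: (h, h, s)] ++ [:: (h, h, ~~ s)]).
  by rewrite !aeq_self.
apply: (@aeqI [:: 0; 1]%N [::]) => // T g lT; rewrite /=; set a := g 0%N; set b := g 1%N.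
pose f h0 : seq (passage + bool) :=
  if h0 == x then [:: inr true] else if h0 == h then [:: inr false] else [::].
have lT' : linear_context (subT T f).
  apply: linear_sub => // -[].
    exists x; first by rewrite /f eqxx.
    by move=> h0 /negbTE nh; rewrite /f nh; case: ifP.
  exists h; first by rewrite /f eq_sym (negbTE xh) eqxx.
  by move=> h0 /negbTE nh; rewrite /f nh; case: ifP.
have -> : fill T (lw [:: (a, (x, h, s)); (b, (x, h, ~~ s))]) =
    fill (subT T f) (fun o => if o then [:: Passage a s true; Passage b (~~ s) true]
         else order2 true (Passage a s false) (Passage b (~~ s) false)).
  rewrite fill_sub; apply: eq_fill => h0; rewrite /f /lw /piece /= ![_ == h0]eq_sym.
  by case: (eqVneq h0 x) => [->|_]; rewrite ?(negbTE xh) //; case: eqP.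
have -> : fill T (lw [::]) = fill (subT T f) (fun=> [::]).
  rewrite fill_sub; apply: eq_fill => h0; rewrite /f /lw /piece /=.
  by case: eqP => //; case: eqP.
move=> w w'; apply: ceq_move => //; exact: Reid2.
Qed.

Lemma aeq_invr A : aeq (A ++ inv A) [::].
Proof.
elim: A => // -[[x h] s] A IH; rewrite -cat1s inv_cat -catA [A ++ _]catA.
by rewrite {}IH /= aeq_cancel.
Qed.
Lemma aeq_invl A : aeq (inv A ++ A) [::].
Proof. by have := aeq_invr (inv A); rewrite invK. Qed.

Lemma aeq_cancell A B C : aeq (A ++ B) (A ++ C) -> aeq B C.
Proof.
move=> e; have : aeq (inv A ++ (A ++ B)) (inv A ++ (A ++ C)) by rewrite e.
by rewrite !catA aeq_invl.
Qed.
Lemma aeq_cancelr A B C : aeq (B ++ A) (C ++ A) -> aeq B C.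
Proof.
move=> e; have : aeq ((B ++ A) ++ inv A) ((C ++ A) ++ inv A) by rewrite e.
by rewrite -!catA aeq_invr !cats0.
Qed.
Lemma aeq_inv1 A B : aeq (A ++ B) [::] -> aeq B (inv A).
Proof. by move=> e; apply: (@aeq_cancell A); rewrite e aeq_invr. Qed.

#[export] Instance aeq_inv : Proper (aeq ==> aeq) inv.
Proof.
move=> A B e; apply: aeq_sym; apply: aeq_inv1; by rewrite e aeq_invr.
Qed.

(** * Commutation of arrows *)

Definition com A B := aeq (A ++ B) (B ++ A).

Lemma com_sym A B : com A B -> com B A.
Proof. exact: aeq_sym. Qed.
Lemma com_nil A : com A [::].
Proof. by rewrite /com cats0. Qed.
Lemma com_catr A B C : com A B -> com A C -> com A (B ++ C).
Proof. by rewrite /com => e e'; rewrite catA e -catA e' catA. Qed.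
Lemma com_catl A B C : com A C -> com B C -> com (A ++ B) C.
Proof. by move=> /com_sym e /com_sym e'; apply: com_sym; apply: com_catr. Qed.
Lemma com_invr A B : com A B -> com A (inv B).
Proof.
rewrite /com => e; apply: (@aeq_cancell B); rewrite !catA aeq_invr -e.
by rewrite -catA aeq_invr cats0.
Qed.
Lemma com_invl A B : com A B -> com (inv A) B.
Proof. by move=> /com_sym e; apply: com_sym; apply: com_invr. Qed.
#[export] Instance com_proper : Proper (aeq ==> aeq ==> iff) com.
Proof. by move=> A A' e B B' e'; rewrite /com; split=> h; rewrite ?e ?e' ?h -?e -?e' //. Qed.
(** No head shares a hole with an end of the other arrow; if the tails share a hole, OC exchanges
    them. *)
Lemma com_disj x h s x' h' s' : h != h' -> x != h' -> x' != h ->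
  com [:: (x, h, s)] [:: (x', h', s')].
Proof.
move=> hh xh x'h.
apply: (@aeqI [:: 0; 1]%N [:: 1; 0]%N) => // T g lT.
rewrite /=; set a := g 0%N; set b := g 1%N => w w'.
apply: oc_perm => // h0; rewrite /lw /piece /= !cats0.
case: (eqVneq h h0) => [e|_]; last case: (eqVneq h' h0) => [e|_].
- by rewrite -{}e in w w' *; rewrite (negbTE x'h) (eq_sym h') (negbTE hh) !cats0;
  split=> //; left.
- by rewrite -{}e in w w' *; rewrite (negbTE xh) /= !cats0; split => //; left.
- rewrite !cats0; case: ifP; case: ifP => _ _ /=; try (by split=> //; left).
  by split; [rewrite (perm_catC [:: _] [:: _]) | right].
Qed.

(** Reidemeister III with [y] on top, [t] in the middle and [h] at the bottom. The move also
    reverses the order of the two tails on top, which OC undoes. *)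
Lemma aeq_R3 y t h s s' : y != t -> y != h -> t != h ->
  com [:: (y, t, s); (y, h, s)] [:: (t, h, s')].
Proof.
move=> yt yh th.
have C : com [:: (y, t, s)] [:: (y, h, s)] by apply: com_disj => //.
(* In [R3_word] the order on the top strand is governed by the sign of the third crossing, hence the
   comparison of [s'] with [s]. *)
have R : aeq ((if s' == s then [:: (y, t, s); (y, h, s)] else [:: (y, h, s); (y, t, s)])
          ++ [:: (t, h, s')])
        ([:: (t, h, s')] ++
         (if s' == s then [:: (y, h, s); (y, t, s)] else [:: (y, t, s); (y, h, s)])).
  pose l1 := if s' == s then [:: 0; 1; 2]%N else [:: 1; 0; 2]%N.
  pose l2 := if s' == s then [:: 2; 1; 0]%N else [:: 2; 0; 1]%N.
  apply: (@aeqI l1 l2); rewrite /l1 /l2; try by case: (s' == s).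
  move=> T g lT; set a := g 0%N; set b := g 1%N; set c := g 2%N.
  have ty : t != y by rewrite eq_sym.
  have hy : h != y by rewrite eq_sym.
  have ht : h != t by rewrite eq_sym.
  pose f h0 : seq (passage + 'I_3) :=
    if y == h0 then [:: inr (@Ordinal 3 0 isT)] else
    if t == h0 then [:: inr (@Ordinal 3 1 isT)] else
    if h == h0 then [:: inr (@Ordinal 3 2 isT)] else [::].
  have lT' : linear_context (subT T f).
    apply: linear_sub => // -[[|[|[|//]]] hi].
    - exists y; first by rewrite /f eqxx.
      by move=> h0; rewrite eq_sym => /negbTE nh; rewrite /f nh; do 2?case: ifP.
    - exists t; first by rewrite /f (negbTE yt) eqxx.
      by move=> h0; rewrite eq_sym => /negbTE nh; rewrite /f nh; do 2?case: ifP.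
    - exists h; first by rewrite /f (negbTE yh) (negbTE th) eqxx.
      by move=> h0; rewrite eq_sym => /negbTE nh; rewrite /f nh; do 2?case: ifP.
  have E1 : fill T (lw (zip (map g l1) ((if s' == s then [:: (y, t, s); (y, h, s)]
       else [:: (y, h, s); (y, t, s)]) ++ [:: (t, h, s')]))) =
      fill (subT T f) (R3_word a b c s s s' s).
    rewrite fill_sub; apply: eq_fill => h0.
    rewrite /l1 /R3_word /order2 eqxx /f; case: (s' == s) => /=; rewrite /lw /piece /=;
    (case: (eqVneq y h0) => [<-|_];
      first by rewrite ?(negbTE ty) ?(negbTE hy) /fillw /= ?cats0);
    (case: (eqVneq t h0) => [<-|_]; first by rewrite ?(negbTE ht) /fillw /= ?cats0);
    by case: eqP => //=; rewrite /fillw /= ?cats0.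
  have E2 : fill T (lw (zip (map g l2) ([:: (t, h, s')] ++ (if s' == s then [:: (y, h, s); (y, t, s)]
       else [:: (y, t, s); (y, h, s)])))) =
      fill (subT T f) (R3_word a b c s s s' (~~ s)).
    rewrite fill_sub; apply: eq_fill => h0.
    have es : (s == ~~ s) = false by case: (s).
    have es' : (s' == ~~ s) = ~~ (s' == s) by case: (s) (s') => [] [].
    rewrite /l2 /R3_word /order2 es es' /f; case: (s' == s) => /=; rewrite /lw /piece /=;
    (case: (eqVneq y h0) => [<-|_];
      first by rewrite ?(negbTE ty) ?(negbTE hy) /fillw /= ?cats0);
    (case: (eqVneq t h0) => [<-|_]; first by rewrite ?(negbTE ht) /fillw /= ?cats0);
    by case: eqP => //=; rewrite /fillw /= ?cats0.
  move=> w w'; rewrite E1 E2 in w w' *; apply: ceq_move => //; exact: Reid3.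
rewrite /com /= in C *.
have CL X : aeq [:: (y, t, s), (y, h, s) & X] [:: (y, h, s), (y, t, s) & X].
  exact: (aeq_ctx [::] X C).
have CR X : aeq (X ++ [:: (y, t, s); (y, h, s)]) (X ++ [:: (y, h, s); (y, t, s)]).
  by rewrite C.
case: (s' == s) R => /= R.
  by rewrite R; apply: aeq_sym; exact: (CR [:: _]).
by rewrite CL R.
Qed.
End Aeq.

#[export] Hint Resolve aeq_refl : core.

(** * Merging holes *)

Section Merge.
Variables (n : nat) (P : nat -> Prop) (H1 H0 : finType) (phi : H1 -> H0).

Definition amap (a : arrow H1) : arrow H0 := (phi a.1.1, phi a.1.2, a.2).
Definition lmap (A : seq (nat * arrow H1)) := [seq (q.1, amap q.2) | q <- A].

(** A hole with a head may not be merged with another hole: only tails can be interleaved at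
    will. *)
Definition headinj (A : seq (arrow H1)) :=
  forall a, a \in A -> forall h, phi h = phi a.1.2 -> h = a.1.2.

Lemma unzip2_lmap A : unzip2 (lmap A) = map amap (unzip2 A).
Proof. by rewrite /unzip2 /lmap -!map_comp. Qed.
Lemma perm_flatten_cat (I : eqType) (u v : I -> word) s :
  perm_eq (flatten [seq u h ++ v h | h <- s])
    (flatten [seq u h | h <- s] ++ flatten [seq v h | h <- s]).
Proof.
elim: s => //= h s IH; rewrite -!catA perm_cat2l.
by rewrite perm_sym perm_catCA perm_cat2l perm_sym.
Qed.

Variable f : H0 -> seq H1.
Hypothesis uf : forall h, uniq (f h).
Hypothesis mf : forall h h1, (h1 \in f h) = (phi h1 == h).

Lemma fiber_delta x h (u : word) :
  flatten [seq if x == h1 then u else [::] | h1 <- f h] =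
  if phi x == h then u else [::].
Proof.
case: ifP => e; first by apply: flatten_delta; rewrite ?mf.
have : x \notin f h by rewrite mf e.
elim: (f h) => //= y s IH; rewrite inE negb_or => /andP [/negbTE -> /IH ->] //.
Qed.

Lemma perm_merge A h :
  perm_eq (flatten [seq lw A h1 | h1 <- f h]) (lw (lmap A) h).
Proof.
elim: A => [|q A IH]; first by rewrite /lw /=; elim: (f h).
rewrite (eq_map (lw_cons q A)); apply: perm_trans (perm_flatten_cat _ _ _) _.
rewrite [lmap _]/= lw_cons; apply: perm_cat => //.
apply: perm_trans (perm_flatten_cat _ _ _) _.
by rewrite !fiber_delta.
Qed.

Lemma lw_over (A : seq (nat * arrow H1)) h :
  (forall q, q \in A -> q.2.1.2 != h) -> all over (lw A h).
Proof.
move=> nA; apply/allP => p /flatten_mapP [q qA]; rewrite /piece mem_cat.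
rewrite (negbTE (nA q qA)) orbF; by case: ifP => // _; rewrite inE => /eqP ->.
Qed.

Lemma linear_merge (T : context n H0) :
  linear_context T -> linear_context (subT T (fun h => map inr (f h))).
Proof.
move=> lT; apply: linear_sub => // h; exists (phi h).
  by rewrite holes_inr count_uniq_mem // mf eqxx.
by move=> h0; rewrite holes_inr mf eq_sym.
Qed.

Lemma bT_merge (T : context n H0) : bT (subT T (fun h => map inr (f h))) = bT T.
Proof.
rewrite /bT flatT_sub base_sub -fillw_nil; apply: eq_fillw => h _.
exact: base_inr.
Qed.

Lemma fill_merge (T : context n H0) (A : seq (nat * arrow H1)) :
  linear_context T -> headinj (unzip2 A) ->
  wf_code (fill (subT T (fun h => map inr (f h))) (lw A)) ->
  ceq P (fill (subT T (fun h => map inr (f h))) (lw A)) (fill T (lw (lmap A))).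
Proof.
move=> lT hA; rewrite fill_sub => wf; apply: oc_perm => // h.
rewrite fillw_inr; split; first exact: perm_merge.
case: (pickP (fun h1 => (h1 \in f h) && has (fun q => q.2.1.2 == h1) A)) => [h1|no].
  case/andP => h1f /hasP [q qA /eqP e]; left.
  have fh : f h = [:: h1].
    apply: perm_small_eq => //; apply: uniq_perm => // x; rewrite mf inE.
    apply/eqP/eqP => [px|->]; last by apply/eqP; rewrite -mf.
    rewrite -e; apply: (hA q.2); first exact: map_f.
    by rewrite px e; apply/esym/eqP; rewrite -mf.
  rewrite fh /= cats0; elim: (A) => //= r B IH; rewrite !lw_cons IH; congr cat.
  by rewrite /piece /=; congr cat; rewrite -!mf fh inE.
right; apply/allP => p /flatten_mapP [h1 h1f]; apply/allP/lw_over => q qA.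
apply/negP => e; have := no h1; rewrite h1f /=; move/hasP; apply; by exists q.
Qed.
End Merge.

Section Map.
Variables (n : nat) (P : nat -> Prop) (H1 H0 : finType) (phi : H1 -> H0).

(** Each hole of a context is split into the adjacent holes of its fibre. By [headinj] a fibre with
    several holes receives tails only, so the splitting merely permutes tails. Laws proved for
    distinct holes therefore persist when tails share a hole. *)
Lemma aeq_map (A B : seq (arrow H1)) : headinj phi A -> headinj phi B ->
  aeq n P A B -> aeq n P (map (amap phi) A) (map (amap phi) B).
Proof.
move=> hA hB e T lT wT; pose f h := [seq h1 <- enum H1 | phi h1 == h].
have uf h : uniq (f h) by rewrite filter_uniq ?enum_uniq.
have mf h h1 : (h1 \in f h) = (phi h1 == h) by rewrite mem_filter mem_enum andbT.
pose T' := subT T (fun h => map inr (f h)).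
have lT' : linear_context T' by apply: linear_merge.
have wT' : wfw (bT T') by rewrite bT_merge.
have M D : headinj phi D -> ceq P (dg T' D) (dg T (map (amap phi) D)).
  move=> hD; have W := wf_dg D lT' wT'.
  have F := fill_merge P uf mf lT _ W; rewrite labelledK in F; have {}F := F hD.
  apply: (ceq_trans F); apply: (ceq_trans (dgP P lT (ceq_wfr F))).
  by rewrite unzip2_lmap labelledK; apply: ceq_refl; apply: wf_dg.
by apply: (ceq_trans (ceq_sym (M A hA))); apply: (ceq_trans (e _ lT' wT')); apply: M.
Qed.

End Map.

(** * Trees *)

Section Trees.
Variables (n : nat) (P : nat -> Prop).

Definition letters (X H : Type) (f : X -> H) (h : H) (E : seq (X * bool)) :
  seq (arrow H) := [seq (f e.1, h, e.2) | e <- E].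

Lemma letters_cat (X H : Type) (f : X -> H) (h : H) E F :
  letters f h (E ++ F) = letters f h E ++ letters f h F.
Proof. exact: map_cat. Qed.

Lemma surgery_lw (X : finType) (E : seq (X * bool)) g h :
  surgery_word E g h = lw (zip (map g (iota 0 (size E))) (letters Some None E)) h.
Proof.
rewrite /surgery_word; move: (iota 0 _) => s.
by case: h => [x|]; elim: s E => [|a s IH] [|e E] //=; rewrite lw_cons /piece -IH //=;
  case: ifP; rewrite (inj_eq Some_inj) => ->.
Qed.

Lemma tree_trivial (l : nat) (t : wtree 'I_l) r : P l ->
  perm_eq (tails t) (enum 'I_l) ->
  aeq n P (letters Some None (expansion r t)) [::].
Proof.
move=> Pl pt T lT wT; apply: ceq_sym; apply: ceq_step.
- exact: wf_dg.
- exact: wf_dg.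
right; exists l => //; exists T, r, t, (addn (bound T)); split=> //.
apply: eq_fill => h; rewrite surgery_lw /labelled size_map; congr lw; congr zip.
by rewrite -iotaDl addn0.
Qed.

Lemma tree_letters (H : finType) (l : nat) (t : wtree 'I_l) r (f : 'I_l -> H) h :
  P l -> perm_eq (tails t) (enum 'I_l) -> (forall i, f i != h) ->
  aeq n P (letters f h (expansion r t)) [::].
Proof.
move=> Pl pt fh.
pose phi (x : option 'I_l) := if x is Some i then f i else h.
have := aeq_map (phi := phi) _ _ (tree_trivial r Pl pt).
rewrite /letters -map_comp; apply=> // a /mapP [e _ -> /=] [i|//] /= e'.
by have := fh i; rewrite e' eqxx.
Qed.
End Trees.

(** * Commutators of arrow words *)

Section Algebra.
Variables (n : nat) (P : nat -> Prop) (H : finType).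
Implicit Types (A B C X Y Z : seq (arrow H)) (x y z t h w : H).
Local Notation "A == B" := (aeq n P A B).
Local Notation com := (com n P).

Definition comm A B := A ++ B ++ inv A ++ inv B.

Lemma inv_comm A B : inv (comm A B) = comm B A.
Proof. by rewrite /comm !inv_cat !invK -!catA. Qed.

#[export] Instance comm_proper :
  Proper (aeq n P (H:=H) ==> aeq n P (H:=H) ==> aeq n P (H:=H)) comm.
Proof. by move=> A A' e B B' e'; rewrite /comm e e'. Qed.

Lemma com_comm A B C : com A C -> com B C -> com (comm A B) C.
Proof.
move=> hA hB; apply: com_catl => //; apply: com_catl => //.
by apply: com_catl; apply: com_invl.
Qed.

Lemma commE A B : comm A B ++ B ++ A == A ++ B.
Proof.
rewrite /comm -!catA [inv B ++ _]catA aeq_invl /=.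
by rewrite aeq_invl cats0.
Qed.

Lemma comm_com A B : com A B -> comm A B == [::].
Proof.
move=> c; apply: (@aeq_cancelr _ _ _ (B ++ A)); rewrite commE; exact: c.
Qed.

Lemma com_commE A B : comm A B == [::] -> com A B.
Proof. by move=> e; have := commE A B; rewrite e /= => h; apply: aeq_sym. Qed.

Lemma mul_split A A' B B' : com A' B -> (A ++ A') ++ (B ++ B') == (A ++ B) ++ (A' ++ B').
Proof.
move=> c; rewrite -!catA; apply: aeq_cat => //.
by rewrite !catA; apply: aeq_cat => //.
Qed.

Lemma inv_split A A' : com A A' -> inv (A ++ A') == inv A ++ inv A'.
Proof.
by rewrite inv_cat => c; apply: com_invl; apply: com_invr; apply: com_sym.
Qed.

Lemma comm_split X X' Y Y' : com X X' -> com X Y' -> com Y X' -> com Y Y' ->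
  comm (X ++ X') (Y ++ Y') == comm X Y ++ comm X' Y'.
Proof.
move=> xx xy yx yy; rewrite {1}/comm (inv_split xx) (inv_split yy).
have e1 : (X ++ X') ++ (Y ++ Y') == (X ++ Y) ++ (X' ++ Y').
  by apply: mul_split; apply: com_sym.
have e2 : (inv X ++ inv X') ++ (inv Y ++ inv Y') == (inv X ++ inv Y) ++ (inv X' ++ inv Y').
  by apply: mul_split; apply: com_invl; apply: com_invr; apply: com_sym.
have e3 : ((X ++ Y) ++ (X' ++ Y')) ++ (inv X ++ inv Y) ++ (inv X' ++ inv Y') ==
    comm X Y ++ comm X' Y'.
  rewrite mul_split; first by rewrite /comm -!catA.
  by apply: com_sym; apply: com_catl; apply: com_invl; apply: com_catr.
by rewrite -e3 -e1 -e2 -!catA.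
Qed.

(* If v acts on Y by a central factor, it fixes the commutator of Y and X. *)
Lemma com_comm_twist v X Y Z : com v X -> v ++ Y == Z ++ Y ++ v ->
  com Z X -> com Z Y -> com v (comm X Y).
Proof.
move=> vX vY ZX ZY.
have vYi : v ++ inv Y == inv Y ++ inv Z ++ v.
  apply: (@aeq_cancell _ _ _ (Z ++ Y)); apply: (@aeq_cancelr _ _ _ Y).
  rewrite -!catA aeq_invl cats0 -vY [Y ++ inv Y ++ _]catA aeq_invr /=.
  by rewrite [Z ++ inv Z ++ _]catA aeq_invr.
rewrite /com /comm catA (vX : v ++ X == X ++ v) -catA.
rewrite [v ++ Y ++ _]catA vY -!catA [v ++ inv X ++ _]catA.
rewrite (com_invr vX : v ++ inv X == inv X ++ v) -[(inv X ++ v) ++ _]catA vYi.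
apply: aeq_cat => //.
have -> : Z ++ Y ++ inv X ++ inv Y ++ inv Z ++ v = (Z ++ (Y ++ inv X ++ inv Y) ++ inv Z) ++ v.
  by rewrite -!catA.
have c : com Z (Y ++ inv X ++ inv Y).
  by apply: com_catr => //; apply: com_catr; apply: com_invr.
rewrite [Z ++ _]catA (c : Z ++ _ == _) -[(_ ++ Z) ++ _]catA aeq_invr cats0.
by rewrite -!catA.
Qed.

Lemma comm_invl X Y : com X (comm Y X) -> comm (inv X) Y == comm Y X.
Proof.
move=> c; apply: (@aeq_cancell _ _ _ X); rewrite (c : X ++ _ == _) /comm invK.
by rewrite -!catA [X ++ inv X ++ _]catA aeq_invr aeq_invl cats0.
Qed.

Lemma comm_invr X Y : com Y (comm Y X) -> comm X (inv Y) == comm Y X.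
Proof.
move=> c; apply: (@aeq_cancell _ _ _ Y); rewrite (c : Y ++ _ == _) /comm invK.
by rewrite -!catA.
Qed.

(** * Arrows with distinct endpoints *)

(** By [aeq_R3] the arrow a = (t, h) commutes with the product of b = (y, t) and c = (y, h).
    Exchanging it with b alone costs a commutator with the inverse of c, that is, a tree with tails
    at [y] and [t] and head at [h]. *)
Lemma R3_swap y t h s s' : y != t -> y != h -> t != h ->
  [:: (y, t, s)] ++ [:: (t, h, s')] ==
  comm [:: (y, h, ~~ s)] [:: (t, h, s')] ++ [:: (t, h, s')] ++ [:: (y, t, s)].
Proof.
move=> yt yh th; set b := [:: (y, t, s)]; set a := [:: (t, h, s')].
pose c := [:: (y, h, s)].
have bc : com b c by apply: com_disj.
have r3 : com (b ++ c) a by apply: aeq_R3.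
have -> : [:: (y, h, ~~ s)] = inv c by [].
rewrite /comm invK -!catA [inv a ++ _]catA aeq_invl cat0s.
apply: (@aeq_cancell _ _ _ c); rewrite [c ++ inv c ++ _]catA aeq_invr cat0s.
rewrite -(bc : b ++ c == c ++ b) -(r3 : (b ++ c) ++ a == a ++ b ++ c).
by rewrite catA (bc : b ++ c == c ++ b).
Qed.

Section Degree2.
Hypothesis P2 : P 2.
Lemma com_heads2 x y h s s' : x != h -> y != h -> com [:: (x, h, s)] [:: (y, h, s')].
Proof.
move=> xh yh; apply: com_commE.
(* With the head attached from the right, the right subtree comes first in the expansion and a tail
   with twist [tw] gets the sign [~~ tw]; this explains the order and the negations. *)
pose tr := Vertex false (Tail (~~ s') (@Ordinal 2 0 isT)) (Tail (~~ s) (@Ordinal 2 1 isT)).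
have pt : perm_eq (tails tr) (enum 'I_2).
  by apply: uniq_perm; rewrite ?enum_uniq // => -[[|[|//]] hi]; rewrite mem_enum.
have := tree_letters true P2 pt (f := fun i => if i == ord0 then y else x) (h := h).
rewrite /letters /= !negbK; apply.
by case=> [[|[|//]] hi].
Qed.

Lemma com_chain2 y t h s s' : y != t -> y != h -> t != h ->
  com [:: (y, t, s)] [:: (t, h, s')].
Proof.
move=> yt yh th; rewrite /com R3_swap // comm_com //; exact: com_heads2.
Qed.
End Degree2.

Section Degree3.
Hypothesis P3 : P 3.

(** The commutator of the arrow with the tree is itself the expansion of a tree with three tails. *)
Lemma com_tree_heads x y z h s1 s2 s3 : x != h -> y != h -> z != h ->
  com [:: (z, h, s3)] (comm [:: (x, h, s1)] [:: (y, h, s2)]).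
Proof.
move=> xh yh zh; apply: com_commE; rewrite {1}/comm inv_comm.
pose tr := Vertex false (Vertex false (Tail (~~ s2) (@Ordinal 3 0 isT))
   (Tail (~~ s1) (@Ordinal 3 1 isT))) (Tail (~~ s3) (@Ordinal 3 2 isT)).
have pt : perm_eq (tails tr) (enum 'I_3).
  by apply: uniq_perm; rewrite ?enum_uniq // => -[[|[|[|//]]] hi]; rewrite mem_enum.
have := tree_letters true P3 pt (f := fun i => nth z [:: y; x] i) (h := h).
rewrite /letters /= !negbK; apply.
by case=> [[|[|[|//]]] hi].
Qed.

(** Each arrow into [h], doubled by a parallel arrow into [w], commutes with (h, w) by Reidemeister
    III. The commutator of the doubled arrows is the given tree times its copy with head at [w], and
    the copy commutes with (h, w) by [com_tree_heads]. *)
Lemma com_tree_out x y h w s1 s2 s3 : x != h -> y != h -> x != w -> y != w -> h != w ->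
  com [:: (h, w, s3)] (comm [:: (x, h, s1)] [:: (y, h, s2)]).
Proof.
move=> xh yh xw yw hw.
set c := [:: _]; set X := [:: (x, h, s1)]; set Y := [:: (y, h, s2)].
pose X' := [:: (x, w, s1)]; pose Y' := [:: (y, w, s2)].
have hx : com (X ++ X') c by apply: aeq_R3.
have hy : com (Y ++ Y') c by apply: aeq_R3.
have hs : comm (X ++ X') (Y ++ Y') == comm X Y ++ comm X' Y'.
  by apply: comm_split; apply: com_disj.
have hc : com (comm X' Y') c by apply: com_sym; apply: com_tree_heads.
have e : comm X Y == comm (X ++ X') (Y ++ Y') ++ inv (comm X' Y').
  by rewrite hs -catA aeq_invr cats0.
rewrite e; apply: com_sym; apply: com_catl; first exact: com_comm.
exact: com_invl.
Qed.

(** The arrow into the tail does not commute with X, but its product with the parallel arrow b = (z,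
    h) does, by Reidemeister III. That product changes Y by the commutator of b and Y, which
    commutes with all arrows concerned, so [com_comm_twist] applies; then b is removed again. *)
Lemma com_tree_tail x y z h s1 s2 s3 : x != h -> y != h -> z != h -> z != x -> y != x ->
  com [:: (z, x, s3)] (comm [:: (x, h, s1)] [:: (y, h, s2)]).
Proof.
move=> xh yh zh zx yx.
set a := [:: _]; set X := [:: (x, h, s1)]; set Y := [:: (y, h, s2)].
pose b := [:: (z, h, s3)].
have hx : h != x by rewrite eq_sym.
have aY : com a Y by apply: com_disj => //; rewrite eq_sym.
have ab : com a b by apply: com_disj => //; rewrite eq_sym.
have vX : com (a ++ b) X by apply: aeq_R3.
have cb : com b (comm X Y) by apply: com_tree_heads.
have aZ : com a (comm b Y) by apply: com_sym; apply: com_comm; apply: com_sym.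
have vY : (a ++ b) ++ Y == comm b Y ++ Y ++ (a ++ b).
  rewrite -catA -[b ++ Y]commE [a ++ comm b Y ++ _]catA (aZ : a ++ _ == _) -!catA.
  by rewrite [a ++ Y ++ _]catA (aY : a ++ Y == _) -catA.
have cv : com (a ++ b) (comm X Y).
  apply: (com_comm_twist vX vY); apply: com_sym; exact: com_tree_heads.
have e : a == (a ++ b) ++ inv b by rewrite -catA aeq_invr cats0.
rewrite e; apply: com_catl => //; exact: com_invl.
Qed.
End Degree3.
End Algebra.

(** * Moving a tree along the strands *)

Section Contexts.
Variables (n : nat) (H : finType).
Implicit Types T : context n H.

Lemma count_flatT T a : count a (flatT T) = (\sum_i count a (T i))%N.
Proof.
by rewrite /flatT count_flatten sumnE big_map /codom /image_mem big_map big_enum.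
Qed.

Lemma perm_flatT T T' : (forall i, perm_eq (T i) (T' i)) -> perm_eq (flatT T) (flatT T').
Proof.
move=> e; apply/permP => a; rewrite !count_flatT; apply: eq_bigr => i _.
exact/permP.
Qed.

Lemma linear_permT T T' : perm_eq (flatT T) (flatT T') ->
  linear_context T -> linear_context T'.
Proof.
move=> e /forallP l; apply/forallP => h; rewrite -(permP e); exact: l.
Qed.

Lemma perm_bT T T' : perm_eq (flatT T) (flatT T') -> perm_eq (bT T) (bT T').
Proof. by move=> e; apply: perm_pmap. Qed.

Lemma wf_permT T T' : perm_eq (flatT T) (flatT T') -> wfw (bT T) = wfw (bT T').
Proof. by move=> e; apply/perm_wfw/perm_bT. Qed.

Lemma once_disj T a i U x V : count a (flatT T) = 1%N -> T i = U ++ x :: V -> a x ->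
  [/\ ~~ has a U, ~~ has a V & forall j, j != i -> ~~ has a (T j)].
Proof.
move=> c1 e ax; have := c1; rewrite count_flatT (bigD1 i) //= e count_cat /= ax.
have h0 (s : seq (passage + H)) : (count a s == 0%N) = ~~ has a s.
  by rewrite has_count -eqn0Ngt.
rewrite addnCA -addnA add1n => -[] /eqP; rewrite !addn_eq0 !h0.
case/andP=> /andP [hU hV] /eqP s0; split=> // j ji; rewrite -h0.
by move/eqP: s0; rewrite sum_nat_eq0 => /forallP /(_ j); rewrite ji.
Qed.

Lemma bT_flat T : bT T = flatten [seq base (T i) | i <- enum 'I_n].
Proof.
rewrite /bT /flatT /codom /image_mem; elim: (enum 'I_n) => //= i s IH.
by rewrite base_cat IH.
Qed.

End Contexts.

Section HolePass.
Variables (n : nat) (P : nat -> Prop) (X : finType) (E : seq (X * bool)).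
Notation H := (option X).
Notation H2 := (option X + bool)%type.
Implicit Types T : context n H.
Local Notation tau := (letters Some None E).

(** The crossing to be passed becomes an arrow between two new holes, so that passing one of its
    ends turns into a commutation of arrow words. *)
Definition absb (a : nat) (x : passage + H) : passage + H2 :=
  match x with
  | inl p => if lbl p == a then inr (inr (over p)) else inl p
  | inr h => inr (inl h)
  end.
Definition absorb a T : context n H2 := [ffun i => map (absb a) (T i)].

Definition sphi (x : H) (o : bool) (h : H) : H2 := if h == x then inr o else inl h.

(** The hole [x] of the tree is put at the end [o] of a foreign arrow. Commutation with that arrow
    is exactly what it takes to push the hole past this end. *)
Definition mobile := forall x o s,
  com n P [:: (inr true, inr false, s)] (map (amap (sphi x o)) tau).

Lemma flatT_absorb a T : flatT (absorb a T) = map (absb a) (flatT T).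
Proof.
rewrite /flatT /codom /image_mem map_flatten; congr flatten; rewrite -[RHS]map_comp.
by apply: eq_map => i; rewrite /= ffunE.
Qed.

Lemma linear_absorb a T : linear_context T -> wfw (bT T) -> a \in map lbl (bT T) ->
  linear_context (absorb a T).
Proof.
move=> /forallP lT wT aT; apply/forallP => -[h|o]; rewrite -/(flatT _) flatT_absorb count_map.
  rewrite -(eqP (lT h)); apply/eqP/eq_count => -[p|h'] //=; by case: ifP.
have -> : count (preim (absb a) (pred1 (inr (inr o)))) (flatT T) =
    count_mem (a, o) (map key (bT T)).
  rewrite /bT; elim: (flatT T) => //= -[p|h] s -> //=; congr addn.
  by rewrite /key xpair_eqE; case: ifP => //= e; rewrite (inj_eq (@inr_inj _ _)).
case/andP: wT => uT mT; rewrite count_uniq_mem //.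
case/mapP: aT => p pT ->; suff -> : (lbl p, o) \in map key (bT T) by [].
apply/mapP; case: (eqVneq (over p) o) => [<-|e]; first by exists p.
exists (mate p); first exact: (allP mT).
by rewrite /key /=; case: (over p) o e => [] [].
Qed.

Variable mob : mobile.

Definition updT T i s : context n H := [ffun j => if j == i then s else T j].

Lemma perm_updT T i s : perm_eq (T i) s -> perm_eq (flatT T) (flatT (updT T i s)).
Proof.
by move=> e; apply: perm_flatT => j; rewrite ffunE; case: eqP => // ->.
Qed.

(** Both diagrams fill the context [T2], with the passed crossing as the last arrow or as the first
    one. Its other end is alone in its hole, where the order of the arrows is invisible. *)
Lemma hole_pass T i U x p V : linear_context T -> wfw (bT T) ->
  T i = U ++ inr x :: inl p :: V ->
  ceq P (dg T tau) (dg (updT T i (U ++ inl p :: inr x :: V)) tau).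
Proof.
move=> lT wT Ti; set T' := updT _ _ _.
have pT : perm_eq (flatT T) (flatT T').
  apply: perm_updT; rewrite Ti perm_cat2l.
  by rewrite -[[:: inr x, inl p & V]]/([:: inr x] ++ [:: inl p] ++ V) perm_catCA.
have lT' := linear_permT pT lT; have wT' : wfw (bT T') by rewrite -(wf_permT pT).
pose a := lbl p; pose o := over p; pose s := pos p.
have pin : p \in bT T by apply: (@mem_bT _ _ _ i); rewrite Ti mem_cat !inE eqxx !orbT.
have aT : a \in map lbl (bT T) by apply: map_f.
have lT2 := linear_absorb lT wT aT; set T2 := absorb a T in lT2.
pose arr : arrow H2 := (inr true, inr false, s).
pose B := labelled (bound T) tau; pose B2 := lmap (sphi x o) B.
have cx : count (pred1 (inr x)) (flatT T) = 1%N by apply/eqP/(forallP lT).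
have cp : count (pred1 (inl p)) (flatT T) = 1%N.
  have -> : count (pred1 (inl p)) (flatT T) = count_mem p (bT T).
    by rewrite /bT; elim: (flatT T) => //= -[q|h] r -> //=.
  rewrite count_uniq_mem ?pin //; apply: (@map_uniq _ _ key); by case/andP: wT.
have Ti' : T i = (U ++ [:: inr x]) ++ inl p :: V by rewrite Ti -catA.
have [xU /= xV xj] := once_disj cx Ti (eqxx _).
have [pU pV pj] := once_disj cp Ti' (eqxx _).
have {}pU : ~~ has (pred1 (inl p)) U by move: pU; rewrite has_cat negb_or => /andP [].
have lwi A h : h != x -> lw (lmap (sphi x o) A) (inl h) = lw A h.
  move=> hx; elim: A => //= q A IH; rewrite !lw_cons IH; congr cat.
  by rewrite /piece /= /sphi; case: (eqVneq q.2.1.1 x) => [->|_];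
     case: (eqVneq q.2.1.2 x) => [->|_]; rewrite ?(eq_sym x) ?(negbTE hx).
have lwx A : lw (lmap (sphi x o) A) (inl x) = [::].
  elim: A => //= q A IH; rewrite !lw_cons IH cats0.
  rewrite /piece /= /sphi; case: (eqVneq q.2.1.1 x) => [_|/negbTE e1];
     by case: (eqVneq q.2.1.2 x) => [_|/negbTE e2] //=; rewrite ?(inj_eq (@inl_inj _ _)) ?e1 ?e2.
have lwo A : lw (lmap (sphi x o) A) (inr o) = lw A x.
  elim: A => //= q A IH; rewrite !lw_cons IH; congr cat.
  by rewrite /piece /= /sphi; case: (eqVneq q.2.1.1 x) => _;
     case: (eqVneq q.2.1.2 x) => _; rewrite ?eqxx.
have lwn A : lw (lmap (sphi x o) A) (inr (~~ o)) = [::].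
  elim: A => //= q A IH; rewrite !lw_cons IH cats0.
  have no : (inr o == inr (~~ o) :> H2) = false.
    by rewrite (inj_eq (@inr_inj _ _)); case: (o).
  rewrite /piece /= /sphi; case: (eqVneq q.2.1.1 x) => _;
     by case: (eqVneq q.2.1.2 x) => _; rewrite ?no.
have lwa h : lw [:: (a, arr)] (inl h) = [::] by [].
have lwb b : lw [:: (a, arr)] (inr b) = [:: Passage a s b] by case: b.
have fE (w : H2 -> word) r :
    (forall h, h != x -> w (inl h) = lw B h) -> w (inr (~~ o)) = [:: mate p] ->
    {subset r <= flatT T} -> ~~ has (pred1 (inr x)) r -> ~~ has (pred1 (inl p)) r ->
    fillw r (lw B) = fillw (map (absb a) r) w.
  move=> w1 w2 sr xr pr; elim: r sr xr pr => //= y r IH sr.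
  rewrite !negb_or => /andP [yx xr] /andP [yp pr]; rewrite /fillw /= -!/(fillw _ _).
  rewrite IH //; last by move=> z zr; apply: sr; rewrite inE zr orbT.
  congr cat; case: y sr yx yp => [q|h] sr /= yx yp; last by rewrite w1.
  case: ifP => // /eqP e; have qin : q \in bT T by rewrite mem_base; apply: sr; rewrite mem_head.
  case: (wfw_lbl wT pin qin (esym e)) => E2; first by rewrite E2 eqxx in yp.
  by rewrite E2 /= w2.
have fT C : (forall h, h != x -> lw C (inl h) = lw B h) ->
    lw C (inr (~~ o)) = [:: mate p] ->
    forall y1 y2, ((y1, y2) = (inr x, inl p) \/ (y1, y2) = (inl p, inr x)) ->
    lw C (inl x) ++ lw C (inr o) = fillw [:: y1; y2] (lw B) ->
    fill (updT T i (U ++ y1 :: y2 :: V)) (lw B) = fill T2 (lw C).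
  move=> w1 w2 y1 y2 ys c1; apply/ffunP => j; rewrite !ffunE -!/(fillw _ _).
  have sj j' : {subset T j' <= flatT T}.
    by move=> z zj; apply/flattenP; exists (T j'); rewrite ?codom_f.
  case: (eqVneq j i) => [->|ji]; last by apply: fE => //; [exact: xj | exact: pj].
  have -> : fillw (U ++ [:: y1, y2 & V]) (lw B) =
      fillw U (lw B) ++ fillw [:: y1; y2] (lw B) ++ fillw V (lw B).
    by rewrite -!fillw_cat.
  have -> : fillw (map (absb a) (T i)) (lw C) = fillw (map (absb a) U) (lw C) ++
      (lw C (inl x) ++ lw C (inr o)) ++ fillw (map (absb a) V) (lw C).
    by rewrite Ti map_cat fillw_cat /= eqxx /fillw /= -catA.
  rewrite c1; congr (_ ++ (_ ++ _)).
  - by apply: fE => // z zU; apply: (sj i); rewrite Ti mem_cat zU.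
  - by apply: fE => // z zV; apply: (sj i); rewrite Ti mem_cat !inE zV !orbT.
have pp : Passage a s o = p by rewrite /a /s /o; case: (p).
have pm : Passage a s (~~ o) = mate p by [].
have E1 : fill T (lw B) = fill T2 (lw (B2 ++ [:: (a, arr)])).
  have {1}-> : T = updT T i (U ++ inr x :: inl p :: V).
    by apply/ffunP => j; rewrite ffunE; case: eqP => // ->.
  apply: fT; try by left.
  - by move=> h hx; rewrite lw_cat lwi // lwa cats0.
  - by rewrite lw_cat lwn lwb pm.
  - by rewrite !lw_cat lwx lwo lwb lwa pp /fillw /= ?cats0.
have E2 : fill T' (lw B) = fill T2 (lw ((a, arr) :: B2)).
  rewrite -cat1s; apply: fT; try by right.
  - by move=> h hx; rewrite lw_cat lwi // lwa.
  - by rewrite lw_cat lwn lwb pm.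
  - by rewrite !lw_cat lwx lwo lwb lwa pp /fillw /= ?cats0.
have bnd : bound T' = bound T.
  by rewrite /bound (perm_big _ (perm_map lbl (perm_bT pT))).
have W1 : wf_code (fill T (lw B)) by apply: wf_labelled.
have W2 : wf_code (fill T' (lw B)) by apply: wf_labelled; rewrite ?bnd.
rewrite /dg bnd -/B E1 E2 in W1 W2 *; apply: aeq_use => //.
rewrite /= /unzip2 map_cat -!/(unzip2 _) unzip2_lmap labelledK /=.
exact/aeq_sym/(mob x o s).
Qed.
End HolePass.

Section Normal.
Variables (n : nat) (P : nat -> Prop) (X : finType) (E : seq (X * bool)).
Notation H := (option X).
Implicit Types T : context n H.
Local Notation tau := (letters Some None E).
Hypothesis mob : mobile n P E.

Definition reach T T' := linear_context T -> wfw (bT T) ->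
  [/\ linear_context T', wfw (bT T') & ceq P (dg T tau) (dg T' tau)].

Lemma reach_refl T : reach T T.
Proof. by move=> lT wT; split=> //; apply: ceq_refl; apply: wf_dg. Qed.
Lemma reach_trans T' T T'' : reach T T' -> reach T' T'' -> reach T T''.
Proof.
move=> r r' lT wT; have [l1 w1 e1] := r lT wT; have [l2 w2 e2] := r' l1 w1.
by split=> //; apply: ceq_trans e2.
Qed.

Lemma updT_same T i s : T i = s -> updT T i s = T.
Proof. by move=> e; apply/ffunP => j; rewrite ffunE; case: eqP => // ->. Qed.
Lemma updT_upd T i s s' : updT (updT T i s) i s' = updT T i s'.
Proof. by apply/ffunP => j; rewrite !ffunE; case: eqP. Qed.
Lemma updTi T i s : updT T i s i = s.
Proof. by rewrite ffunE eqxx. Qed.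

Lemma reach_pass T i U x p V : T i = U ++ inr x :: inl p :: V ->
  reach T (updT T i (U ++ inl p :: inr x :: V)).
Proof.
move=> e lT wT.
have pT : perm_eq (flatT T) (flatT (updT T i (U ++ inl p :: inr x :: V))).
  apply: perm_updT; rewrite e perm_cat2l.
  by rewrite -[[:: inr x, inl p & V]]/([:: inr x] ++ [:: inl p] ++ V) perm_catCA.
split; first exact: linear_permT pT lT.
  by rewrite -(wf_permT pT).
exact: hole_pass.
Qed.

Lemma reach_passes T i U x ps V : T i = U ++ inr x :: map inl ps ++ V ->
  reach T (updT T i (U ++ map inl ps ++ inr x :: V)).
Proof.
elim: ps T U => [|p ps IH] T U e; first by rewrite updT_same //; exact: reach_refl.
have e' := reach_pass e; apply: (reach_trans e').
set T1 := updT _ _ _; have := IH T1 (U ++ [:: inl p]).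
rewrite updTi -!catA /= => /(_ erefl); by rewrite updT_upd.
Qed.

Definition nf (s : seq (passage + H)) := map inl (base s) ++ map (@inr _ _) (holes s).

Lemma base_nf s : base (nf s) = base s.
Proof. by rewrite /nf base_cat base_inl base_inr cats0. Qed.
Lemma holes_nf s : holes (nf s) = holes s.
Proof. by rewrite /nf holes_cat holes_inl holes_inr. Qed.

Lemma reach_strand T i U s : T i = U ++ s -> reach T (updT T i (U ++ nf s)).
Proof.
elim: s T U => [|[p|x] s IH] T U e; first by rewrite updT_same //; exact: reach_refl.
  have := IH T (U ++ [:: inl p]); rewrite -!catA /=; exact.
have := IH T (U ++ [:: inr x]); rewrite -!catA /= => /(_ e) h.
apply: (reach_trans h); set T1 := updT _ _ _.
have e1 : T1 i = U ++ inr x :: map inl (base s) ++ map inr (holes s) by rewrite updTi.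
by have := reach_passes e1; rewrite updT_upd.
Qed.

Definition nfT T : context n H := [ffun i => nf (T i)].

Lemma reach_nf T : reach T (nfT T).
Proof.
have G (s : seq 'I_n) : reach T [ffun i => if i \in s then nf (T i) else T i].
  elim: s => [|i s IH].
    rewrite (_ : [ffun _ => _] = T); first exact: reach_refl.
    by apply/ffunP => i; rewrite ffunE.
  apply: (reach_trans IH); set T1 := [ffun _ => _].
  have := @reach_strand T1 i [::] (T1 i) erefl.
  rewrite (_ : updT _ _ _ = [ffun j => if j \in i :: s then nf (T j) else T j]) //.
  apply/ffunP => j; rewrite !ffunE inE; case: (eqVneq j i) => [->|_] //=.
  by case: ifP => // _; rewrite /nf base_nf holes_nf.
have := G (enum 'I_n); rewrite (_ : [ffun _ => _] = nfT T) //.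
by apply/ffunP => i; rewrite !ffunE mem_enum.
Qed.
End Normal.

Lemma uniq_holes n (H : finType) (T : context n H) i : linear_context T -> uniq (holes (T i)).
Proof.
move=> /forallP lT; apply: count_mem_uniq => h; rewrite count_holes.
have := lT h; rewrite -/(flatT _) count_flatT (bigD1 i) //= => /eqP e.
have : (count_mem (inr h) (T i) <= 1)%N by rewrite -e leq_addr.
rewrite mem_holes -has_pred1 has_count.
by case: count => [|[]].
Qed.

(** * Stacking words at the ends of the strands *)

Section Stack.
Variables (n : nat) (P : nat -> Prop).
(* The holes (i, Some true), (i, None) and (i, Some false) lie, in this order,
   at the end of the strand i: tails in front of the heads, heads, tails behind. *)
Definition eh : finType := ('I_n * option bool)%type.
Definition eholes (i : 'I_n) : seq eh := [:: (i, Some true); (i, None); (i, Some false)].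

Definition TM (M : code n) : context n eh :=
  [ffun i => map inl (M i) ++ map inr (eholes i)].

Definition stack (M : code n) (W : seq (arrow eh)) : code n := dg (TM M) W.

Lemma linear_TM M : linear_context (TM M).
Proof.
apply/forallP => -[i b]; rewrite -/(flatT _) count_flatT (bigD1 i) //= big1 => [|j ji].
  rewrite addn0 ffunE count_cat -!count_holes holes_inl holes_inr /eholes /=.
  by rewrite !xpair_eqE eqxx /=; case: b => [[]|].
rewrite ffunE count_cat -!count_holes holes_inl holes_inr /eholes /=.
by rewrite !xpair_eqE (negbTE ji).
Qed.

Lemma bT_TM M : bT (TM M) = passages M.
Proof.
rewrite bT_flat /passages /codom /image_mem; congr flatten.
by apply: eq_map => i; rewrite ffunE base_cat base_inl base_inr cats0.
Qed.

Lemma wf_stack M W : wf_code M -> wf_code (stack M W).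
Proof. by move=> wM; apply: wf_dg; rewrite ?bT_TM //; exact: linear_TM. Qed.

Lemma stack_aeq M W W' : wf_code M -> aeq n P W W' -> ceq P (stack M W) (stack M W').
Proof. by move=> wM; apply; rewrite ?bT_TM //; exact: linear_TM. Qed.

Lemma stack_nil M : stack M [::] = M.
Proof.
rewrite /stack dg_nil; apply/ffunP => i; rewrite !ffunE -/(fillw _ _).
by rewrite fillw_nil base_cat base_inl base_inr cats0.
Qed.

Section Canonical.
Variables (X : finType) (E : seq (X * bool)).
Notation H := (option X).
Local Notation tau := (letters Some None E).
Hypothesis mob : mobile n P E.

(* phi sends the holes of T to holes at the ends of the same strands, in the
   same order up to permuting tails. *)
Definition end_position (T : context n H) (phi : H -> eh) := [/\
  (phi None).2 = None, (forall x, (phi (Some x)).2 <> None),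
  (forall h i, h \in holes (T i) -> (phi h).1 = i) &
  (forall i, holes (T i) = flatten [seq [seq h <- holes (T i) | phi h == e] | e <- eholes i])].

(** Mobility gathers the holes of each strand at its end without changing their order. There they
    form the fibres of [phi], and only holes of tails get merged. *)
Lemma canonical T phi : linear_context T -> wfw (bT T) -> end_position T phi ->
  ceq P (dg T tau) (stack (fill T (fun=> [::])) (map (amap phi) tau)).
Proof.
move=> lT wT [p0 px pi ph].
have [lN wN eN] := reach_nf mob lT wT; apply: (ceq_trans eN).
pose M := fill T (fun=> [::]).
pose f e := [seq h <- holes (T e.1) | phi h == e].
have hT h : exists i, h \in holes (T i).
  have : h \in holes (flatT T) by rewrite (perm_mem (linear_perm lT)) mem_enum.
  by rewrite mem_holes => /flattenP [s /codomP [i ->] hs]; exists i; rewrite mem_holes.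
have uf e : uniq (f e) by rewrite filter_uniq // uniq_holes.
have mf e h : (h \in f e) = (phi h == e).
  rewrite mem_filter; case: eqP => //= <-; have [i hi] := hT h.
  by rewrite (pi _ _ hi).
have lM := linear_TM M.
have nE : nfT T = subT (TM M) (fun e => map inr (f e)).
  apply/ffunP => i; rewrite !ffunE /nf -/(fillw _ _) fillw_nil subw_cat; congr cat.
    by elim: (base (T i)) => //= p s IH; rewrite /subw /= -/(subw _ _) -IH.
  by rewrite {1}ph /subw /= !cats0 !map_cat.
have hJ : headinj phi tau.
  move=> a /mapP [q _ ->] /= [x|//] e; have := px x; by rewrite e p0.
have := fill_merge P uf mf lM (A := labelled (bound (nfT T)) tau).
rewrite labelledK -nE => /(_ hJ (wf_dg tau lN wN)) F.
apply: (ceq_trans F); apply: (ceq_trans (dgP P lM (ceq_wfr F))).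
rewrite unzip2_lmap labelledK; apply: ceq_refl; apply: wf_stack.
have := wT; rewrite wf_codeE bT_flat /passages /codom /image_mem.
rewrite (_ : map _ _ = [seq base (T i) | i <- enum 'I_n]) //.
by apply: eq_map => i; rewrite /M ffunE -/(fillw _ _) fillw_nil.
Qed.
End Canonical.
End Stack.

(** * Stacking is compatible with the equivalences *)

Section StackCompat.
Variables (n : nat) (P : nat -> Prop) (W : seq (arrow (eh n))).
Implicit Types C D : code n.

(** In [stack] the labels of [W] depend on the diagram below, which a move changes. With even labels
    for the diagram and odd ones for [W], a move below is literally a move of the stacked
    diagram. *)
Let Wodd := [seq (q.1.*2.+1, q.2) | q <- labelled 0 W].
Definition stackd C := fill (TM (relabel double C)) (lw Wodd).

Definition spread b l := if (l < b)%N then l.*2 else (l - b).*2.+1.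
Lemma spread_inj b : injective (spread b).
Proof.
move=> x y; rewrite /spread; case: ltnP => hx; case: ltnP => hy.
- exact: double_inj.
- by move/(congr1 odd); rewrite /= !odd_double.
- by move/(congr1 odd); rewrite /= !odd_double.
- move=> [] /double_inj e; by rewrite -(subnK hx) -(subnK hy) e.
Qed.

Lemma stack_stackd C : wf_code C -> ceq P (stack C W) (stackd C).
Proof.
move=> wC; pose g := spread (bound (TM C)).
have -> : stackd C = relabel g (stack C W).
  apply/ffunP => i; rewrite relabelE /stack /dg !ffunE -!/(fillw _ _) map_fillw.
  rewrite map_cat -!map_comp !fillw_cat; congr cat.
    have fE (g1 : passage -> passage) : fillw (map (fun p => inl (g1 p)) (C i)) =
        fun _ : eh n -> word => map g1 (C i).
      by apply/funext => w; rewrite map_comp fillw_inl.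
    rewrite (fE (fun p => Passage (lbl p).*2 (pos p) (over p))) (fE (rlp g)).
    apply/eq_in_map => p pC.
    rewrite /rlp /g /spread ifT //; apply: bound_gt; rewrite bT_TM.
    by apply: map_f; apply/mem_passages; exists i.
  rewrite (eq_map (_ : _ =1 inr)) //; apply: eq_fillw => e _.
  rewrite -lw_map_lbl; congr lw; rewrite /Wodd /labelled.
  rewrite -[X in _ = map _ (zip (iota X _) _)]addn0 (iotaDl (bound _)) -/g.
  elim: (iota 0 (size W)) {2 4}W => [|a s IH] V; first by case: V.
  case: V => [|b V] //=; rewrite IH; congr cons.
  by rewrite /g /spread ltnNge leq_addr /= addKn.
by apply: ceq_relabel; [exact: wf_stack | move=> x y _ _; exact: spread_inj].
Qed.

Section Lift.
Variables (H : finType) (T : context n H).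
Definition liftT : context n H := [ffun i =>
  map (fun x => if x is inl p then inl (rlp double p) else x) (T i)
  ++ map inl (fillw (map inr (eholes i)) (lw Wodd))].

Lemma linear_lift : linear_context T -> linear_context liftT.
Proof.
move=> /forallP lT; apply/forallP => h; rewrite -(eqP (lT h)) -!/(flatT _) !count_flatT.
apply/eqP; apply: eq_bigr => i _; rewrite ffunE count_cat -[X in (_ + X)%N]count_holes.
by rewrite holes_inl addn0 count_map; apply: eq_count => -[].
Qed.

Lemma stackd_fill w : stackd (fill T w) = fill liftT (fun h => map (rlp double) (w h)).
Proof.
apply/ffunP => i; rewrite !ffunE -!/(fillw _ _) !fillw_cat !fillw_inl; congr cat.
by rewrite map_fillw.
Qed.
End Lift.

Lemma stackd_move C D : welded_move C D -> welded_move (stackd C) (stackd D).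
Proof.
case=> [{}C g gi|T a s o lT|T a b s d lT|T a b c sa sb sc d lT|T a b sa sb lT].
- pose g' l := if odd l then l else (g l./2).*2.
  have g'i : injective g'.
    move=> x y; rewrite /g'; case: ifP => ox; case: ifP => oy //.
    + by move=> e; move: ox; rewrite e odd_double.
    + by move=> e; move: oy; rewrite -e odd_double.
    + move/double_inj/gi => e; by rewrite -(odd_double_half x) -(odd_double_half y) ox oy e.
  have -> : stackd (relabel g C) = relabel g' (stackd C); last exact: Relabel.
  apply/ffunP => i; rewrite relabelE !ffunE -!/(fillw _ _) !fillw_cat map_cat.
  rewrite !fillw_inl -!map_comp; congr cat.
    apply: eq_map => p; rewrite /rlp /= /g' odd_double doubleK //.
  rewrite map_fillw -map_comp (eq_map (_ : _ =1 inr)) //.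
  apply: eq_fillw => e _; rewrite -lw_map_lbl; congr lw; rewrite /Wodd -map_comp.
  by apply: eq_map => q; rewrite /g' /= odd_double.
- rewrite !stackd_fill; exact: Reid1 (linear_lift lT).
- rewrite !stackd_fill.
  rewrite (_ : fill (liftT T) _ = fill (liftT T) (fun o =>
         if o then [:: Passage a.*2 s true; Passage b.*2 (~~ s) true]
         else order2 d (Passage a.*2 s false) (Passage b.*2 (~~ s) false))).
    exact: Reid2 (linear_lift lT).
  by apply: eq_fill => -[] //=; rewrite /order2; case: d.
- rewrite !stackd_fill.
  have E d' : fill (liftT T) (fun h => map (rlp double) (R3_word a b c sa sb sc d' h)) =
      fill (liftT T) (R3_word a.*2 b.*2 c.*2 sa sb sc d').
    by apply: eq_fill => -[[|[|[|//]]] hi]; rewrite /R3_word /order2 /=; case: ifP.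
  rewrite !E; exact: Reid3 (linear_lift lT).
- rewrite !stackd_fill; exact: OverCommute (linear_lift lT).
Qed.

Lemma stackd_surgery l C D : surgery l C D -> surgery l (stackd C) (stackd D).
Proof.
case=> T [r [t [g [lT pt -> ->]]]]; exists (liftT T), r, t, (double \o g).
split=> //; first exact: linear_lift.
- by rewrite stackd_fill.
- rewrite stackd_fill; apply: eq_fill => h; rewrite /surgery_word.
  by case: h => [x|]; rewrite -map_comp.
Qed.

Lemma stack_ceq C D : ceq P C D -> ceq P (stack C W) (stack D W).
Proof.
case=> h [h' e].
suff G (L L' : diagram n) : clos_refl_sym_trans _ (dstep P) L L' ->
    ceq P (stackd L) (stackd L').
  apply: (ceq_trans (stack_stackd h)); apply: ceq_trans (ceq_sym (stack_stackd h')).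
  exact: G e.
elim=> {C D h h' e L L'} [L L' st|L|L L' _|L L' L'' _ e _ e'].
- apply: ceq_step; try by apply: ceq_wfr (stack_stackd _); apply: wf_dcode.
  case: st => [m|[l Pl s]]; first by left; apply: stackd_move.
  by right; exists l => //; apply: stackd_surgery.
- by apply: ceq_refl; apply: ceq_wfr (stack_stackd _); apply: wf_dcode.
- exact: ceq_sym.
- exact: ceq_trans e e'.
Qed.
End StackCompat.

(** * Trees at the ends of the strands *)

Section Mobile.
Variables (n : nat) (P : nat -> Prop).

Lemma map_comm (H H' : finType) (phi : H -> H') A B :
  map (amap phi) (comm A B) = comm (map (amap phi) A) (map (amap phi) B).
Proof.
by rewrite /comm !map_cat /inv -!map_rev -!map_comp.
Qed.

Definition commw (X : Type) (x : X) s y s' : seq (X * bool) :=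
  [:: (x, s); (y, s'); (x, ~~ s); (y, ~~ s')].

Lemma letters_commw (X : Type) (H : finType) (f : X -> H) h x s y s' :
  letters f h (commw x s y s') = comm [:: (f x, h, s)] [:: (f y, h, s')].
Proof. by []. Qed.

(** The encounters are: a head with an over-passage ([com_tree_out]) or an under-passage
    ([com_tree_heads]), and a tail with an over-passage (OC) or an under-passage
    ([com_tree_tail]). *)
Lemma mobile_comm (X : finType) (x y : X) s s' : P 3 -> x != y ->
  mobile n P (commw x s y s').
Proof.
move=> P3 xy z o sg; rewrite letters_commw map_comm /amap /= /sphi.
have sx (u v : X) : (inl (Some u) == inl (Some v) :> option X + bool) = (u == v) by [].
case: z => [z|]; last first.
  by case: o; [apply: com_tree_out | apply: com_tree_heads].
case: (eqVneq x z) => [<-|xz].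
  have yx : (Some y == Some x) = false by rewrite (inj_eq Some_inj) eq_sym (negbTE xy).
  rewrite eqxx yx; case: o; last by apply: com_tree_tail.
  by apply: com_sym; apply: com_comm; apply: com_disj.
have -> : (Some x == Some z) = false by rewrite (inj_eq Some_inj) (negbTE xz).
case: (eqVneq y z) => [<-|yz].
  rewrite eqxx; case: o.
    by apply: com_sym; apply: com_comm; apply: com_disj.
  rewrite -inv_comm; apply: com_invr; apply: com_tree_tail => //.
have -> : (Some y == Some z) = false by rewrite (inj_eq Some_inj) (negbTE yz).
by case: o; apply: com_sym; apply: com_comm; apply: com_disj.
Qed.

Lemma mobile_arrow s : P 2 -> mobile n P [:: (tt, s)].
Proof.
move=> P2 z o sg; rewrite /letters /= /amap /sphi /=.
case: z => [[]|] /=; case: o.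
- exact: com_disj.
- exact: com_chain2.
- by apply: com_sym; apply: com_chain2.
- exact: com_heads2.
Qed.
End Mobile.

Section EndPosition.
Variables (n : nat).

Lemma hole_strand (H : finType) (T : context n H) h i j : linear_context T ->
  h \in holes (T i) -> h \in holes (T j) -> i = j.
Proof.
move=> /forallP /(_ h) /eqP; rewrite -/(flatT _) => c; rewrite !mem_holes => hi hj.
have [U [V e]] : exists U V, T i = U ++ inr h :: V.
  by case: (path.splitPr hi) => U V; exists U, V.
have [_ _ /(_ j)] := once_disj c e (eqxx _).
case: (eqVneq j i) => // _ /(_ isT); by rewrite has_pred1 hj.
Qed.

Lemma hole_exists (H : finType) (T : context n H) h : linear_context T ->
  exists i, h \in holes (T i).
Proof.
move=> lT; have : h \in holes (flatT T) by rewrite (perm_mem (linear_perm lT)) mem_enum.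
by rewrite mem_holes => /flattenP [s /codomP [i ->] hs]; exists i; rewrite mem_holes.
Qed.

Lemma passages_nil (H : finType) (T : context n H) :
  passages (fill T (fun=> [::])) = bT T.
Proof. by rewrite passages_fill fillw_nil. Qed.

(** The normal positions of a tail when the head is on the strand [k]. Being in front of or behind
    the head only makes sense on [k]; on the other strands [Some true] is the position chosen. *)
Definition ctail (k : 'I_n) (x : eh n) : bool :=
  match x.2 with Some true => true | Some false => x.1 == k | None => false end.

Lemma filter_all (A : Type) (a : pred A) s : all a s -> filter a s = s.
Proof. by move/all_filterP. Qed.
Lemma filter_none (A : Type) (a : pred A) s : ~~ has a s -> filter a s = [::].
Proof. by elim: s => //= x s IH; rewrite negb_or => /andP [/negbTE -> /IH]. Qed.

(** A tail is sent to [Some false] exactly when it follows the head on the same strand, so the order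
    is preserved up to permuting tails. *)
Lemma end_exists (X : finType) (T : context n (option X)) : linear_context T ->
  exists phi k, [/\ end_position T phi, phi None = (k, None) &
     forall x, ctail k (phi (Some x))].
Proof.
move=> lT; have [f fP] := choice (fun h => hole_exists h lT).
pose k := f None; pose hk := holes (T k).
pose phi h : eh n := (f h, if h is Some x then
  Some (~~ ((f h == k) && (index None hk < index h hk)%N)) else None).
have fi h i : h \in holes (T i) -> f h = i by move=> hi; apply: (hole_strand lT (fP h) hi).
exists phi, k; split=> //; last first.
  by move=> x; rewrite /ctail /phi /=; case: eqP => //= _; case: ltnP.
split=> // i; case: (eqVneq i k) => [->|ik].
  have uk : uniq hk by exact: uniq_holes.
  have Nk : None \in hk by exact: fP.
  have ep h : h \in hk -> phi h =
      (k, if h is Some x then Some (~~ (index None hk < index h hk)%N) else None).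
    by move=> hh; rewrite /phi (fi h k hh); case: h hh => // x _; rewrite eqxx.
  rewrite -/hk /=; rewrite cats0.
  have [u [v e]] : exists u v, hk = u ++ None :: v.
    by case: (path.splitPr Nk) => u v; exists u, v.
  have eu h : h \in u -> phi h = (k, Some true).
    move=> hu; have hh : h \in hk by rewrite e mem_cat hu.
    have iu : (index h hk <= index None hk)%N.
      rewrite e !index_cat hu ifN /= ?addn0 ?index_size //.
      by move: uk; rewrite e cat_uniq /= negb_or => /and3P [_ /andP []].
    rewrite ep // -leqNgt iu; case: h hu {hh iu} => // hu.
    by move: uk; rewrite e cat_uniq /= hu /= andbF.
  have ev h : h \in v -> phi h = (k, Some false).
    move=> hv; have hh : h \in hk by rewrite e mem_cat inE hv !orbT.
    have Nv : h != None.
      by apply/eqP => E; move: uk; rewrite e cat_uniq /= -E hv /= !andbF.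
    have hu : h \notin u.
      move: uk; rewrite e cat_uniq /= negb_or => /and3P [_ /andP [_ /hasPn no] _].
      exact: no.
    have Nu : None \notin u.
      by move: uk; rewrite e cat_uniq /= negb_or => /and3P [_ /andP []].
    have iv : (index None hk < index h hk)%N.
      by rewrite e !index_cat (negbTE hu) (negbTE Nu) /= eq_sym (negbTE Nv) addn0 addnS ltnS leq_addr.
    by rewrite ep // iv; case: h Nv {hh hv hu iv}.
  rewrite e !filter_cat /=.
  have -> : phi None = (k, None) by [].
  rewrite !xpair_eqE /= !andbF eqxx /=.
  rewrite (filter_all (s := u) (a := fun h => phi h == (k, Some true))); last first.
    by apply/allP => h /eu ->; rewrite eqxx.
  rewrite (filter_none (s := v) (a := fun h => phi h == (k, Some true))); last first.
    by apply/hasPn => h /ev ->; rewrite xpair_eqE andbF.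
  rewrite (filter_none (s := u) (a := fun h => phi h == (k, None))); last first.
    by apply/hasPn => h /eu ->; rewrite xpair_eqE andbF.
  rewrite (filter_none (s := v) (a := fun h => phi h == (k, None))); last first.
    by apply/hasPn => h /ev ->; rewrite xpair_eqE andbF.
  rewrite (filter_none (s := u) (a := fun h => phi h == (k, Some false))); last first.
    by apply/hasPn => h /eu ->; rewrite xpair_eqE andbF.
  rewrite (filter_all (s := v) (a := fun h => phi h == (k, Some false))); last first.
    by apply/allP => h /ev ->; rewrite eqxx.
  by rewrite cats0.
have ep h : h \in holes (T i) -> phi h = (i, Some true).
  move=> hi; rewrite /phi (fi h i hi) (negbTE ik); case: h hi => // /fi e.
  by rewrite -e eqxx in ik.
rewrite /= cats0.
rewrite (filter_all (a := fun h => phi h == (i, Some true))); last first.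
  by apply/allP => h /ep ->; rewrite eqxx.
rewrite (filter_none (a := fun h => phi h == (i, None))); last first.
  by apply/hasPn => h /ep ->; rewrite xpair_eqE andbF.
rewrite (filter_none (a := fun h => phi h == (i, Some false))) ?cats0 //.
by apply/hasPn => h /ep ->; rewrite xpair_eqE andbF.
Qed.
End EndPosition.

Section Insert.
Variables (n : nat) (P : nat -> Prop) (X : finType) (E : seq (X * bool)).
Notation H := (option X).
Local Notation tau := (letters Some None E).
Hypothesis mob : mobile n P E.

(** The word [A] is made part of the context, behind each hole, so that the tree alone is inserted
    and [canonical] applies. *)
Lemma insert_tree (T : context n H) A phi : linear_context T -> wfw (bT T) ->
  end_position T phi ->
  ceq P (dg T (tau ++ A)) (stack (dg T A) (map (amap phi) tau)).
Proof.
move=> lT wT [p0 px pi ph].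
pose A' := labelled (bound T) A.
pose f h : seq (passage + H) := inr h :: map inl (lw A' h).
pose T' := subT T f.
have hT i : holes (T' i) = holes (T i).
  rewrite ffunE holes_sub; elim: (holes (T i)) => //= h s ->.
  by rewrite holes_inl.
have lT' : linear_context T'.
  apply: linear_sub => // h; exists h; first by rewrite /f /= holes_inl eqxx.
  by move=> h0 ne; rewrite /f /= holes_inl inE eq_sym.
have F : fill T' (fun=> [::]) = dg T A.
  by rewrite fill_sub; apply: eq_fill => h; rewrite /f /fillw /= -/(fillw _ _) fillw_inl.
have wT' : wfw (bT T') by rewrite -passages_nil -wf_codeE F; apply: wf_dg.
have eT' : end_position T' phi.
  by split=> // [h i|i]; rewrite hT; [exact: pi | exact: ph].
have := canonical mob lT' wT' eT'; rewrite F; apply: ceq_trans.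
pose B := labelled (bound T') tau.
have eB : dg T' tau = fill T (lw (B ++ A')).
  rewrite /dg -/B fill_sub; apply: eq_fill => h.
  by rewrite /f /fillw /= -/(fillw _ _) fillw_inl lw_cat.
have wB : wf_code (fill T (lw (B ++ A'))) by rewrite -eB; apply: wf_dg.
rewrite eB; apply: ceq_sym; have := dgP P lT wB.
by rewrite /unzip2 map_cat -!/(unzip2 _) !labelledK.
Qed.

(** On the left the tree follows all of [W] on each strand; on the right it is interleaved with [W]
    hole by hole. [canonical] carries it from the second position to the first. *)
Lemma stack_assoc M W (phi : H -> eh n) : wf_code M ->
  (phi None).2 = None -> (forall x, (phi (Some x)).2 <> None) ->
  ceq P (stack (stack M W) (map (amap phi) tau)) (stack M (W ++ map (amap phi) tau)).
Proof.
move=> wM p0 px; have lM := linear_TM M.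
pose W' := labelled (bound (TM M)) W.
pose f (e : eh n) : seq (passage + eh n) := map inl (lw W' e) ++ [:: inr e].
pose T1 := subT (TM M) f.
have lT1 : linear_context T1.
  apply: linear_sub => // h; exists h; first by rewrite /f holes_cat holes_inl /= eqxx.
  by move=> h0 ne; rewrite /f holes_cat holes_inl inE eq_sym.
pose g (e : eh n) := [seq h <- enum {: option X} | phi h == e].
have ug e : uniq (g e) by rewrite filter_uniq // enum_uniq.
have mg e h : (h \in g e) = (phi h == e) by rewrite mem_filter mem_enum andbT.
pose T := subT T1 (fun e => map inr (g e)).
have lT : linear_context T by apply: linear_merge.
have F1 : fill T1 (fun=> [::]) = stack M W.
  rewrite fill_sub; apply: eq_fill => e.
  by rewrite /f fillw_cat fillw_inl /fillw /= cats0.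
have F : fill T (fun=> [::]) = stack M W.
  rewrite fill_sub -F1; apply: eq_fill => e.
  by rewrite fillw_inr; elim: (g e).
have wT : wfw (bT T) by rewrite -passages_nil -wf_codeE F; apply: wf_stack.
have hT i : holes (T i) = flatten [seq g e | e <- eholes i].
  rewrite ffunE holes_sub; have -> : holes (T1 i) = eholes i.
    by rewrite ffunE ffunE holes_sub /TM holes_cat holes_inl holes_inr /= !holes_cat !holes_inl.
  by congr flatten; apply: eq_map => e; rewrite holes_inr.
have gg e e' : [seq h <- g e' | phi h == e] = if e' == e then g e else [::].
  rewrite /g -filter_predI; case: (eqVneq e' e) => [->|ne].
    by apply: eq_filter => h /=; rewrite andbb.
  apply: filter_none; apply/hasPn => h _ /=; apply/negP => /andP [/eqP -> /eqP e2].
  by rewrite e2 eqxx in ne.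
have eT : end_position T phi.
  split=> // [h i|i].
    rewrite hT /= !mem_cat !mg orbF => /or3P [] /eqP -> //.
  rewrite hT; congr flatten; apply/eq_in_map => e ei.
  rewrite filter_flatten -map_comp (eq_map (gg e)).
  by move: ei; rewrite !inE => /or3P [] /eqP -> /=; rewrite !xpair_eqE !eqxx /= ?andbF ?cats0.
have := canonical mob lT wT eT; rewrite F => /ceq_sym C; apply: (ceq_trans C).
have hJ : headinj phi tau.
  move=> a /mapP [q _ ->] /= [x|//] e; have := px x; by rewrite e p0.
pose B := labelled (bound T) tau.
have FM := fill_merge P ug mg lT1 (A := B).
rewrite /B labelledK in FM; have {}FM := FM hJ (wf_dg tau lT wT).
apply: (ceq_trans FM).
have eB : fill T1 (lw (lmap phi B)) = fill (TM M) (lw (W' ++ lmap phi B)).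
  rewrite fill_sub; apply: eq_fill => e.
  by rewrite /f fillw_cat fillw_inl lw_cat /fillw /= cats0.
have wB := ceq_wfr FM; rewrite -/B eB in wB *.
have := dgP P lM wB; rewrite /unzip2 map_cat -!/(unzip2 _) unzip2_lmap !labelledK.
exact.
Qed.
End Insert.

(** * Trees with two tails *)

Section Gens.
Variable n : nat.
Local Notation P3 := (fun l => is_true (3 <= l)%N).
Local Notation P2 := (fun l => is_true (2 <= l)%N).

Definition gen : finType := (eh n * eh n * 'I_n)%type.
Implicit Types g : gen.
Definition trg g : seq (arrow (eh n)) :=
  comm [:: (g.1.1, (g.2, None), true)] [:: (g.1.2, (g.2, None), true)].
Definition trs (W : seq gen) := flatten (map trg W).
Definition swap g : gen := (g.1.2, g.1.1, g.2).
Definition cgen g := ctail g.2 g.1.1 && ctail g.2 g.1.2.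

Lemma swapK : involutive swap. Proof. by case=> [[x y] k]. Qed.
Lemma inv_trg g : inv (trg g) = trg (swap g).
Proof. exact: inv_comm. Qed.
Lemma trs_cat W W' : trs (W ++ W') = trs W ++ trs W'.
Proof. by rewrite /trs map_cat flatten_cat. Qed.
Lemma trs_cons g W : trs (g :: W) = trg g ++ trs W.
Proof. by []. Qed.
Lemma trs1 g : trs [:: g] = trg g.
Proof. by rewrite trs_cons cats0. Qed.
Lemma inv_trs W : inv (trs W) = trs (rev (map swap W)).
Proof.
elim: W => // g W IH; rewrite trs_cons inv_cat IH inv_trg.
by rewrite map_cons rev_cons -cats1 trs_cat trs1.
Qed.
Lemma cgen_swap g : cgen (swap g) = cgen g.
Proof. by rewrite /cgen andbC. Qed.

Lemma ctail_head (k : 'I_n) (x : eh n) h : ctail k x -> x != (h, None).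
Proof. by rewrite /ctail; case: x => i [b|] // _; rewrite xpair_eqE andbF. Qed.

Lemma trg_self x k : aeq n P3 (trg (x, x, k)) [::].
Proof. apply: comm_com; exact: aeq_refl. Qed.

(** Every letter of one tree commutes with the other tree: by [com_tree_heads] if the heads agree,
    and by OC otherwise, since tails never lie in a hole of heads. *)
Lemma trg_com g g' : cgen g -> cgen g' -> com n P3 (trg g) (trg g').
Proof.
case: g g' => [[x y] k] [[x' y'] k'] /andP [/= x1 y1] /andP [/= x2 y2].
have nx h := ctail_head h x1; have ny h := ctail_head h y1.
have nx' h := ctail_head h x2; have ny' h := ctail_head h y2.
have G z : (forall h, z != (h, None)) ->
    com n P3 [:: (z, (k', None), true)] (trg (x, y, k)).
  move=> zh; rewrite /trg /=; case: (eqVneq k' k) => [->|ne].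
    exact: (@com_tree_heads n P3 _ isT x y z (k, None)).
  have ne' : (k, None) != (k', None) :> eh n by rewrite xpair_eqE eqxx andbT eq_sym.
  by apply: com_sym; apply: com_comm; apply: com_disj.
rewrite {2}/trg /=; apply: com_sym; apply: com_comm; exact: G.
Qed.

(** Inverting one entry of a commutator that commutes with this entry inverts the commutator, which
    exchanges the tails. So all signs can be made positive. *)
Lemma comm_sign (x y : eh n) k s s' : x != (k, None) -> y != (k, None) ->
  exists2 g, g = (x, y, k) \/ g = (y, x, k) &
  aeq n P3 (comm [:: (x, (k, None), s)] [:: (y, (k, None), s')]) (trg g).
Proof.
move=> xk yk.
pose X b : seq (arrow (eh n)) := [:: (x, (k, None), b)].
pose Y b : seq (arrow (eh n)) := [:: (y, (k, None), b)].
have cl b b' : aeq n P3 (comm (X (~~ b)) (Y b')) (comm (Y b') (X b)).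
  by apply: (comm_invl (X := X b)); apply: com_tree_heads.
have cr b b' : aeq n P3 (comm (X b) (Y (~~ b'))) (comm (Y b') (X b)).
  by apply: (comm_invr (Y := Y b')); apply: com_tree_heads.
have cl' b b' : aeq n P3 (comm (Y (~~ b)) (X b')) (comm (X b') (Y b)).
  by apply: (comm_invl (X := Y b)); apply: com_tree_heads.
case: s s' => [] [].
- by exists (x, y, k); [left | ].
- by exists (y, x, k); [right | exact: (cr true true)].
- by exists (y, x, k); [right | exact: (cl true true)].
- exists (x, y, k); [by left | apply: (aeq_trans (cl true false)); exact: (cl' true true)].
Qed.

Definition end3 (x y : eh n) (k : 'I_n) (h : option bool) : eh n :=
  match h with Some true => x | Some false => y | None => (k, None) end.

Lemma stack_trg M W g : wf_code M -> cgen g ->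
  ceq P3 (stack (stack M W) (trg g)) (stack M (W ++ trg g)).
Proof.
case: g => [[x y] k] wM /andP [/= cx cy]; case: (eqVneq x y) => [<-|xy].
  apply: (ceq_trans (stack_aeq (wf_stack W wM) (trg_self x k))).
  rewrite stack_nil; apply: stack_aeq => //.
  by rewrite (trg_self x k) cats0.
have mob : mobile n P3 (commw true true false true) by apply: mobile_comm.
have px z : (end3 x y k (Some z)).2 <> None.
  by case: z; [move: cx | move: cy]; rewrite /ctail /=; case: (_.2).
exact: (stack_assoc mob W (phi := end3 x y k) wM erefl px).
Qed.

Lemma stack_trs M W0 W : wf_code M -> all cgen W ->
  ceq P3 (stack (stack M W0) (trs W)) (stack M (W0 ++ trs W)).
Proof.
move=> wM; elim/last_ind: W => [_|W g IH].
  by rewrite stack_nil cats0; apply: ceq_refl; apply: wf_stack.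
rewrite all_rcons => /andP [cg cW]; rewrite -cats1 trs_cat.
rewrite trs1; have w0 := wf_stack W0 wM.
apply: (ceq_trans (ceq_sym (stack_trg (trs W) w0 cg))).
apply: (ceq_trans (stack_ceq (trg g) (IH cW))).
by rewrite catA; apply: stack_trg.
Qed.

Definition trel (D D' : code n) := exists2 W, all cgen W & ceq P3 D' (stack D (trs W)).

Lemma trel_ceq D D' : ceq P3 D D' -> trel D D'.
Proof. by move=> e; exists [::] => //; rewrite stack_nil; apply: ceq_sym. Qed.

Lemma trel_trans D' D D'' : trel D D' -> trel D' D'' -> wf_code D -> trel D D''.
Proof.
case=> W cW e [W' cW' e'] wD; exists (W ++ W'); first by rewrite all_cat cW.
apply: (ceq_trans e'); apply: (ceq_trans (stack_ceq _ e)).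
rewrite trs_cat; exact: stack_trs.
Qed.

Lemma trel_sym D D' : wf_code D -> trel D D' -> trel D' D.
Proof.
move=> wD [W cW e]; exists (rev (map swap W)).
  by rewrite all_rev all_map; apply: sub_all cW => g; rewrite /= cgen_swap.
apply: ceq_sym; apply: (ceq_trans (stack_ceq _ e)).
apply: (ceq_trans (stack_trs _ wD _)).
  by rewrite all_rev all_map; apply: sub_all cW => g; rewrite /= cgen_swap.
rewrite -inv_trs -[X in ceq _ _ X](stack_nil D); apply: stack_aeq => //.
exact: aeq_invr.
Qed.

Lemma surgery2E r (t : wtree 'I_2) : perm_eq (tails t) (enum 'I_2) ->
  exists x y s s', x != y /\ expansion r t = commw x s y s'.
Proof.
have tg (H : Type) (u : wtree H) : (0 < size (tails u))%N.
  by elim: u => //= _ X IX Y IY; rewrite size_cat addn_gt0 IX.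
move=> pt; have := perm_size pt; have := perm_uniq pt.
rewrite enum_uniq size_enum_ord; case: t {pt} => [//|tw X Y] /=.
rewrite size_cat; case: X => [t1 x|t1 X1 X2]; case: Y => [t2 y|t2 Y1 Y2] /=.
- rewrite inE andbT => xy _; case: (r (+) tw).
    exists y, x, (~~ t2), (~~ t1); split; first by rewrite eq_sym.
    by rewrite /commw /= !negbK.
  by exists x, y, (~~ t1), (~~ t2); split; rewrite // /commw /= !negbK.
- rewrite size_cat => _; move: (tg _ Y1) (tg _ Y2).
  by case: (size (tails Y1)) => // a; case: (size (tails Y2)) => // b; rewrite !addnS.
- rewrite size_cat => _; move: (tg _ X1) (tg _ X2).
  by case: (size (tails X1)) => // a; case: (size (tails X2)) => // b; rewrite !(addnS, addSn).
- rewrite !size_cat => _; move: (tg _ X1) (tg _ X2) (tg _ Y1).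
  by case: (size (tails X1)) => // a; case: (size (tails X2)) => // b;
    case: (size (tails Y1)) => // c; rewrite !(addnS, addSn).
Qed.

Lemma surgery2 (D D' : code n) : wf_code D -> wf_code D' -> surgery 2 D D' -> trel D D'.
Proof.
move=> wD wD' [T [r [t [g [lT pt DE D'E]]]]].
have [x [y [s [s' [xy e]]]]] := surgery2E r pt.
have [phi [k [ep p0 ck]]] := end_exists lT.
have wT : wfw (bT T) by rewrite -passages_nil -wf_codeE -DE.
have mob : mobile n P3 (commw x s y s') by apply: mobile_comm.
have C := canonical mob lT wT ep.
have xk h : phi (Some x) != (h, None) by apply: ctail_head (ck x).
have yk h : phi (Some y) != (h, None) by apply: ctail_head (ck y).
have [g0 g0E ge] := comm_sign s s' (xk k) (yk k).
exists [:: g0]; first by case: g0E => ->; rewrite /= /cgen /= !ck.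
rewrite trs1; apply: ceq_trans (stack_aeq wD ge).
have -> : comm [:: (phi (Some x), (k, None), s)] [:: (phi (Some y), (k, None), s')] =
   map (amap phi) (letters Some None (commw x s y s')).
  by rewrite letters_commw map_comm /amap /= p0.
rewrite DE; apply: ceq_trans C.
have D'E2 : D' = fill T (lw (zip (map g (iota 0 (size (expansion r t))))
    (letters Some None (expansion r t)))).
  by rewrite D'E; apply: eq_fill => h; rewrite surgery_lw.
rewrite D'E2 in wD' *; have := dgP P3 lT wD'.
by rewrite unzip2_zip ?size_map ?size_iota // e.
Qed.

Lemma w2_trel (L L' : diagram n) : w_equiv 2 L L' -> trel L L'.
Proof.
elim=> {L L'} [L L' [m|[l l2 s]]|L|L L' _ IH|L L' L'' _ IH _ IH'].
- apply: trel_ceq; apply: ceq_move => //; exact: wf_dcode.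
- case: (ltngtP l 2) l2 s => // [l3 _ s|-> _ s]; last by apply: surgery2 => //; exact: wf_dcode.
  apply: trel_ceq; apply: ceq_step; try exact: wf_dcode.
  by right; exists l.
- apply: trel_ceq; apply: ceq_refl; exact: wf_dcode.
- by apply: trel_sym => //; exact: wf_dcode.
- by apply: trel_trans IH' _ => //; exact: wf_dcode.
Qed.
End Gens.

Import GRing.Theory.

Section CancelWords.
Variables (n : nat) (P : nat -> Prop) (H : finType) (G : eqType).
Variables (m : G -> seq (arrow H)) (iota : G -> G) (ok : pred G).
Hypothesis okI : forall g, ok g -> ok (iota g).
Hypothesis iotaK : involutive iota.
Hypothesis iotaN : forall g, ok g -> iota g != g.
Hypothesis mC : forall g g', ok g -> ok g' -> com n P (m g) (m g').
Hypothesis mI : forall g, ok g -> aeq n P (m g ++ m (iota g)) [::].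

(** Induction on the length: the first letter is cancelled against an occurrence of its formal
    inverse [iota g], brought next to it by commutation. *)
Lemma cancel_words c : all ok c ->
  (forall g, ok g -> count_mem g c = count_mem (iota g) c) ->
  aeq n P (flatten (map m c)) [::].
Proof.
have [k] := ubnP (size c); elim: k c => // k IH [//|g c] /= sk /andP [og oc] cn.
have ig : iota g \in c.
  have := cn _ og; rewrite eqxx (negbTE (_ : g != iota g)); last by rewrite eq_sym iotaN.
  by rewrite -has_pred1 has_count; lia.
have [u [v e]] : exists u v, c = u ++ iota g :: v.
  by case: (path.splitPr ig) => u v; exists u, v.
rewrite {}e in sk oc cn *; move: oc; rewrite all_cat /= => /and3P [ou oi ov].
have cu : com n P (flatten (map m u)) (m (iota g)).
  elim: u ou {sk cn} => [_|x u IHu /= /andP [ox ou]]; first exact/com_sym/com_nil.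
  by apply: com_catl; [apply: mC; rewrite ?okI | exact: IHu].
rewrite map_cat flatten_cat /= [flatten _ ++ _]catA.
rewrite (cu : aeq n P (flatten (map m u) ++ m (iota g)) _) !catA mI // cat0s.
have -> : flatten (map m u) ++ flatten (map m v) = flatten (map m (u ++ v)).
  by rewrite map_cat flatten_cat.
apply: IH.
- by move: sk; rewrite !size_cat /=; lia.
- by rewrite all_cat ou.
move=> x ox; have := cn x ox; rewrite !count_cat /= ![g == _]eq_sym ![iota g == _]eq_sym.
rewrite (inj_eq (can_inj iotaK)) (_ : (iota x == g) = (x == iota g)); last first.
  by rewrite -(inj_eq (can_inj iotaK)) iotaK.
by lia.
Qed.
End CancelWords.

(** * Linking numbers *)

Section Linking.
Variable n : nat.
Implicit Types C D : code n.
Local Open Scope ring_scope.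

Definition sgb (b : bool) : int := if b then 1 else -1.

Lemma linkingE C i j :
  linking C i j = \sum_(p <- C i | over p && (mate p \in C j)) sgb (pos p).
Proof. by []. Qed.

Lemma linking_perm C D : (forall i, perm_eq (C i) (D i)) ->
  forall i j, linking C i j = linking D i j.
Proof.
move=> e i j; rewrite !linkingE (perm_big _ (e i)); apply: eq_bigl => p.
by rewrite (perm_mem (e j)).
Qed.

Lemma map_uniq_inj (A B : eqType) (f : A -> B) s x y :
  uniq (map f s) -> x \in s -> y \in s -> f x = f y -> x = y.
Proof.
elim: s => //= z s IH /andP [zs us]; rewrite !inE => /orP [/eqP ->|xs] /orP [/eqP ->|ys] //.
- by move=> e; rewrite e map_f in zs.
- by move=> e; rewrite -e map_f in zs.
- exact: IH.
Qed.

Lemma mem_piece (H : finType) (q : nat * arrow H) h p : (p \in piece q h) =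
  [&& lbl p == q.1, pos p == q.2.2 & (if over p then q.2.1.1 else q.2.1.2) == h].
Proof.
have E l s o l' s' o' : (Passage l s o == Passage l' s' o') =
    [&& l == l', s == s' & o == o'].
  by rewrite -(can_eq passage_codeK) /passage_code /= !xpair_eqE -andbA.
case: p => l s o; rewrite /piece mem_cat /=.
by case: o; case: ifP => e1; case: ifP => e2; rewrite ?inE ?E /= ?e1 ?e2 ?andbT ?andbF ?orbF.
Qed.

Lemma linking_fill (H : finType) (T : context n H) (A : seq (nat * arrow H)) i j :
  linear_context T -> wf_code (fill T (lw A)) ->
  linking (fill T (lw A)) i j = linking (fill T (fun=> [::])) i j +
   \sum_(q <- A | (q.2.1.1 \in holes (T i)) && (q.2.1.2 \in holes (T j))) sgb q.2.2.
Proof.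
move=> lT; rewrite wf_fillA // => /and3P [wT uA /allP aA].
have Ti i' : fill T (lw A) i' = fillw (T i') (lw A) by rewrite ffunE.
have T0 i' : fill T (fun=> [::]) i' = base (T i') by rewrite ffunE -/(fillw _ _) fillw_nil.
have bl i' p : p \in base (T i') -> lbl p \in map lbl (bT T).
  by rewrite mem_base => /mem_bT pb; apply: map_f.
have lwl p h : p \in lw A h -> lbl p \in unzip1 A.
  case/flatten_mapP => q qA; rewrite mem_piece => /andP [/eqP -> _].
  by apply: map_f.
have mT i' p : (p \in fill T (lw A) i') =
    (p \in base (T i')) || (p \in flatten (map (lw A) (holes (T i')))).
  by rewrite Ti (perm_mem (perm_fillw _ _)) mem_cat.
have uT : uniq (holes (T i)) := uniq_holes i lT.
have headE q : q \in A -> (Passage q.1 q.2.2 false \in fill T (lw A) j) = (q.2.1.2 \in holes (T j)).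
  move=> qA; rewrite mT.
  have -> : (Passage q.1 q.2.2 false \in base (T j)) = false.
    by apply/negbTE/negP => /bl /=; apply/negP; apply: aA; apply: map_f.
  apply/flatten_mapP/idP => [[h hj /flatten_mapP [r rA]]|hj]; last first.
    by exists q.2.1.2 => //; apply/flatten_mapP; exists q => //; rewrite mem_piece /= !eqxx.
  rewrite mem_piece /= => /and3P [/eqP e _ /eqP eh].
  by rewrite (map_uniq_inj uA qA rA e) eh.
rewrite !linkingE Ti T0 (perm_big _ (perm_fillw _ _)) big_cat; congr (_ + _).
  rewrite big_seq_cond [RHS]big_seq_cond; apply: eq_bigl => p.
  case pb: (p \in base (T i)) => //=; congr andb; rewrite mT T0.
  case: (_ \in base _) => //=.
  apply/negbTE/negP => /flatten_mapP [h _ /lwl /aA]; by rewrite /= (bl i _ pb).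
rewrite /= big_flatten big_map.
transitivity (\sum_(h <- holes (T i)) \sum_(q <- A)
    if (q.2.1.1 == h) && (q.2.1.2 \in holes (T j)) then sgb q.2.2 else 0).
  apply: eq_bigr => h _; rewrite /lw big_flatten big_map big_seq [RHS]big_seq.
  apply: eq_bigr => q qA; rewrite /piece big_cat /= [X in _ + X]big1_seq => [|p]; last first.
    by case: ifP => _; rewrite ?inE; case/andP => // /andP [op _] /eqP e; rewrite e in op.
  rewrite addr0; case: eqP => _; last by rewrite big_nil.
  by rewrite big_cons big_nil /= -headE //= addr0.
rewrite exchange_big /= [RHS]big_mkcond /=; apply: eq_bigr => q _.
case: (q.2.1.2 \in _); last first.
  by rewrite andbF big1 // => h; rewrite andbF.
rewrite andbT; case: ifP => h0.
  rewrite (bigD1_seq q.2.1.1) //= eqxx /= big1 ?addr0 // => h.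
  by rewrite andbT eq_sym => /negbTE ->.
rewrite big1_seq // => h /andP [_ hT]; rewrite andbT; case: eqP => // e.
by rewrite e hT in h0.
Qed.
End Linking.

(** * Linking numbers classify string links up to w_2-equivalence *)

Section W2.
Variable n : nat.
Local Notation P2 := (fun l => is_true (2 <= l)%N).
Implicit Types L : code n.

Definition hole1 (q : passage) : option unit := if over q then Some tt else None.

Definition absorb1 a L : context n (option unit) :=
  [ffun i => map (fun q => if lbl q == a then inr (hole1 q) else inl q) (L i)].

Lemma linear_absorb1 a L : wf_code L -> a \in map lbl (passages L) ->
  linear_context (absorb1 a L).
Proof.
move=> /andP [uL mL] aL; apply/forallP => h; rewrite -/(flatT _).
have -> : flatT (absorb1 a L) =
    map (fun q => if lbl q == a then inr (hole1 q) else inl q) (passages L).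
  rewrite /flatT /passages /codom /image_mem map_flatten; congr flatten.
  by rewrite -[RHS]map_comp; apply: eq_map => i; rewrite ffunE.
pose o := h == Some tt; rewrite count_map.
rewrite (eq_count (a2 := preim key (pred1 (a, o)))); last first.
  move=> q; rewrite /= /key xpair_eqE; case: (lbl q == a) => //=.
  by rewrite /hole1 /o; case: (over q); case: (h) => [[]|].
rewrite -count_map count_uniq_mem //; case/mapP: aL => p pL ->.
suff -> : (lbl p, o) \in map key (passages L) by [].
apply/mapP; case: (eqVneq (over p) o) => [<-|e]; first by exists p.
exists (mate p); first exact: (allP mL).
by rewrite /key /=; case: (over p) o e => [] [].
Qed.

Lemma fill_absorb1 p L : wf_code L -> p \in passages L ->
  fill (absorb1 (lbl p) L) (lw [:: (lbl p, (Some tt, None, pos p))]) = L.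
Proof.
move=> wL pL; apply/ffunP => i; rewrite !ffunE -/(fillw _ _).
have sub : {subset L i <= passages L} by move=> q qL; apply/mem_passages; exists i.
elim: (L i) sub => //= q s IH sub; rewrite /fillw /= -/(fillw _ _) IH; last first.
  by move=> r rs; apply: sub; rewrite inE rs orbT.
case: eqP => // e; rewrite -[q :: s]cat1s; congr cat.
have sq : pos q = pos p.
  by case: (wfw_lbl wL pL (sub q (mem_head _ _)) (esym e)) => ->.
by rewrite /hole1 /lw /piece -e -sq; case: q {e sq sub} => l s' [].
Qed.

Definition arr2 := ('I_n * 'I_n * bool)%type.
Definition ar (b : arr2) : seq (arrow (eh n)) :=
  [:: ((b.1.1, Some true), (b.1.2, None), b.2)].
Definition empty_code : code n := [ffun=> [::]].

Local Open Scope ring_scope.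

Lemma passages_empty : passages empty_code = [::].
Proof.
by rewrite /passages /codom /image_mem; elim: (enum _) => //= i s ->; rewrite ffunE.
Qed.

(** For either value of [b] the two holes are adjacent on the strand [k], so Reidemeister I removes
    the arrow. *)
Lemma self_arrow P L k b s : wf_code L ->
  ceq P (stack L [:: ((k, Some b), (k, None), s)]) L.
Proof.
move=> wL; have wS := wf_stack [:: ((k, Some b), (k, None), s)] wL.
pose T : context n 'I_1 := [ffun i => map inl (L i) ++ (if i == k then [:: inr ord0] else [::])].
have lT : linear_context T.
  apply/forallP => h; rewrite -/(flatT _) count_flatT (bigD1 k) //= big1 => [|j jk].
    by rewrite addn0 ffunE eqxx count_cat -count_holes holes_inl /= (ord1 h).
  by rewrite ffunE (negbTE jk) cats0 -count_holes holes_inl.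
have E0 : fill T (fun=> [::]) = L.
  apply/ffunP => i; rewrite !ffunE -/(fillw _ _) fillw_cat fillw_inl.
  by case: ifP; rewrite /fillw /= cats0.
have E1 : stack L [:: ((k, Some b), (k, None), s)] =
   fill T (fun=> [:: Passage (bound (TM L)) s b; Passage (bound (TM L)) s (~~ b)]).
  apply/ffunP => i; rewrite !ffunE -!/(fillw _ _) !fillw_cat !fillw_inl; congr cat.
  rewrite /eholes /fillw /= /lw /piece /= !cats0 !xpair_eqE /=.
  rewrite ![i == k]eq_sym; case: (k == i) => /=; rewrite ?andbF ?fillw_nil //=; case: b {wS} => //=.
rewrite -[X in ceq P _ X]E0 E1; rewrite E1 in wS; apply: ceq_move => //.
  by rewrite E0.
exact: Reid1.
Qed.

(** Induction on the number of passages: modulo trees with two tails an arrow is mobile, so a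
    crossing can be taken out of the diagram and put at the ends of the strands. Crossings of a
    strand with itself disappear there and do not affect the linking numbers considered. *)
Lemma w2_normal L : wf_code L -> exists B : seq arr2,
  [/\ all (fun b => b.1.1 != b.1.2) B,
      ceq P2 L (stack empty_code (flatten (map ar B))) &
      forall i j, i != j -> linking L i j = \sum_(b <- B | b.1 == (i, j)) sgb b.2].
Proof.
have [k] := ubnP (size (passages L)); elim: k L => // k IH L sk wL.
case: (posnP (size (passages L))) => [/size0nil p0|].
  have LE : L = empty_code.
    apply/ffunP => i; rewrite ffunE; case e: (L i) => [//|p s].
    have : p \in passages L by apply/mem_passages; exists i; rewrite e mem_head.
    by rewrite p0.
  exists [::]; split=> // [|i j ij].
    by rewrite stack_nil LE in wL *; apply: ceq_refl.
  by rewrite big_nil linkingE LE ffunE big_nil.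
case pE: (passages L) => [//|p s'] _.
have pL : p \in passages L by rewrite pE mem_head.
have lT := linear_absorb1 wL (map_f lbl pL).
set T := absorb1 (lbl p) L in lT.
have LE := fill_absorb1 wL pL; rewrite -/T in LE.
pose M := fill T (fun=> [::]).
have wT : wfw (bT T) by apply: (wf_bT (A := [:: (lbl p, (Some tt, None, pos p))]) lT); rewrite LE.
have wM : wf_code M by rewrite wf_codeE passages_nil.
have sM : (size (passages M) < k)%N.
  have : (0 < size (holes (flatT T)))%N.
    by rewrite (perm_size (linear_perm lT)) -cardE card_option.
  have : size (passages L) = (size (base (flatT T)) + size (holes (flatT T)))%N.
    rewrite /T; have -> : flatT (absorb1 (lbl p) L) =
      map (fun q => if lbl q == lbl p then inr (hole1 q) else inl q) (passages L).
      rewrite /flatT /passages /codom /image_mem map_flatten; congr flatten.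
      by rewrite -[RHS]map_comp; apply: eq_map => i; rewrite ffunE.
    by elim: (passages L) => //= q s ->; case: ifP => //=; rewrite addnS.
  rewrite /M passages_nil /bT; move: sk; lia.
have [B [oB eB lB]] := IH M sM wM.
have [phi [k0 [ep p0 ck]]] := end_exists lT.
have mob : mobile n P2 [:: (tt, pos p)] by apply: mobile_arrow.
have C := canonical mob lT wT ep.
have wL' : wf_code (fill T (lw [:: (lbl p, (Some tt, None, pos p))])) by rewrite LE.
have e1 : ceq P2 L (stack M (map (amap phi) (letters Some None [:: (tt, pos p)]))).
  have := dgP P2 lT wL'; rewrite LE => e; apply: (ceq_trans e); exact: C.
rewrite /letters /= /amap /= p0 in e1.
have := linking_fill _ _ lT wL'; rewrite LE -/M => lk.
have [_ _ pi _] := ep.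
have mh h i : (h \in holes (T i)) = ((phi h).1 == i).
  apply/idP/eqP => [/pi //|<-]; have [j hj] := hole_exists h lT.
  by rewrite (pi _ _ hj).
have {}lk i j : linking L i j = linking M i j +
    (if ((phi (Some tt)).1, k0) == (i, j) then sgb (pos p) else 0).
  by rewrite lk big_cons big_nil !mh p0 /= xpair_eqE addr0.
case xE: (phi (Some tt)) (ck tt) => [i0 [b|]] //= ct; rewrite xE in e1 lk.
case: (eqVneq i0 k0) => [ik|ik].
  exists B; split=> // [|i j ij].
    apply: (ceq_trans e1); rewrite ik; exact: (ceq_trans (self_arrow P2 k0 b (pos p) wM)).
  rewrite lk lB // xpair_eqE /= ik; case: eqP => [->|_]; last by rewrite addr0.
  by rewrite (negbTE ij) addr0.
have bt : b = true by move: ct; rewrite /ctail /= (negbTE ik); case: (b).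
rewrite bt in e1; exists (rcons B (i0, k0, pos p)); split.
- by rewrite all_rcons ik.
- apply: (ceq_trans e1); rewrite map_rcons -cats1 flatten_cat /=.
  apply: (ceq_trans (stack_ceq _ eB)).
  have px (x : unit) : (if Some x is Some _ then (i0, Some true) else (k0, None) : eh n).2 <> None by [].
  have wE : wf_code empty_code by rewrite wf_codeE passages_empty.
  exact: (stack_assoc mob _ (phi := fun h => if h is Some _ then (i0, Some true) else (k0, None)) wE erefl px).
- move=> i j ij; rewrite lk lB // -cats1 big_cat /= big_cons big_nil /=.
  by congr (_ + _); case: eqP => // _; rewrite addr0.
Qed.

Definition flipa (b : arr2) : arr2 := (b.1, ~~ b.2).

(** The arrows of the normal forms commute modulo trees with two tails, and for each ordered pair of
    strands the sum of their signs is a linking number. Hence the form of L times the inverse of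
    that of L' cancels. *)
Lemma linking_w2 L L' : wf_code L -> wf_code L' ->
  (forall i j, i != j -> linking L i j = linking L' i j) -> ceq P2 L L'.
Proof.
move=> wL wL' lk.
have [B [oB eB lB]] := w2_normal wL; have [B' [oB' eB' lB']] := w2_normal wL'.
apply: (ceq_trans eB); apply: ceq_trans (ceq_sym eB').
have wE : wf_code empty_code by rewrite wf_codeE passages_empty.
apply: stack_aeq => //.
pose ok (b : arr2) := b.1.1 != b.1.2.
have cw c : all ok c -> (forall g, ok g -> count_mem g c = count_mem (flipa g) c) ->
    aeq n P2 (flatten (map ar c)) [::].
  apply: (cancel_words (iota := flipa)) => //.
  - by case=> ij [].
  - by case=> ij [] _; rewrite /flipa xpair_eqE eqxx.
  - case=> [[i j] s] [[i' j'] s'] oi oj; rewrite /ar /=.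
    have Nh (a b : 'I_n) : (a, Some true) != (b, None) :> eh n by rewrite xpair_eqE andbF.
    case: (eqVneq j j') => [<-|jj]; first exact: com_heads2.
    by apply: com_disj => //; rewrite xpair_eqE eqxx andbT.
  - by case=> [[i j] s] _; exact: aeq_cancel.
have cB (D : seq arr2) i j : \sum_(b <- D | b.1 == (i, j)) sgb b.2 =
    (count_mem (i, j, true) D)%:Z - (count_mem (i, j, false) D)%:Z.
  elim: D => [|[ij s] D IHD]; first by rewrite big_nil.
  by rewrite big_cons IHD /= !xpair_eqE; case: (ij == (i, j)); case: s; rewrite /sgb /=; lia.
have cc g : ok g -> (count_mem g B + count_mem (flipa g) B' =
    count_mem (flipa g) B + count_mem g B')%N.
  case: g => [[i j] s] oij; have := lk i j oij; rewrite lB // lB' // !cB.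
  by rewrite /flipa /=; case: s {oij}; rewrite /=; lia.
have cf g D : count_mem g (map flipa D) = count_mem (flipa g) D.
  rewrite count_map; apply: eq_count => -[ij s] /=.
  by case: g => ij' s'; rewrite /flipa !xpair_eqE /=; case: (s) (s') => [] [].
have fK g : flipa (flipa g) = g by case: g => ij []; rewrite /flipa.
have oF D : all ok D -> all ok (map flipa D) by rewrite all_map.
have e1 : aeq n P2 (flatten (map ar B) ++ flatten (map ar (map flipa B'))) [::].
  rewrite -flatten_cat -map_cat; apply: cw; first by rewrite all_cat oB oF.
  by move=> g og; rewrite !count_cat !cf fK cc.
have e2 : aeq n P2 (flatten (map ar (map flipa B')) ++ flatten (map ar B')) [::].
  rewrite -flatten_cat -map_cat; apply: cw; first by rewrite all_cat oB' oF.
  by move=> g og; rewrite !count_cat !cf fK addnC.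
by rewrite -[X in aeq n P2 X _]cats0 -e2 catA e1.
Qed.
End W2.

(** * Exchanging heads and tails *)

Section AppT.
Variables (n : nat) (M : code n) (H : finType) (hs : 'I_n -> seq H).
Definition appT : context n H := [ffun i => map inl (M i) ++ map inr (hs i)].

Lemma linear_appT : (forall h, exists2 i, count_mem h (hs i) = 1%N &
   forall j, j != i -> h \notin hs j) -> linear_context appT.
Proof.
move=> hh; apply/forallP => h; have [i hi hj] := hh h.
rewrite -/(flatT _) count_flatT (bigD1 i) //= big1 => [|j /hj].
  by rewrite addn0 ffunE count_cat -!count_holes holes_inl holes_inr /= hi.
rewrite -has_pred1 has_count -leqNgt leqn0 => /eqP.
by rewrite ffunE count_cat -!count_holes holes_inl holes_inr.
Qed.

Lemma fill_appT w : fill appT w = [ffun i => M i ++ flatten (map w (hs i))].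
Proof. by apply/ffunP => i; rewrite !ffunE -/(fillw _ _) fillw_cat fillw_inl fillw_inr. Qed.

Lemma bT_appT : bT appT = passages M.
Proof.
rewrite bT_flat /passages /codom /image_mem; congr flatten.
by apply: eq_map => i; rewrite ffunE base_cat base_inl base_inr cats0.
Qed.

Lemma holes_appT i : holes (appT i) = hs i.
Proof. by rewrite ffunE holes_cat holes_inl holes_inr. Qed.
End AppT.

Section Relation.
Variable n : nat.
Local Notation P3 := (fun l => is_true (3 <= l)%N).

Lemma swap_HT (T : context n (option bool)) phi k :
  linear_context T -> wfw (bT T) -> end_position T phi -> phi None = (k, None) ->
  exists2 g, g = (phi (Some true), phi (Some false), k) \/
             g = (phi (Some false), phi (Some true), k) &
  ceq P3 (dg T [:: (Some true, Some false, true); (Some false, None, true)])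
     (stack (dg T [:: (Some false, None, true); (Some true, Some false, true)]) (trg g)).
Proof.
move=> lT wT ep p0; have [_ px _ _] := ep.
have xk x h : phi (Some x) != (h, None).
  by apply/eqP => e; apply: (px x); rewrite e.
have [g gE ge] := comm_sign false true (xk true k) (xk false k).
exists g => //.
have mob : mobile n P3 (commw true false false true) by apply: mobile_comm.
pose A : seq (arrow (option bool)) := [:: (Some false, None, true)] ++ [:: (Some true, Some false, true)].
have e1 := @R3_swap n P3 (option bool : finType) (Some true) (Some false) None true true isT isT isT.
apply: (ceq_trans (e1 T lT wT)).
have := insert_tree mob A lT wT ep; rewrite letters_commw map_comm /amap /= p0 => e2.
apply: (ceq_trans e2); apply: stack_aeq => //; exact: wf_dg.
Qed.

Section Base.
Variable M : code n.
Hypothesis wM : wf_code M.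

Definition app2 i j (u v : word) : code n :=
  [ffun q => M q ++ (if q == i then u else if q == j then v else [::])].

Lemma app2_sym i j u v : i != j -> app2 i j u v = app2 j i v u.
Proof.
move=> ij; apply/ffunP => q; rewrite !ffunE; congr cat.
case: (eqVneq q i) => [->|_]; first by rewrite (negbTE ij).
by case: eqP.
Qed.

(** On the strand [i] lies the hole where a head and a tail are exchanged; on [j] lie the other two
    ends of these arrows, the head first if [x] holds. *)
Definition hs (x : bool) (i j q : 'I_n) : seq (option bool) :=
  if q == i then [:: Some false] else
  if q == j then (if x then [:: None; Some true] else [:: Some true; None]) else [::].

Lemma linear_hs x i j : i != j -> linear_context (appT M (hs x i j)).
Proof.
move=> ij; apply: linear_appT => -[[]|]; [exists j | exists i | exists j];
  rewrite /hs ?[j == i]eq_sym ?(negbTE ij) ?eqxx //=; try by case: x.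
- by move=> q /negbTE qj; rewrite qj; case: eqP.
- by move=> q /negbTE ->; case: eqP => //; case: x.
- by move=> q /negbTE qj; rewrite qj; case: eqP.
Qed.

Definition hphi (x : bool) (i j : 'I_n) (h : option bool) : eh n :=
  match h with
  | None => (j, None)
  | Some true => (j, Some (~~ x))
  | Some false => (i, Some true)
  end.

Lemma end_hs x i j : i != j -> end_position (appT M (hs x i j)) (hphi x i j).
Proof.
move=> ij; have ji : j != i by rewrite eq_sym.
split=> //; first by case.
  move=> h q; rewrite holes_appT /hs; case: (eqVneq q i) => [->|qi].
    by rewrite inE => /eqP ->.
  case: (eqVneq q j) => [->|//].
  by case: x; rewrite !inE => /orP [] /eqP ->.
move=> q; rewrite holes_appT /hs; case: (eqVneq q i) => [->|qi].
  by rewrite /hphi /= !xpair_eqE !eqxx /=.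
case: (eqVneq q j) => [->|//].
by case: x; rewrite /hphi /= !xpair_eqE !eqxx /= ?andbF.
Qed.

Lemma labels_fresh (H : finType) (T : context n H) l1 l2 s1 s2 :
  bT T = passages M -> linear_context T -> l1 != l2 ->
  (bound (TM M) <= l1)%N -> (bound (TM M) <= l2)%N ->
  ceq P3 (fill T (lw [:: (l1, s1); (l2, s2)])) (dg T [:: s1; s2]).
Proof.
move=> bE lT ne m1 m2; apply: (dgP P3 lT (A := [:: (l1, s1); (l2, s2)])).
rewrite wf_fillA // bE -wf_codeE wM /= inE ne /= andbT.
have nf l : (bound (TM M) <= l)%N -> l \notin map lbl (passages M).
  by move=> la; apply/negP; rewrite -(bT_TM M) => /bound_gt; rewrite ltnNge la.
by rewrite !nf.
Qed.

Local Notation O l := (Passage l true true).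
Local Notation U l := (Passage l true false).
Definition tail_ends (x : bool) l m := if x then [:: U l; O m] else [:: O m; U l].

Lemma swap_app2 x i j l m : i != j -> l != m ->
  (bound (TM M) <= l)%N -> (bound (TM M) <= m)%N ->
  exists2 g : gen n, g = ((j, Some (~~ x)), (i, Some true), j) \/
             g = ((i, Some true), (j, Some (~~ x)), j) &
  ceq P3 (app2 i j [:: U m; O l] (tail_ends x l m))
    (stack (app2 i j [:: O l; U m] (tail_ends x l m)) (trg g)).
Proof.
move=> ij lm bl bm; have lT := linear_hs x ij; have ep := end_hs x ij.
have bE := bT_appT M (hs x i j).
have wT : wfw (bT (appT M (hs x i j))) by rewrite bE.
have [g gE ge] := swap_HT (phi := hphi x i j) (k := j) lT wT ep erefl; exists g => //.
pose at_ : arrow (option bool) := (Some false, None, true).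
pose bt : arrow (option bool) := (Some true, Some false, true).
have E1 : fill (appT M (hs x i j)) (lw [:: (m, bt); (l, at_)]) =
    app2 i j [:: U m; O l] (tail_ends x l m).
  rewrite fill_appT; apply/ffunP => q; rewrite !ffunE; congr cat; rewrite /hs.
  by case: ifP => // _; case: ifP => // _; rewrite /tail_ends; case: x {lT ep bE wT ge gE}.
have E2 : fill (appT M (hs x i j)) (lw [:: (l, at_); (m, bt)]) =
    app2 i j [:: O l; U m] (tail_ends x l m).
  rewrite fill_appT; apply/ffunP => q; rewrite !ffunE; congr cat; rewrite /hs.
  by case: ifP => // _; case: ifP => // _; rewrite /tail_ends; case: x {lT ep bE wT ge gE E1}.
have L1 := labels_fresh bt at_ bE lT (_ : m != l) bm bl.
have L2 := labels_fresh at_ bt bE lT lm bl bm.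
rewrite E1 in L1; rewrite E2 in L2; apply: (ceq_trans (L1 _)); first by rewrite eq_sym.
by apply: (ceq_trans ge); apply: stack_ceq; apply: ceq_sym.
Qed.

(* The two ways to exchange both pairs of adjacent ends of two arrows running in
   opposite directions between the strands i and j. *)
Lemma square i j : i != j -> let l := bound (TM M) in let m := l.+1 in
  let F := app2 i j [:: O l; U m] [:: U l; O m] in
  wf_code F /\ exists g1 g2 g3 g4 : gen n,
    [/\ g1 = ((j, Some false), (i, Some true), j) \/
        g1 = ((i, Some true), (j, Some false), j),
        g2 = ((i, Some false), (j, Some true), i) \/
        g2 = ((j, Some true), (i, Some false), i),
        g3 = ((i, Some true), (j, Some true), i) \/
        g3 = ((j, Some true), (i, Some true), i),
        g4 = ((j, Some true), (i, Some true), j) \/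
        g4 = ((i, Some true), (j, Some true), j) &
    ceq P3 (stack F (trg g1)) (stack F (trs [:: g3; g4; g2]))].
Proof.
move=> ij l m F; have ji : j != i by rewrite eq_sym.
have lm : l != m by rewrite /m neq_ltn leqnn.
have ml : m != l by rewrite eq_sym.
have bl : (bound (TM M) <= l)%N by [].
have bm : (bound (TM M) <= m)%N by rewrite /m leqW.
(* The pairs of adjacent ends on [i] and on [j] each have two orders, which gives a square of four
   codes. Each application of [swap_app2] is one of its edges. *)
have [g1 s1 e1] := swap_app2 true ij lm bl bm.
have [g2 s2 e2] := swap_app2 true ji ml bm bl.
have [g4 s4 e4] := swap_app2 false ij lm bl bm.
have [g3 s3 e3] := swap_app2 false ji ml bm bl.
rewrite /tail_ends /= -/F in e1 e2 e3 e4.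
set G := app2 i j [:: O l; U m] [:: O m; U l] in e4.
have GE : app2 j i [:: O m; U l] [:: O l; U m] = G by rewrite app2_sym.
have FE : app2 j i [:: U l; O m] [:: O l; U m] = F by rewrite app2_sym.
have EE : app2 j i [:: U l; O m] [:: U m; O l] = app2 i j [:: U m; O l] [:: U l; O m].
  by rewrite app2_sym.
have F'E : app2 i j [:: U m; O l] [:: O m; U l] = app2 j i [:: O m; U l] [:: U m; O l].
  by rewrite app2_sym.
rewrite GE FE in e3; rewrite EE in e2; rewrite F'E in e4.
have c3 : cgen g3 by case: s3 => ->; rewrite /cgen /ctail /= ?eqxx.
have c4 : cgen g4 by case: s4 => ->; rewrite /cgen /ctail /= ?eqxx.
have c2 : cgen g2 by case: s2 => ->; rewrite /cgen /ctail /= ?eqxx.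
have wF := ceq_wfl e3; split=> //.
exists g1, g2, (swap g3), g4; split=> //.
  by case: s3 => ->; [right | left].
have wG : wf_code G.
  have lT := linear_hs false ij; have bE := bT_appT M (hs false i j).
  pose at_ : arrow (option bool) := (Some false, None, true).
  pose bt : arrow (option bool) := (Some true, Some false, true).
  have /ceq_wfl := labels_fresh at_ bt bE lT lm bl bm.
  rewrite (_ : fill _ _ = G) // fill_appT; apply/ffunP => q; rewrite !ffunE /hs.
  by congr cat; case: ifP => // _; case: ifP.
have e3' : ceq P3 G (stack F (trg (swap g3))).
  apply: ceq_sym; apply: (ceq_trans (stack_ceq _ e3)).
  apply: (ceq_trans (stack_trg _ wG _)); first by rewrite cgen_swap.
  rewrite -[X in ceq _ _ X](stack_nil G); apply: stack_aeq => //.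
  by rewrite -inv_trg; apply: aeq_invr.
(* The corner where only the ends on [i] are exchanged is reached from [F] directly, through [g1],
   or the other way round, through the inverse of [g3], then [g4] and [g2]. *)
apply: (ceq_trans (ceq_sym e1)); apply: (ceq_trans e2).
apply: (ceq_trans (stack_ceq _ e4)); apply: (ceq_trans (stack_ceq _ (stack_ceq _ e3'))).
apply: (ceq_trans (stack_ceq _ (stack_trg _ wF c4))).
apply: (ceq_trans (stack_trg _ wF c2)).
have -> : trs [:: swap g3; g4; g2] = (trg (swap g3) ++ trg g4) ++ trg g2.
  by rewrite -[X in trs X]/([:: _] ++ [:: _] ++ [:: _]) !trs_cat !trs1 catA.
by apply: ceq_refl; apply: wf_stack.
Qed.
End Base.

(* The [square] of two arrows that cancel each other compares two ways back to L. *)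
Lemma relation L i j : wf_code L -> i != j ->
  exists g1 g2 g3 g4 : gen n,
    [/\ g1 = ((j, Some false), (i, Some true), j) \/
        g1 = ((i, Some true), (j, Some false), j),
        g2 = ((i, Some false), (j, Some true), i) \/
        g2 = ((j, Some true), (i, Some false), i),
        g3 = ((i, Some true), (j, Some true), i) \/
        g3 = ((j, Some true), (i, Some true), i),
        g4 = ((j, Some true), (i, Some true), j) \/
        g4 = ((i, Some true), (j, Some true), j) &
    ceq P3 (stack L (trg g1)) (stack L (trs [:: g3; g4; g2]))].
Proof.
move=> wL ij; have ji : j != i by rewrite eq_sym.
pose hs2 q : seq bool := if q == i then [:: true] else if q == j then [:: false] else [::].
pose T := appT L hs2.
have lT : linear_context T.
  apply: linear_appT => -[]; [exists i | exists j]; rewrite /hs2 ?eqxx ?(negbTE ji) //.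
    by move=> q /negbTE ->; case: ifP.
  by move=> q /negbTE ->; case: ifP.
have wT : wfw (bT T) by rewrite bT_appT.
(* [A] is the inverse of the word [B] of the two arrows that [square] appends; this is what reduces
   [F] to [L]. *)
pose A : seq (arrow bool) := [:: (false, true, false); (true, false, false)].
pose B : seq (arrow bool) := [:: (true, false, true); (false, true, true)].
pose M := dg T A; have wM : wf_code M by apply: wf_dg.
have [] := square wM ij; set F := app2 _ _ _ _ _ => wF.
case=> g1 [g2 [g3 [g4 [s1 s2 s3 s4 e]]]]; exists g1, g2, g3, g4.
split; [exact: s1 | exact: s2 | exact: s3 | exact: s4 | ].
suff eF : ceq P3 F L.
  by apply: (ceq_trans (stack_ceq _ (ceq_sym eF))); apply: (ceq_trans e); apply: stack_ceq.
pose l := bound (TM M).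
pose C := labelled (bound T) A ++ [:: (l, (true, false, true)); (l.+1, (false, true, true))].
have FE : F = fill T (lw C).
  apply/ffunP => q; rewrite /F -/l /app2 /M /dg !fill_appT !ffunE -catA; congr cat.
  rewrite /hs2; case: ifP => [_|_]; first by rewrite /= ?cats0.
  by case: ifP => _ //=; rewrite ?cats0.
rewrite FE; apply: (ceq_trans (dgP P3 lT _)); first by rewrite -FE.
have E0 : dg T [::] = L.
  by rewrite dg_nil fill_appT; apply/ffunP => q; rewrite ffunE; elim: (hs2 q) => [|//]; rewrite cats0.
rewrite -[X in ceq _ _ X]E0.
exact: (@aeq_invl n P3 _ B T lT wT).
Qed.
End Relation.

(** * Removing redundant trees *)

Section Allowed.
Variable n : nat.
Local Notation P3 := (fun l => is_true (3 <= l)%N).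
Local Notation P2 := (fun l => is_true (2 <= l)%N).
Implicit Types (g : gen n) (L : code n).

(** For a pair of strands, [relation] ties together the two trees with one tail behind the head and
    the other on the second strand. The one whose head is on the larger strand is given up, the
    other one is kept. *)
Definition bad_pair (x y : eh n) (k : 'I_n) :=
  [&& x == (k, Some false), y.2 == Some true & (y.1 < k)%N].
(* By [relation], the trees excluded here are redundant. *)
Definition allowed g :=
  [&& cgen g, g.1.1 != g.1.2, ~~ bad_pair g.1.1 g.1.2 g.2 & ~~ bad_pair g.1.2 g.1.1 g.2].

Lemma allowed_swap g : allowed (swap g) = allowed g.
Proof.
rewrite /allowed cgen_swap /swap /= eq_sym.
by do 2?congr andb; rewrite andbC.
Qed.

Lemma allowed_cgen W : all allowed W -> all (@cgen n) W.
Proof. by apply: sub_all => g /andP []. Qed.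

Lemma allowed_rev W : all allowed W -> all allowed (rev (map (@swap n) W)).
Proof. by rewrite all_rev all_map; apply: sub_all => g; rewrite /= allowed_swap. Qed.

Lemma elim_gen L g : wf_code L -> cgen g ->
  exists2 W, all allowed W & ceq P3 (stack L (trg g)) (stack L (trs W)).
Proof.
move=> wL cg; case: (eqVneq g.1.1 g.1.2) => [e|ne].
  exists [::] => //; apply: stack_aeq => //.
  by case: g e cg => [[x y] k] /= -> _; apply: trg_self.
case ag: (allowed g); first by exists [:: g]; rewrite /= ?ag // trs1; apply/ceq_refl/wf_stack.
have [i [j [lij gE]]] : exists i j : 'I_n, (i < j)%N /\
    (g = ((j, Some false), (i, Some true), j) \/ g = ((i, Some true), (j, Some false), j)).
  move: ag; rewrite /allowed cg ne /=; case: g {cg ne} => [[x y] k] /=.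
  move/negbT; rewrite -negb_or negbK => /orP [] /and3P [/eqP -> /eqP].
    by case: y => i b /= -> ik; exists i, k; split=> //; left.
  by case: x => i b /= -> ik; exists i, k; split=> //; right.
have ij : i != j by rewrite neq_ltn lij.
have [g1 [g2 [g3 [g4 [s1 s2 s3 s4 e]]]]] := relation wL ij.
have ji : (j < i)%N = false by apply/negbTE; rewrite -leqNgt ltnW.
have oW : all allowed [:: g3; g4; g2].
  have nji : (j == i) = false by rewrite eq_sym (negbTE ij).
  case: s2 => ->; case: s3 => ->; case: s4 => ->;
  by rewrite /= /allowed /cgen /ctail /bad_pair /= !xpair_eqE /= ?eqxx ?(negbTE ij) ?nji ?ji /= ?andbF ?andbT.
have cW := allowed_cgen oW.
have gg : g = g1 \/ g = swap g1.
  by case: gE => ->; case: s1 => ->; rewrite /swap /=; [left | right | right | left].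
case: gg => gg; first by exists [:: g3; g4; g2] => //; rewrite gg.
have g1E : g1 = swap g by rewrite gg swapK.
exists (rev (map (@swap n) [:: g3; g4; g2])); first exact: allowed_rev.
set W := [:: g3; g4; g2] in e oW cW *.
have cr : com n P3 (trg g) (trs W).
  elim: W cW {e oW} => [_|x W IH /= /andP [cx cW]]; first exact: com_nil.
  by rewrite trs_cons; apply: com_catr; [apply: trg_com | apply: IH].
(* Here the relation expresses the inverse [g1] of [g]. Stacking [g] on both of its sides, where
   [g1] and [g] cancel, yields this equivalence. *)
have h1 : ceq P3 L (stack L (trg g ++ trs W)).
  have -> : ceq P3 L = ceq P3 (stack L [::]) by rewrite stack_nil.
  have c1 : aeq n P3 [::] (trg g1 ++ trg g).
    by rewrite g1E -inv_trg; apply: aeq_sym; apply: aeq_invl.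
  apply: (ceq_trans (stack_aeq wL c1)); apply: (ceq_trans (ceq_sym (stack_trg _ wL cg))).
  apply: (ceq_trans (stack_ceq _ e)); apply: (ceq_trans (stack_trg _ wL cg)).
  by apply: stack_aeq => //; apply: aeq_sym.
rewrite -inv_trs; apply: ceq_sym; apply: (ceq_trans (stack_ceq _ h1)).
have cR : all (@cgen n) (rev (map (@swap n) W)) by apply/allowed_cgen/allowed_rev.
rewrite inv_trs; apply: (ceq_trans (stack_trs _ wL cR)); rewrite -inv_trs.
by apply: stack_aeq => //; rewrite -catA aeq_invr cats0.
Qed.

Lemma elim_gens L W : wf_code L -> all (@cgen n) W ->
  exists2 W', all allowed W' & ceq P3 (stack L (trs W)) (stack L (trs W')).
Proof.
move=> wL; elim/last_ind: W => [_|W g IH].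
  by exists [::] => //; apply/ceq_refl/wf_stack.
rewrite all_rcons => /andP [cg cW]; have [W' oW' e'] := IH cW.
have [W1 oW1 e1] := elim_gen (wf_stack (trs W) wL) cg.
exists (W' ++ W1); first by rewrite all_cat oW'.
rewrite -cats1 !trs_cat trs1; apply: (ceq_trans (ceq_sym (stack_trg _ wL cg))).
apply: (ceq_trans e1); apply: (ceq_trans (stack_ceq _ e')).
exact: (stack_trs _ wL (allowed_cgen oW1)).
Qed.

Lemma trs_cancel W : all allowed W ->
  (forall g, allowed g -> count_mem g W = count_mem (swap g) W) -> aeq n P3 (trs W) [::].
Proof.
apply: (cancel_words (iota := @swap n)).
- by move=> g; rewrite allowed_swap.
- exact: swapK.
- case=> [[x y] k] /and4P [_ /= xy _ _]; rewrite /swap !xpair_eqE /=.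
  by rewrite eq_sym (negbTE xy).
- by move=> g g' /andP [cg _] /andP [cg' _]; apply: trg_com.
- by move=> g _; rewrite -inv_trg; apply: aeq_invr.
Qed.

Lemma linking_trees (L L' : diagram n) :
  (forall i j, i != j -> linking L i j = linking L' i j) ->
  exists2 W, all allowed W & ceq P3 L' (stack L (trs W)).
Proof.
move=> lk; have := linking_w2 (wf_dcode L) (wf_dcode L') lk.
move/ceqE/w2_trel => [W cW e]; have [W' oW' e'] := elim_gens (wf_dcode L) cW.
by exists W' => //; apply: ceq_trans e'.
Qed.
End Allowed.

Local Open Scope ring_scope.

(** * Counting pairs of arrows *)

Definition flt (x y : nat) (w : word) : word :=
  [seq p <- w | (lbl p == x) || (lbl p == y)].
Definition keyto (y : nat) (p : passage) := (lbl p == y, over p).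
Definition pat : seq (bool * bool) :=
  [:: (true, true); (false, false); (true, false); (false, true)].
(** [pat] with the two arrows exchanged, so that both orders of a pair are tested with the key of a
    single arrow. *)
Definition tap : seq (bool * bool) :=
  [:: (false, true); (true, false); (false, false); (true, true)].
(* The passages of the arrows x and y come in the order O_y U_x U_y O_x. *)
Definition pt (x y : nat) (w : word) : bool :=
  (x != y) && (map (keyto y) (flt x y w) == pat).
Definition sgp (p : passage) : int := sgb (pos p).
Definition pairs (w : word) : int :=
  \sum_(p <- w | ~~ over p) \sum_(q <- w | ~~ over q)
     sgp p * sgp q * (pt (lbl p) (lbl q) w)%:R.

Lemma flt_sym x y w : flt x y w = flt y x w.
Proof. by apply: eq_filter => p; rewrite orbC. Qed.

Lemma pt_tap x y w : pt y x w = (x != y) && (map (keyto y) (flt x y w) == tap).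
Proof.
rewrite /pt eq_sym; case: (eqVneq x y) => //= xy; rewrite flt_sym.
pose ng (k : bool * bool) := (~~ k.1, k.2).
have ngI : injective ng by move=> [[] []] [[] []].
have -> : map (keyto x) (flt x y w) = map ng (map (keyto y) (flt x y w)).
  rewrite -map_comp; apply/eq_in_map => p; rewrite mem_filter /= /keyto => /andP [h _].
  congr pair; case/orP: h => /eqP ->; rewrite eqxx ?(negbTE xy) //=.
  by rewrite eq_sym (negbTE xy).
rewrite -[pat]/(map ng tap); apply/eqP/eqP => [/(inj_map ngI)|->] //.
Qed.

Section PairsFill.
Variables (H : finType).
Implicit Types (s : seq (passage + H)) (v : H -> word) (A : seq (nat * arrow H)).

(** What [keyto y] reads off once an arrow from [t] to [h] is inserted. It depends on the holes
    only, neither on the sign nor on the order within a hole. *)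
Definition kw1 (y : nat) (t h : H) s : seq (bool * bool) :=
  flatten [seq match z with
    | inl p => if lbl p == y then [:: (true, over p)] else [::]
    | inr h' => (if t == h' then [:: (false, true)] else [::]) ++
                (if h == h' then [:: (false, false)] else [::])
    end | z <- s].

(* The contribution of an arrow from t to h paired with the arrows of s. *)
Definition kappa s (t h : H) : int :=
  \sum_(r <- base s | ~~ over r)
     sgp r * ((kw1 (lbl r) t h s == pat)%:R + (kw1 (lbl r) t h s == tap)%:R).

Lemma filter_fillw_base (a : pred passage) s v :
  {in base s, forall p, a p = false} ->
  filter a (fillw s v) = filter a (flatten (map v (holes s))).
Proof.
elim: s => //= -[p|h] s IH hs; rewrite /fillw /= -/(fillw _ _).
  by rewrite hs ?mem_head // IH // => q qs; rewrite hs // inE qs orbT.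
by rewrite !filter_cat IH.
Qed.

Lemma filter_fillw_holes (a : pred passage) s v :
  (forall h, h \in holes s -> {in v h, forall p, a p = false}) ->
  filter a (fillw s v) = filter a (base s).
Proof.
elim: s => //= -[p|h] s IH hs; rewrite /fillw /= -/(fillw _ _).
  by rewrite IH.
rewrite filter_cat IH => [|h' h's]; last by apply: hs; rewrite inE h's orbT.
rewrite (_ : filter a (v h) = [::]) //; apply/eqP.
rewrite -[_ == _]negbK -has_filter; apply/hasPn => p pv.
by rewrite (hs h) // mem_head.
Qed.

Lemma perm_lw_in (l : seq H) A : uniq l ->
  (forall q, q \in A -> (q.2.1.1 \in l) && (q.2.1.2 \in l)) ->
  perm_eq (flatten [seq lw A h | h <- l]) (ends A).
Proof.
move=> ul; elim: A => [|q A IH] hA; first by rewrite /lw /=; elim: (l).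
rewrite (eq_map (lw_cons q A)); apply: perm_trans (perm_flatten_cat _ _ _) _.
rewrite -[ends _]/([:: _; _] ++ ends A); apply: perm_cat.
  apply: perm_trans (perm_flatten_cat _ _ _) _.
  by have /andP [h1 h2] := hA q (mem_head _ _); rewrite !flatten_delta.
by apply: IH => r rA; apply: hA; rewrite inE rA orbT.
Qed.

Lemma filter_lw A q h : uniq (unzip1 A) -> q \in A ->
  [seq p <- lw A h | lbl p == q.1] = piece q h.
Proof.
have lp (r : nat * arrow H) h' : all (fun p => lbl p == r.1) (piece r h').
  by apply/allP => p; rewrite mem_piece => /andP [].
elim: A => //= r A IH /andP [rA uA]; rewrite lw_cons filter_cat inE => /orP [/eqP ->|qA].
  have /all_filterP -> := lp r h.
  rewrite (_ : filter _ _ = [::]) ?cats0 //; apply/eqP.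
  rewrite -[_ == _]negbK -has_filter; apply/hasPn => p /flatten_mapP [r' r'A].
  rewrite mem_piece => /andP [/eqP -> _]; apply/negP => /eqP e.
  by move: rA; rewrite -e map_f.
rewrite IH // (_ : filter _ _ = [::]) //; apply/eqP.
rewrite -[_ == _]negbK -has_filter; apply/hasPn => p.
rewrite mem_piece => /andP [/eqP -> _]; apply/negP => /eqP e.
by move: rA; rewrite e map_f.
Qed.

(** A pair consists of two old arrows, of two inserted ones, or of one of each. The mixed part is a
    sum over the inserted arrows that sees only their holes and signs, so opposite parallel arrows
    cancel in it. *)
Lemma pairs_fill s v A : uniq (holes s) -> uniq (unzip1 A) ->
  all (fun l => l \notin map lbl (base s)) (unzip1 A) ->
  (forall h, h \in holes s -> perm_eq (v h) (lw A h)) ->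
  (forall q, q \in A -> [&& q.2.1.1 \in holes s, q.2.1.2 \in holes s & q.2.1.1 != q.2.1.2]) ->
  pairs (fillw s v) = pairs (base s) + pairs (flatten (map v (holes s))) +
    \sum_(q <- A) sgb q.2.2 * kappa s q.2.1.1 q.2.1.2.
Proof.
move=> us uA /allP dA pv hA.
set w := fillw s v; set b := base s; set c := flatten _.
pose f w' p q : int := sgp p * sgp q * (pt (lbl p) (lbl q) w')%:R.
have pw : perm_eq w (b ++ c) by apply: perm_fillw.
have lv h p : h \in holes s -> p \in v h -> lbl p \in unzip1 A.
  move=> hh; rewrite (perm_mem (pv h hh)) => /flatten_mapP [q qA].
  by rewrite mem_piece => /andP [/eqP -> _]; apply: map_f.
have lc p : p \in c -> lbl p \in unzip1 A by move=> /flatten_mapP [h hh]; apply: lv.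
have lb p : p \in b -> lbl p \notin unzip1 A.
  by move=> pb; apply/negP => /dA; rewrite map_f.
have fbb p q : p \in b -> q \in b -> flt (lbl p) (lbl q) w = flt (lbl p) (lbl q) b.
  move=> pb qb; apply: filter_fillw_holes => h hh r /(lv h r hh) rA.
  by apply/norP; split; apply/eqP => e; [have := lb p pb | have := lb q qb]; rewrite -e rA.
have fcc p q : p \in c -> q \in c -> flt (lbl p) (lbl q) w = flt (lbl p) (lbl q) c.
  move=> pc qc; apply: filter_fillw_base => r rb.
  by apply/norP; split; apply/eqP => e; have := lb r rb; rewrite e ?lc.
have sp (g : passage -> passage -> int) :
    \sum_(p <- b ++ c | ~~ over p) \sum_(q <- b ++ c | ~~ over q) g p q =
    \sum_(p <- b | ~~ over p) \sum_(q <- b | ~~ over q) g p q +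
    \sum_(p <- c | ~~ over p) \sum_(q <- c | ~~ over q) g p q +
    \sum_(p <- c | ~~ over p) \sum_(q <- b | ~~ over q) (g p q + g q p).
  have s1 (l : word) : \sum_(p <- l | ~~ over p) \sum_(q <- b ++ c | ~~ over q) g p q =
      \sum_(p <- l | ~~ over p) \sum_(q <- b | ~~ over q) g p q +
      \sum_(p <- l | ~~ over p) \sum_(q <- c | ~~ over q) g p q.
    by rewrite -big_split; apply: eq_bigr => p _; rewrite big_cat.
  have s2 : \sum_(p <- c | ~~ over p) \sum_(q <- b | ~~ over q) (g p q + g q p) =
      \sum_(p <- c | ~~ over p) \sum_(q <- b | ~~ over q) g p q +
      \sum_(p <- b | ~~ over p) \sum_(q <- c | ~~ over q) g p q.
    rewrite [X in _ = _ + X]exchange_big /= -big_split; apply: eq_bigr => p _.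
    by rewrite -big_split.
  rewrite s2 big_cat /= !s1; ring.
rewrite {1}/pairs (perm_big _ pw) /=.
under eq_bigr do rewrite (perm_big _ pw).
rewrite (sp (f w)); congr (_ + _ + _).
- rewrite /pairs big_seq_cond [RHS]big_seq_cond; apply: eq_bigr => p /andP [pb _].
  rewrite big_seq_cond [RHS]big_seq_cond; apply: eq_bigr => q /andP [qb _].
  by rewrite /f /pt fbb.
- rewrite /pairs big_seq_cond [RHS]big_seq_cond; apply: eq_bigr => p /andP [pb _].
  rewrite big_seq_cond [RHS]big_seq_cond; apply: eq_bigr => q /andP [qb _].
  by rewrite /f /pt fcc.
have pc : perm_eq c (ends A).
  apply: perm_trans (perm_lw_in us (A := A) _); last by move=> q /hA /and3P [-> ->].
  rewrite /c; elim: (holes s) pv => //= h l IH pv; apply: perm_cat.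
    by apply: pv; rewrite mem_head.
  by apply: IH => h' hl; apply: pv; rewrite inE hl orbT.
rewrite (perm_big _ pc) /= /ends big_flatten big_map big_seq [RHS]big_seq.
apply: eq_bigr => q qA; rewrite !big_cons big_nil /= addr0 /kappa big_distrr /=.
rewrite big_seq_cond [RHS]big_seq_cond; apply: eq_bigr => r /andP [rb _].
set y := lbl r; set x := q.1.
have xA : x \in unzip1 A by apply: map_f.
have yA : y \notin unzip1 A := lb r rb.
have xy : x != y by apply: contraNneq yA => <-.
have K : map (keyto y) (flt x y w) = kw1 y q.2.1.1 q.2.1.2 s.
  suff K s' : {subset base s' <= b} -> {subset holes s' <= holes s} ->
    map (keyto y) (flt x y (fillw s' v)) = kw1 y q.2.1.1 q.2.1.2 s' by exact: K.
  elim: s' => //= z s' IH sb sh.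
  rewrite /kw1 /= -/(kw1 _ _ _ _) /fillw /= -/(fillw _ _) /flt filter_cat map_cat.
  rewrite -/(flt _ _ _) IH; last 2 first.
  - by move=> p ps; apply: sb; case: (z) => [p'|h']; rewrite /= ?inE ps ?orbT.
  - by move=> p ps; apply: sh; case: (z) => [p'|h']; rewrite /= ?inE ps ?orbT.
  congr cat; case: z sb sh => [p|h'] /= sb sh.
    rewrite (_ : (lbl p == x) = false) /=; first by case: ifP => //= e; rewrite /keyto e.
    apply/eqP => e; have pin : p \in base (inl p :: s') by rewrite mem_base mem_head.
    by have := lb p (sb p pin); rewrite e xA.
  have hh : h' \in holes s by apply: sh; rewrite /= mem_head.
  have pp : perm_eq [seq p <- v h' | (lbl p == x) || (lbl p == y)] (piece q h').
    rewrite -(filter_lw h' uA qA); apply: (perm_trans (perm_filter _ (pv h' hh))).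
    apply/permP => a; congr count; apply: eq_in_filter => p.
    rewrite -(perm_mem (pv h' hh)) => /(lv h' p hh) pA.
    by rewrite (_ : (lbl p == y) = false) ?orbF //; apply/eqP => e; rewrite -e pA in yA.
  have /and3P [_ _ th] := hA q qA.
  (* The ends of [q] lie in different holes, so a hole contains at most one of them and the two
     words agree, not only up to order. *)
  have -> : flt x y (v h') = piece q h'.
    apply: perm_small_eq (pp); rewrite /piece; case: eqP => [<-|_]; last by case: eqP.
    by rewrite eq_sym (negbTE th).
  by rewrite /piece map_cat; congr cat; case: ifP => //= _; rewrite /keyto /= (negbTE xy).
by rewrite /f /= -/x -/y (pt_tap x y w) {1}/pt K xy /= /sgp /=; ring.
Qed.
End PairsFill.

(** * Closures of contexts *)

Definition rv (A : Type) (b : bool) (s : seq A) := if b then rev s else s.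

Lemma perm_rv (A : eqType) b (s : seq A) : perm_eq (rv b s) s.
Proof. by case: b => //=; rewrite perm_rev. Qed.

Lemma pmap_rv (A B : Type) (f : A -> option B) b s : pmap f (rv b s) = rv b (pmap f s).
Proof.
case: b => //=; elim: s => //= x s IH; rewrite rev_cons -cats1 pmap_cat IH /=.
by case: (f x) => [y|] //=; rewrite ?cats0 // rev_cons cats1.
Qed.

Section Closure.
Variables (n : nat) (R : complist n).
Implicit Types C : code n.

Definition clmap C (p : passage) : option passage :=
  if kept R C (mate p)
  then Some (Passage (lbl p) (pos p (+) reversed R C p (+) reversed R C (mate p)) (over p))
  else None.

Definition clword C : word := flatten [seq rv x.2 (pmap (clmap C) (C x.1)) | x <- R].

Lemma closureE C : closure R C ord0 = clword C.
Proof.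
rewrite ffunE; congr flatten; apply: eq_map => x; rewrite /closure_strand.
have -> : [seq Passage (lbl p) (pos p (+) reversed R C p (+) reversed R C (mate p)) (over p)
   | p <- C x.1 & kept R C (mate p)] = pmap (clmap C) (C x.1).
  by elim: (C x.1) => //= p s IH; rewrite /clmap; case: ifP => _ /=; rewrite IH.
by [].
Qed.

Section Context.
Variables (H : finType) (T : context n H).
Hypothesis uR : uniq [seq x.1 | x <- R].
Hypothesis lT : linear_context T.

Definition pctx (psi : passage -> option passage) (s : seq (passage + H)) : seq (passage + H) :=
  pmap (fun y => match y with
        | inl p => omap inl (psi p)
        | inr h => Some (inr h)
        end) s.

Lemma pmap_fillw psi s w : pmap psi (fillw s w) = fillw (pctx psi s) (fun h => pmap psi (w h)).
Proof.
elim: s => //= -[p|h] s IH; rewrite /fillw /= -!/(fillw _ _).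
  by rewrite IH; case: (psi p).
by rewrite pmap_cat IH.
Qed.

Lemma rv_fillw b s (w : H -> word) : rv b (fillw s w) = fillw (rv b s) (fun h => rv b (w h)).
Proof.
case: b => //=; elim: s => //= -[p|h] s IH; rewrite /fillw /= -!/(fillw _ _).
  by rewrite rev_cons IH rev_cons -!cats1 fillw_cat.
by rewrite rev_cat IH rev_cons -cats1 fillw_cat /fillw /= cats0.
Qed.

Lemma holes_pctx psi s : holes (pctx psi s) = holes s.
Proof. by elim: s => //= -[p|h] s /= <- //; case: (psi p). Qed.
Lemma base_pctx psi s : base (pctx psi s) = pmap psi (base s).
Proof. by elim: s => //= -[p|h] s /= <- //; case: (psi p). Qed.
Lemma holes_rv b (s : seq (passage + H)) : holes (rv b s) = rv b (holes s).
Proof. exact: pmap_rv. Qed.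
Lemma base_rv b (s : seq (passage + H)) : base (rv b s) = rv b (base s).
Proof. exact: pmap_rv. Qed.

Definition clctx psi := flatten [seq rv x.2 (pctx psi (T x.1)) | x <- R].
Definition clholes := flatten [seq rv x.2 (holes (T x.1)) | x <- R].
Definition revh (h : H) := has (fun x => x.2 && (h \in holes (T x.1))) R.
Definition inR (h : H) := has (fun x => h \in holes (T x.1)) R.

Lemma holes_clctx psi : holes (clctx psi) = clholes.
Proof.
rewrite /clctx /clholes; elim: (R) => //= x s IH; rewrite holes_cat IH.
by rewrite holes_rv holes_pctx.
Qed.

Lemma base_clctx psi :
  base (clctx psi) = flatten [seq rv x.2 (pmap psi (base (T x.1))) | x <- R].
Proof.
rewrite /clctx; elim: (R) => //= x s IH; rewrite base_cat IH.
by rewrite base_rv base_pctx.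
Qed.

Lemma mem_clholes h : (h \in clholes) = inR h.
Proof.
apply/flatten_mapP/hasP => -[x xR]; rewrite ?(perm_mem (perm_rv _ _)) => hx; exists x => //.
by rewrite (perm_mem (perm_rv _ _)).
Qed.

Lemma uniq_clholes : uniq clholes.
Proof.
rewrite /clholes; elim: (R) uR => //= x s IH /andP [xs us]; rewrite cat_uniq IH // andbT.
rewrite (perm_uniq (perm_rv _ _)) uniq_holes //=.
apply/hasPn => h /flatten_mapP [y ys]; rewrite !(perm_mem (perm_rv _ _)) => hy.
apply/negP => hx; have e := hole_strand lT hx hy.
by case/negP: xs; apply/mapP; exists y.
Qed.

Lemma revhE x h : x \in R -> h \in holes (T x.1) -> revh h = x.2.
Proof.
move=> xR hx; apply/hasP/idP => [[y yR /andP [y2 hy]]|x2]; last by exists x; rewrite // x2.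
have e := hole_strand lT hx hy.
suff -> : x = y by [].
exact: (map_uniq_inj uR).
Qed.

(** A move or an insertion in the string link thus becomes a change of the words in holes of one
    long knot, where the counting formula applies. *)
Lemma clword_fill w : let psi := clmap (fill T w) in
  clword (fill T w) = fillw (clctx psi) (fun h => rv (revh h) (pmap psi (w h))).
Proof.
move=> psi; rewrite /clword /clctx.
suff G (s : complist n) : {subset s <= R} ->
    flatten [seq rv x.2 (pmap psi (fill T w x.1)) | x <- s] =
    fillw (flatten [seq rv x.2 (pctx psi (T x.1)) | x <- s])
      (fun h => rv (revh h) (pmap psi (w h))) by exact: G.
elim: s => //= x s IH sR; rewrite fillw_cat -IH; last first.
  by move=> y ys; apply: sR; rewrite inE ys orbT.
congr cat; rewrite ffunE -/(fillw _ _) pmap_fillw rv_fillw.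
apply: eq_fillw => h; rewrite holes_rv holes_pctx (perm_mem (perm_rv _ _)) => hx.
by rewrite (revhE (sR x (mem_head _ _)) hx).
Qed.

Section Arrows.
Variables (w : H -> word) (A : seq (nat * arrow H)).
Hypothesis wA : wf_code (fill T (lw A)).
Hypothesis pw : forall h, perm_eq (w h) (lw A h).
Let C := fill T w.
Let M := fill T (fun=> [::]).

Lemma mem_fill_base p i : p \in bT T -> (p \in C i) = (p \in M i).
Proof.
move: wA; rewrite wf_fillA // => /and3P [_ _ /allP aA] pb.
rewrite /C /M !ffunE -!/(fillw _ _) fillw_nil (perm_mem (perm_fillw _ _)) mem_cat.
case: (p \in base _) => //=; apply/negbTE/negP => /flatten_mapP [h _].
rewrite (perm_mem (pw h)) => /flatten_mapP [q qA]; rewrite mem_piece => /andP [/eqP e _].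
by have := aA q.1 (map_f fst qA); rewrite -e map_f.
Qed.

Lemma mem_fill_arrow q o i : q \in A ->
  (Passage q.1 q.2.2 o \in C i) = ((if o then q.2.1.1 else q.2.1.2) \in holes (T i)).
Proof.
move: wA; rewrite wf_fillA // => /and3P [_ uA /allP aA] qA.
rewrite /C ffunE -/(fillw _ _) (perm_mem (perm_fillw _ _)) mem_cat.
have -> : (Passage q.1 q.2.2 o \in base (T i)) = false.
  apply/negbTE/negP; rewrite mem_base => /mem_bT pb.
  by have := aA q.1 (map_f fst qA); rewrite (map_f lbl pb).
apply/flatten_mapP/idP => [[h hi]|hi].
  rewrite (perm_mem (pw h)) => /flatten_mapP [r rA]; rewrite mem_piece /=.
  by case/and3P => /eqP e _ /eqP eh; rewrite (map_uniq_inj uA qA rA e) eh.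
exists (if o then q.2.1.1 else q.2.1.2) => //; rewrite (perm_mem (pw _)).
by apply/flatten_mapP; exists q => //; rewrite mem_piece /= !eqxx.
Qed.

Lemma mate_bT p : p \in bT T -> mate p \in bT T.
Proof.
move: wA; rewrite wf_fillA // => /and3P [/andP [_ /allP m] _ _]; exact: m.
Qed.

Lemma clmap_base p : p \in bT T -> clmap C p = clmap M p.
Proof.
move=> pb; have mb := mate_bT pb.
have k : kept R C (mate p) = kept R M (mate p).
  by apply: eq_has => x; rewrite mem_fill_base.
have r q : q \in bT T -> reversed R C q = reversed R M q.
  by move=> qb; apply: eq_has => x; rewrite mem_fill_base.
by rewrite /clmap k !r.
Qed.

Lemma clmap_arrow q o : q \in A -> clmap C (Passage q.1 q.2.2 o) =
  if inR (if o then q.2.1.2 else q.2.1.1)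
  then Some (Passage q.1 (q.2.2 (+) revh q.2.1.1 (+) revh q.2.1.2) o) else None.
Proof.
move=> qA.
have k o' : kept R C (Passage q.1 q.2.2 o') = inR (if o' then q.2.1.1 else q.2.1.2).
  by apply: eq_has => x; rewrite mem_fill_arrow.
have r o' : reversed R C (Passage q.1 q.2.2 o') = revh (if o' then q.2.1.1 else q.2.1.2).
  by apply: eq_has => x; rewrite mem_fill_arrow.
rewrite /clmap /mate /= k !r; case: o => /=; case: ifP => // _.
by rewrite -addbA (addbC (revh _)) addbA.
Qed.

(* The arrows surviving in the closure, with their new signs. *)
Definition clarrows : seq (nat * arrow H) :=
  [seq (q.1, (q.2.1, q.2.2 (+) revh q.2.1.1 (+) revh q.2.1.2))
     | q <- A & inR q.2.1.1 && inR q.2.1.2].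

Lemma pmap_lw h : inR h -> pmap (clmap C) (lw A h) = lw clarrows h.
Proof.
move=> hR; rewrite /clarrows.
suff G (B : seq (nat * arrow H)) : {subset B <= A} -> pmap (clmap C) (lw B h) =
    lw [seq (q.1, (q.2.1, q.2.2 (+) revh q.2.1.1 (+) revh q.2.1.2))
     | q <- B & inR q.2.1.1 && inR q.2.1.2] h by exact: G.
elim: B => //= q B IH sB.
have qA : q \in A by apply: sB; rewrite mem_head.
rewrite lw_cons pmap_cat IH; last by move=> r rB; apply: sB; rewrite inE rB orbT.
have -> : pmap (clmap C) (piece q h) =
  if inR q.2.1.1 && inR q.2.1.2 then
    piece (q.1, (q.2.1, q.2.2 (+) revh q.2.1.1 (+) revh q.2.1.2)) h else [::].
  rewrite /piece pmap_cat /=; case: (eqVneq q.2.1.1 h) => [e1|ne1];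
   case: (eqVneq q.2.1.2 h) => [e2|ne2] //=; rewrite ?clmap_arrow //= ?e1 ?e2 ?hR ?andbT //=.
  - by case: ifP.
  - by case: ifP.
  - by case: ifP.
by case: ifP => _ //=.
Qed.

Lemma base_clword : base (clctx (clmap C)) = clword M.
Proof.
rewrite base_clctx; congr flatten; apply: eq_map => x; congr rv.
rewrite {2}/M ffunE -/(fillw _ _) fillw_nil.
have : {subset base (T x.1) <= bT T}.
  by move=> p; rewrite mem_base => /mem_bT.
elim: (base (T x.1)) => //= p s IH sb; rewrite clmap_base ?IH //.
  by move=> r rs; apply: sb; rewrite inE rs orbT.
by apply: sb; rewrite mem_head.
Qed.

Lemma clctx_base : clctx (clmap C) = clctx (clmap M).
Proof.
congr flatten; apply: eq_map => x; congr rv.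
have : {subset base (T x.1) <= bT T}.
  by move=> p; rewrite mem_base => /mem_bT.
elim: (T x.1) => //= -[p|h] s IH sb; last by rewrite IH.
rewrite clmap_base ?IH //; last by apply: sb; rewrite /= mem_head.
by move=> r rs; apply: sb; rewrite /= inE rs orbT.
Qed.

Let v h := rv (revh h) (pmap (clmap C) (w h)).

Lemma perm_clfill h : inR h -> perm_eq (v h) (lw clarrows h).
Proof.
move=> hR; rewrite -pmap_lw //; apply: perm_trans (perm_rv _ _) _.
exact: perm_pmap.
Qed.

(** The first term ignores the inserted arrows and the last one ignores their order within holes.
    Hence two fillings with the same arrows are compared by the middle term alone. *)
Lemma pairs_clfill : (forall q, q \in A -> q.2.1.1 != q.2.1.2) ->
  pairs (clword C) = pairs (clword M) + pairs (flatten (map v clholes)) +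
   \sum_(q <- clarrows) sgb q.2.2 * kappa (clctx (clmap M)) q.2.1.1 q.2.1.2.
Proof.
move: (wA); rewrite wf_fillA // => /and3P [wT uA /allP aA] th.
rewrite {1}/C clword_fill -/C.
have sub : {subset unzip1 clarrows <= unzip1 A}.
  move=> l /mapP [q /mapP [r]]; rewrite mem_filter => /andP [_ rA] -> ->.
  by rewrite /=; apply: map_f.
rewrite (pairs_fill (A := clarrows)); first by rewrite holes_clctx base_clword clctx_base.
- by rewrite holes_clctx uniq_clholes.
- rewrite /unzip1 /clarrows -map_comp /=; apply: subseq_uniq uA.
  by rewrite /unzip1; apply: map_subseq; apply: filter_subseq.
- apply/allP => l /sub /aA; apply: contra => /mapP [p]; rewrite base_clctx.
  case/flatten_mapP => x xR; rewrite (perm_mem (perm_rv _ _)) mem_pmap => /mapP [r rb].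
  rewrite /clmap; case: ifP => // _ [->] /= ->; apply: map_f.
  by move: rb; rewrite mem_base => /mem_bT.
- by move=> h; rewrite holes_clctx mem_clholes; apply: perm_clfill.
- move=> q /mapP [r]; rewrite mem_filter => /andP [/andP [r1 r2] rA] -> /=.
  by rewrite holes_clctx !mem_clholes r1 r2 th.
Qed.
End Arrows.
End Context.
End Closure.

(** * Invariance of the count *)

Lemma pairs_perm w w' : perm_eq w w' -> (forall x y, pt x y w = pt x y w') ->
  pairs w = pairs w'.
Proof.
move=> e E; rewrite /pairs (perm_big _ e); apply: eq_bigr => p _.
by rewrite (perm_big _ e); apply: eq_bigr => q _; rewrite E.
Qed.

Lemma pairs0 w : (forall x y, pt x y w = false) -> pairs w = 0.
Proof.
by move=> E; rewrite /pairs big1 // => p _; rewrite big1 // => q _; rewrite E mulr0.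
Qed.

Lemma pt_over x y w : pt x y w -> subseq [:: true; false; false; true] (map over w).
Proof.
case/andP => _ /eqP e.
have -> : [:: true; false; false; true] = map over (flt x y w).
  have -> : map over (flt x y w) = map snd (map (keyto y) (flt x y w)) by rewrite -map_comp.
  by rewrite e.
by apply: map_subseq; apply: filter_subseq.
Qed.

(** The pattern alternates between the two arrows, so an arrow with adjacent ends takes part in no
    pair. This is the reason for invariance under Reidemeister I. *)
Lemma pt_adj x y p q A B : lbl p = lbl q -> (lbl p == x) || (lbl p == y) ->
  pt x y (A ++ p :: q :: B) = false.
Proof.
move=> e l; rewrite /pt /flt filter_cat /= -e l map_cat /=.
case: (x != y) => //=; set k := keyto y p.
have -> : keyto y q = (k.1, over q) by rewrite /k /keyto e.
move: (map _ _) (map _ _) k (over q) => s' s [k o] o'.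
apply/negbTE/eqP; case: s => [|a [|b [|c [|d [|? ?]]]]]; rewrite /pat /=;
  case=> *; congruence.
Qed.

(** The two over-passages are the first and the last letter of the pattern, hence never adjacent.
    This is the reason for invariance under OC. *)
Lemma pt_adj_over x y p q A B : over p -> over q ->
  (lbl p == x) || (lbl p == y) -> (lbl q == x) || (lbl q == y) ->
  pt x y (A ++ p :: q :: B) = false.
Proof.
move=> op oq lp lq; rewrite /pt /flt filter_cat /= lp lq map_cat /=.
case: (x != y) => //=; rewrite /keyto op oq.
move: (map _ _) (map _ _) (lbl p == y) (lbl q == y) => s' s k k'.
apply/negbTE/eqP; case: s => [|a [|b [|c [|d [|? ?]]]]]; rewrite /pat /=;
  case=> *; congruence.
Qed.

Lemma pairs_oc p q A B : over p -> over q ->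
  pairs (A ++ p :: q :: B) = pairs (A ++ q :: p :: B).
Proof.
move=> op oq; apply: pairs_perm.
  by rewrite perm_cat2l -[p :: q :: B]/([:: p] ++ [:: q] ++ B) perm_catCA.
move=> x y; have [lp|/negbTE lp] := boolP ((lbl p == x) || (lbl p == y)); last first.
  by rewrite /pt /flt !filter_cat /= lp.
have [lq|/negbTE lq] := boolP ((lbl q == x) || (lbl q == y)); last first.
  by rewrite /pt /flt !filter_cat /= lq.
by rewrite !pt_adj_over.
Qed.

Lemma pairs_isolated p q A B : lbl p = lbl q ->
  (forall r, r \in A ++ B -> lbl r != lbl p) ->
  pairs (A ++ p :: q :: B) = pairs (A ++ B).
Proof.
move=> e nl.
have pw : perm_eq (A ++ p :: q :: B) ([:: p; q] ++ (A ++ B)).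
  by rewrite -[p :: q :: B]/([:: p; q] ++ B) perm_catCA.
rewrite /pairs (perm_big _ pw) big_cat /= [X in X + _]big1_seq ?add0r; last first.
  move=> r /andP [_ rpq]; have lr : lbl r = lbl p.
    by move: rpq; rewrite !inE => /orP [] /eqP ->.
  by rewrite big1 // => r' _; rewrite lr pt_adj ?eqxx ?mulr0.
rewrite big_seq_cond [RHS]big_seq_cond; apply: eq_bigr => r /andP [rAB _].
rewrite (perm_big _ pw) big_cat /= [X in X + _]big1_seq ?add0r; last first.
  move=> r' /andP [_ rpq]; have lr : lbl r' = lbl p.
    by move: rpq; rewrite !inE => /orP [] /eqP ->.
  by rewrite lr pt_adj ?eqxx ?orbT ?mulr0.
rewrite big_seq_cond [RHS]big_seq_cond; apply: eq_bigr => r' /andP [r'AB _].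
rewrite /pt /flt !filter_cat /= -e ![lbl p == _]eq_sym.
by rewrite (negbTE (nl r rAB)) (negbTE (nl r' r'AB)).
Qed.

Lemma pairs_relabel (g : nat -> nat) w : injective g ->
  pairs (map (rlp g) w) = pairs w.
Proof.
move=> gi; rewrite /pairs big_map; apply: eq_bigr => p _.
rewrite big_map; apply: eq_bigr => q _; rewrite /sgp /=; congr (_ * (nat_of_bool _)%:R).
rewrite /pt (inj_eq gi); congr (_ && (_ == _)); rewrite /flt filter_map -map_comp.
rewrite (eq_filter (a2 := fun r => (lbl r == lbl p) || (lbl r == lbl q))).
  by apply: eq_map => r; rewrite /keyto /= (inj_eq gi).
by move=> r; rewrite /= !(inj_eq gi).
Qed.

(* A version of the count that reduces. *)
Definition cntpm (b : bool) (w : word) : nat :=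
  sumn [seq count (fun q => [&& ~~ over p, ~~ over q, pt (lbl p) (lbl q) w &
                              (pos p == pos q) == b]) w | p <- w].

Lemma pairs_cnt w : pairs w = (cntpm true w)%:Z - (cntpm false w)%:Z.
Proof.
pose f (v : word) p q : int := if [&& ~~ over p, ~~ over q & pt (lbl p) (lbl q) v]
  then (if pos p == pos q then 1 else -1) else 0.
have E : pairs w = \sum_(p <- w) \sum_(q <- w) f w p q.
  rewrite /pairs big_mkcond; apply: eq_bigr => p _; rewrite /f.
  case: (over p) => /=; first by rewrite big1.
  rewrite big_mkcond; apply: eq_bigr => q _; case: (over q) => //=.
  by rewrite /sgp; case: (pos p) (pos q) (pt _ _ _) => [] [] [].
rewrite E /cntpm.
have Fi p (u : word) : \sum_(q <- u) f w p q =
    (count (fun q => [&& ~~ over p, ~~ over q, pt (lbl p) (lbl q) w & (pos p == pos q) == true]) u)%:Z -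
    (count (fun q => [&& ~~ over p, ~~ over q, pt (lbl p) (lbl q) w & (pos p == pos q) == false]) u)%:Z.
  elim: u => [|q u IH]; rewrite ?big_nil // big_cons IH /= /f.
  by case: (over p) (over q) (pt _ _ _) (pos p == pos q) => [] [] [] [] /=; lia.
under eq_bigr do rewrite Fi.
have G (a b : passage -> nat) u : \sum_(p <- u) ((a p)%:Z - (b p)%:Z) =
    (sumn (map a u))%:Z - (sumn (map b u))%:Z.
  by elim: u => [|p u IH]; rewrite ?big_nil // big_cons IH /=; lia.
exact: G.
Qed.

Lemma perm_word_tuple (H : eqType) (x0 : H) (l S : seq H) : uniq l -> uniq S ->
  {subset S <= l} -> exists2 ks, ks \in permutations (iota 0 (size S)) &
    [seq e <- l | e \in S] = map (nth x0 S) ks.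
Proof.
move=> ul uS sS.
have p : perm_eq [seq e <- l | e \in S] S.
  apply: uniq_perm => //; first exact: filter_uniq.
  move=> e; rewrite mem_filter; case eS: (e \in S) => //=; exact: sS.
have /(perm_iotaP x0) [ks pk e] := p.
by exists ks; rewrite ?mem_permutations.
Qed.

Lemma flatten_support (H : eqType) (v : H -> word) (l S : seq H) :
  (forall e, e \in l -> e \notin S -> v e = [::]) ->
  flatten (map v l) = flatten (map v [seq e <- l | e \in S]).
Proof.
elim: l => //= e l IH hv; rewrite IH => [|e' el]; last by apply: hv; rewrite inE el orbT.
by case eS: (e \in S) => //=; rewrite hv ?mem_head ?eS.
Qed.

(** * Reidemeister moves *)

Definition r3w (a b c : nat) (sa sb sc d : bool) (k : nat) : word :=
  nth [::]
    [:: order2 (sc == d) (Passage a sa true) (Passage b sb true);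
        order2 (sb == d) (Passage a sa false) (Passage c sc true);
        order2 (sa == d) (Passage b sb false) (Passage c sc false)] k.

(** After renaming the labels to 0, 1, 2, all orders of the three strands and all signs are checked
    by computation. The two values of [d] give the same identity read in opposite directions. *)
Lemma pairs_r3 (a b c : nat) sa sb sc d ks : a != b -> a != c -> b != c ->
  ks \in permutations (iota 0 3) ->
  pairs (flatten (map (r3w a b c sa sb sc d) ks)) =
  pairs (flatten (map (r3w a b c sa sb sc (~~ d)) ks)).
Proof.
move=> ab ac bc kp; pose g0 l := nth l [:: a; b; c] l.
have gi : {in [:: 0; 1; 2]%N &, injective g0}.
  move=> x y; rewrite !inE => /or3P [] /eqP -> /or3P [] /eqP -> //=; rewrite /g0 /= => /eqP;
   by rewrite ?(negbTE ab) ?(negbTE ac) ?(negbTE bc) // eq_sym ?(negbTE ab) ?(negbTE ac) ?(negbTE bc).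
have [g gj ge] := inj_extend gi.
have E d' : flatten (map (r3w a b c sa sb sc d') ks) =
    map (rlp g) (flatten (map (r3w 0 1 2 sa sb sc d') ks)).
  have e0 : g 0%N = a by rewrite -ge.
  have e1 : g 1%N = b by rewrite -ge.
  have e2 : g 2%N = c by rewrite -ge.
  rewrite map_flatten -map_comp; congr flatten; apply: eq_map => k.
  rewrite /r3w /order2; case: k => [|[|[|[|k]]]] /=; rewrite ?e0 ?e1 ?e2 //;
    by case: ifP => _; rewrite /= /rlp /= ?e0 ?e1 ?e2.
rewrite !E !pairs_relabel // !pairs_cnt.
pose bs := [:: true; false].
pose W d' sa sb sc ks := flatten (map (r3w 0 1 2 sa sb sc d') ks).
have chk : all (fun ks => all (fun sa => all (fun sb => all (fun sc =>
    (cntpm true (W true sa sb sc ks) + cntpm false (W false sa sb sc ks) ==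
     cntpm true (W false sa sb sc ks) + cntpm false (W true sa sb sc ks))%N)
   bs) bs) bs) (permutations (iota 0 3)) by vm_compute.
have bM x : x \in bs by case: x.
have /allP /(_ sa (bM _)) /allP /(_ sb (bM _)) /allP /(_ sc (bM _)) /eqP := allP chk _ kp.
by rewrite /W; case: d => /=; lia.
Qed.

Lemma pairs_nil : pairs [::] = 0.
Proof. by rewrite /pairs big_nil. Qed.

Lemma perm_nil_l (A : eqType) (s : seq A) : perm_eq s [::] -> s = [::].
Proof. by move/perm_size; case: s. Qed.

Lemma map_over_nseq b (u : word) k : perm_eq (map over u) (nseq k b) -> map over u = nseq k b.
Proof.
move=> p; have sz := perm_size p; rewrite size_nseq in sz.
rewrite -[in RHS]sz; apply/all_pred1P; rewrite (perm_all _ p).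
by apply/all_pred1P; rewrite size_nseq.
Qed.

(** One hole contains just the two tails and the other just the two heads, so the passages come in
    the order O O U U or U U O O, never O U U O. *)
Lemma pairs_opp (H : finType) (v : H -> word) (l : seq H) t h a b s :
  uniq l -> t \in l -> h \in l -> t != h ->
  (forall e, e \in l -> perm_eq (v e) (lw [:: (a, (t, h, s)); (b, (t, h, ~~ s))] e)) ->
  pairs (flatten (map v l)) = 0.
Proof.
move=> ul tl hl th pv; apply: pairs0 => x y; apply/negbTE/negP => /pt_over.
rewrite (flatten_support (S := [:: t; h])); last first.
  move=> e el; rewrite !inE negb_or => /andP [et eh]; apply: perm_nil_l.
  by apply: (perm_trans (pv e el)); rewrite /lw /piece /= ![_ == e]eq_sym (negbTE et) (negbTE eh).
have ot : map over (v t) = nseq 2 true.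
  apply: map_over_nseq; apply: (perm_trans (perm_map _ (pv t tl))).
  by rewrite /lw /piece /= eqxx eq_sym (negbTE th).
have oh : map over (v h) = nseq 2 false.
  apply: map_over_nseq; apply: (perm_trans (perm_map _ (pv h hl))).
  by rewrite /lw /piece /= eqxx (negbTE th).
have uS : uniq [:: t; h] by rewrite /= inE th.
have sS : {subset [:: t; h] <= l} by move=> e; rewrite !inE => /orP [] /eqP ->.
have [ks kp ->] := perm_word_tuple t ul uS sS.
have pE : permutations (iota 0 2) = [:: [:: 0; 1]; [:: 1; 0]]%N by vm_compute.
move: kp; rewrite [size _]/= pE !inE => /orP [] /eqP -> /=;
by rewrite cats0 map_cat ot oh.
Qed.

Section Invariance.
Variables (n : nat) (R : complist n).
Hypothesis uR : uniq [seq x.1 | x <- R].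
Implicit Types C D : code n.

Lemma pairs_clopp (H : finType) (T : context n H) w t h a b s : linear_context T ->
  t != h -> let A := [:: (a, (t, h, s)); (b, (t, h, ~~ s))] in
  wf_code (fill T (lw A)) -> (forall e, perm_eq (w e) (lw A e)) ->
  pairs (clword R (fill T w)) = pairs (clword R (fill T (fun=> [::]))).
Proof.
move=> lT th A wA pw; rewrite (pairs_clfill uR lT wA pw); last first.
  by move=> q; rewrite !inE => /orP [] /eqP ->.
set v := (X in map X (clholes R T)).
have pv e : e \in clholes R T -> perm_eq (v e) (lw (clarrows R T A) e).
  by rewrite mem_clholes => eR; exact: (perm_clfill lT wA pw eR).
case k: (inR R T t && inR R T h); last first.
  have c0 : clarrows R T A = [::] by rewrite /clarrows /= k.
  rewrite c0 big_nil addr0 (_ : flatten _ = [::]) ?pairs_nil ?addr0 //.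
  elim: (clholes R T) pv => //= e l IH pv; rewrite IH; last first.
    by move=> e' el; apply: pv; rewrite inE el orbT.
  by have := pv e (mem_head _ _); rewrite c0 => /perm_nil_l ->.
have c0 : clarrows R T A =
    [:: (a, (t, h, s (+) revh R T t (+) revh R T h));
        (b, (t, h, ~~ (s (+) revh R T t (+) revh R T h)))].
  by rewrite /clarrows /= k /= -!addNb.
rewrite c0 !big_cons big_nil /= (pairs_opp (t := t) (h := h) (a := a) (b := b)
  (s := s (+) revh R T t (+) revh R T h)) //.
- by case: (_ (+) _); rewrite /sgb /=; ring.
- exact: uniq_clholes.
- by rewrite mem_clholes; case/andP: k.
- by rewrite mem_clholes; case/andP: k.
- by rewrite -c0.
Qed.

Lemma clmap_eq C D : (forall i p, (p \in C i) = (p \in D i)) -> clmap R C =1 clmap R D.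
Proof.
move=> e p; rewrite /clmap.
have k : kept R C (mate p) = kept R D (mate p) by apply: eq_has => x; rewrite e.
have r q : reversed R C q = reversed R D q by apply: eq_has => x; rewrite e.
by rewrite k !r.
Qed.

Lemma split_hole (H : finType) (s : seq (passage + H)) h : uniq (holes s) -> h \in holes s ->
  exists X Y, [/\ s = X ++ inr h :: Y, h \notin holes X & h \notin holes Y].
Proof.
move=> us hs; have : inr h \in s by rewrite -mem_holes.
move=> hin; have [X [Y E]] : exists X Y, s = X ++ inr h :: Y.
  by case: (path.splitPr hin) => X Y; exists X, Y.
exists X, Y; split=> //.
  by move: us; rewrite E holes_cat /= cat_uniq /= negb_or => /and3P [_ /andP []].
by move: us; rewrite E holes_cat /= cat_uniq /= => /and3P [_ _ /andP []].
Qed.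

Lemma fillw1 (s : seq (passage + 'I_1)) v : ord0 \notin holes s -> fillw s v = base s.
Proof.
elim: s => //= -[p|h] s IH; rewrite /fillw /= -/(fillw _ _).
  by move=> /IH ->.
by rewrite (ord1 h) inE eqxx.
Qed.

Lemma pairs_clmove C D : wf_code C -> wf_code D -> welded_move C D ->
  pairs (clword R C) = pairs (clword R D).
Proof.
move=> wC wD m; case: m wC wD => [{}C g gi|T a s o lT|T a b s d lT|T a b c sa sb sc d lT|T a b sa sb lT] wC wD.
- have mg i p : (rlp g p \in relabel g C i) = (p \in C i).
    rewrite relabelE mem_map // => -[l1 s1 o1] [l2 s2 o2] [/gi -> -> ->] //.
  have -> : clword R (relabel g C) = map (rlp g) (clword R C); last by rewrite pairs_relabel.
  rewrite /clword map_flatten -map_comp; congr flatten; apply: eq_map => x /=.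
  rewrite relabelE -pmap_rv -[map _ (rv _ _)]/(map (rlp g) (rv x.2 _)).
  have cE p : clmap R (relabel g C) (rlp g p) = omap (rlp g) (clmap R C p).
    have k q : kept R (relabel g C) (rlp g q) = kept R C q.
      by apply: eq_has => y; rewrite mg.
    have r q : reversed R (relabel g C) (rlp g q) = reversed R C q.
      by apply: eq_has => y; rewrite mg.
    rewrite /clmap -[mate (rlp g p)]/(rlp g (mate p)) k !r.
    by case: ifP.
  have pE u : pmap (clmap R (relabel g C)) (map (rlp g) u) = map (rlp g) (pmap (clmap R C) u).
    elim: u => //= p u IHu; rewrite cE IHu; by case: (clmap R C p).
  by rewrite pmap_rv pE; case: x.2 => //=; rewrite map_rev.
- pose A : seq (nat * arrow 'I_1) := [:: (a, (ord0, ord0, s))].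
  pose w (h : 'I_1) := [:: Passage a s o; Passage a s (~~ o)].
  have pw h : perm_eq (w h) (lw A h).
    rewrite (ord1 h) /lw /piece /= /w; case: (o) => //=.
    by rewrite (perm_catC [:: _] [:: _]).
  have wA : wf_code (fill T (lw A)).
    by rewrite wf_codeE -(perm_wfw (perm_fill T pw)) -wf_codeE.
  rewrite -[RHS](congr1 pairs (base_clword R lT wA pw)).
  rewrite -/w (clword_fill uR lT); set psi := clmap R (fill T w).
  set v := fun h => rv _ _; set S := clctx R T psi.
  case h0: (ord0 \in holes S); last by rewrite fillw1 // h0.
  have uS : uniq (holes S) by rewrite holes_clctx uniq_clholes.
  have iR : inR R T ord0 by rewrite -mem_clholes -(holes_clctx R T psi).
  have [X [Y [SE hX hY]]] := split_hole uS h0.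
  have cA o' : psi (Passage a s o') = Some (Passage a (s (+) revh R T ord0 (+) revh R T ord0) o').
    rewrite /psi (clmap_arrow R lT wA pw (q := (a, (ord0, ord0, s))) o') ?mem_head //=.
    by rewrite !if_same iR.
  have [p [q [vE lp lq]]] : exists p q, [/\ v ord0 = [:: p; q], lbl p = a & lbl q = a].
    rewrite /v /w /= !cA /=; case: (revh _ _ _) => /=; last by do 2!eexists; split.
    by rewrite /rev /=; do 2!eexists; split.
  have bl r : r \in base S -> lbl r != a.
    rewrite /S base_clctx => /flatten_mapP [x xR].
    rewrite (perm_mem (perm_rv _ _)) mem_pmap => /mapP [r' rb].
    rewrite /psi /clmap; case: ifP => // _ [->] /=; apply/eqP => e.
    move: wA; rewrite wf_fillA // => /and3P [_ _ /=]; rewrite andbT -e map_f //.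
    by move: rb; rewrite mem_base => /mem_bT.
  move: bl; rewrite SE base_cat /= fillw_cat {2}/fillw /= -/(fillw _ _) vE !fillw1 //= => bl.
  apply: pairs_isolated; first by rewrite lp lq.
  by move=> r rXY; rewrite lp bl.
- pose A : seq (nat * arrow bool) := [:: (a, (true, false, s)); (b, (true, false, ~~ s))].
  set w := fun o : bool => _.
  have pw h : perm_eq (w h) (lw A h).
    case: h; rewrite /w /lw /piece //= /order2; case: (d) => //.
    by rewrite (perm_catC [:: _] [:: _]).
  have wA : wf_code (fill T (lw A)).
    by rewrite wf_codeE -(perm_wfw (perm_fill T pw)) -wf_codeE.
  exact: (pairs_clopp lT _ wA pw).
- pose o0 : 'I_3 := @Ordinal 3 0 isT; pose o1 : 'I_3 := @Ordinal 3 1 isT.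
  pose o2 : 'I_3 := @Ordinal 3 2 isT.
  pose A : seq (nat * arrow 'I_3) := [:: (a, (o0, o1, sa)); (b, (o0, o2, sb)); (c, (o1, o2, sc))].
  have pw d' h : perm_eq (R3_word a b c sa sb sc d' h) (lw A h).
    case: h => [[|[|[|//]]] hi]; rewrite /lw /piece /= /R3_word /order2 /=; case: ifP => _ //;
    by rewrite (perm_catC [:: _] [:: _]).
  have wA : wf_code (fill T (lw A)).
    by rewrite wf_codeE -(perm_wfw (perm_fill T (pw d))) -wf_codeE.
  have th q : q \in A -> q.2.1.1 != q.2.1.2.
    by rewrite !inE => /or3P [] /eqP ->.
  rewrite !(pairs_clfill uR lT wA (pw _) th); congr (_ + _ + _).
  set v1 := (X in pairs (flatten (map X _)) = _).
  set v2 := (X in _ = pairs (flatten (map X _))).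
  have p1 e : inR R T e -> perm_eq (v1 e) (lw (clarrows R T A) e).
    by move=> eR; exact: (perm_clfill lT wA (pw d) eR).
  have p2 e : inR R T e -> perm_eq (v2 e) (lw (clarrows R T A) e).
    by move=> eR; exact: (perm_clfill lT wA (pw (~~ d)) eR).
  (* If the closure omits a strand of the triangle, at most one of its arrows survives, and both
     sides have the same words. *)
  case k: [&& inR R T o0, inR R T o1 & inR R T o2]; last first.
    have sz : (size (clarrows R T A) <= 1)%N.
      rewrite /clarrows size_map size_filter /=; move: k.
      by case: (inR R T o0) (inR R T o1) (inR R T o2) => [] [] [].
    have sl e : (size (lw (clarrows R T A) e) <= 1)%N.
      have : all (fun q : nat * arrow 'I_3 => q.2.1.1 != q.2.1.2) (clarrows R T A).
        apply/allP => q /mapP [r]; rewrite mem_filter => /andP [_ /th rA] -> //.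
      case: (clarrows R T A) sz => [|q [|//]] //= _; rewrite andbT => qth.
      rewrite /lw /= cats0 /piece; case: eqP => [<-|_]; last by case: eqP.
      by rewrite eq_sym (negbTE qth).
    congr pairs; congr flatten; apply/eq_in_map => e; rewrite mem_clholes => eR.
    by rewrite (perm_small_eq (sl e) (p1 e eR)) (perm_small_eq (sl e) (p2 e eR)).
  case/and3P: k => k0 k1 k2.
  pose r0 := revh R T o0; pose r1 := revh R T o1; pose r2 := revh R T o2.
  (* Reversing strands gives a triangle again: a sign changes with the two strands of its crossing,
     an order with its own strand. Compatibility of both forces this value of the last parameter. *)
  pose da d' := d' (+) r0 (+) r1 (+) r2.
  have vE d' e : rv (revh R T e) (pmap (clmap R (fill T (R3_word a b c sa sb sc d')))
       (R3_word a b c sa sb sc d' e)) =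
      r3w a b c (sa (+) r0 (+) r1) (sb (+) r0 (+) r2) (sc (+) r1 (+) r2) (da d') e.
    have cl q o : q \in A -> clmap R (fill T (R3_word a b c sa sb sc d')) (Passage q.1 q.2.2 o) =
       Some (Passage q.1 (q.2.2 (+) revh R T q.2.1.1 (+) revh R T q.2.1.2) o).
      move=> qA; rewrite (clmap_arrow R lT wA (pw d') o qA) ifT //.
      by move: qA; rewrite !inE => /or3P [] /eqP -> /=; case: (o).
    have ca o : clmap R (fill T (R3_word a b c sa sb sc d')) (Passage a sa o) =
        Some (Passage a (sa (+) r0 (+) r1) o).
      by apply: (cl (a, (o0, o1, sa))); rewrite !inE eqxx.
    have cb o : clmap R (fill T (R3_word a b c sa sb sc d')) (Passage b sb o) =
        Some (Passage b (sb (+) r0 (+) r2) o).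
      by apply: (cl (b, (o0, o2, sb))); rewrite !inE eqxx orbT.
    have cc o : clmap R (fill T (R3_word a b c sa sb sc d')) (Passage c sc o) =
        Some (Passage c (sc (+) r1 (+) r2) o).
      by apply: (cl (c, (o1, o2, sc))); rewrite !inE eqxx !orbT.
    have eo : [\/ e = o0, e = o1 | e = o2].
      by case: e => [[|[|[|//]]] hi]; [apply: Or31 | apply: Or32 | apply: Or33]; apply: val_inj.
    move: ca cb cc {cl}; set f := clmap R (fill T _) => ca cb cc.
    rewrite /da; case: eo => ->.
    - rewrite -/r0 /R3_word /r3w /= /order2; case: ifP => E1; rewrite /= ca cb /=;
      by move: E1; case: (sc) (d') (r0) (r1) (r2) => [] [] [] [] [].
    - rewrite -/r1 /R3_word /r3w /= /order2; case: ifP => E1; rewrite /= ca cc /=;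
      by move: E1; case: (sb) (d') (r0) (r1) (r2) => [] [] [] [] [].
    - rewrite -/r2 /R3_word /r3w /= /order2; case: ifP => E1; rewrite /= cb cc /=;
      by move: E1; case: (sa) (d') (r0) (r1) (r2) => [] [] [] [] [].
  have uS : uniq [:: o0; o1; o2] by [].
  have sS : {subset [:: o0; o1; o2] <= clholes R T}.
    by move=> e; rewrite mem_clholes !inE => /or3P [] /eqP ->.
  have ul : uniq (clholes R T) := uniq_clholes uR lT.
  have [ks kp] := perm_word_tuple o0 ul uS sS.
  rewrite filter_all; last first.
    by apply/allP => -[[|[|[|//]]] hi] _; rewrite !inE.
  move=> lE; have vK d' (v : 'I_3 -> word) : (forall e, v e =
      r3w a b c (sa (+) r0 (+) r1) (sb (+) r0 (+) r2) (sc (+) r1 (+) r2) (da d') e) ->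
     flatten (map v (clholes R T)) = flatten (map (r3w a b c (sa (+) r0 (+) r1)
       (sb (+) r0 (+) r2) (sc (+) r1 (+) r2) (da d')) ks).
    move=> hv; rewrite lE -map_comp; congr flatten; apply/eq_in_map => i ik.
    have : i \in iota 0 3.
      by move: kp; rewrite mem_permutations => /perm_mem <-.
    by rewrite mem_iota /=; case: i {ik} => [|[|[|//]]] _ /=; rewrite hv.
  rewrite (vK d v1) ?(vK (~~ d) v2); try by move=> e; exact: vE.
  have -> : da (~~ d) = ~~ da d by rewrite /da -!addNb.
  move: wA; rewrite wf_fillA // => /and3P [_ /= uA _].
  move: uA; rewrite !inE negb_or andbT => /andP [/andP [ab ac] bc].
  exact: pairs_r3.
- have mm i p : (p \in fill T (fun=> [:: Passage a sa true; Passage b sb true]) i) =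
      (p \in fill T (fun=> [:: Passage b sb true; Passage a sa true]) i).
    rewrite !ffunE -!/(fillw _ _); elim: (T i) => //= -[q|h] s IH.
      by rewrite /fillw /= -!/(fillw _ _) !inE IH.
    by rewrite /fillw /= -!/(fillw _ _) !inE IH !orbA; congr orb; rewrite orbC.
  have cE := funext (clmap_eq mm).
  rewrite !(clword_fill uR lT) cE; set psi := clmap R _.
  set S := clctx R T psi; set v1 := fun h => _; set v2 := fun h : 'I_1 => rv _ (pmap psi [:: Passage b _ _; _]).
  case h0: (ord0 \in holes S); last by rewrite !fillw1 // h0.
  have uS : uniq (holes S) by rewrite holes_clctx uniq_clholes.
  have [X [Y [SE hX hY]]] := split_hole uS h0.
  rewrite SE !fillw_cat /fillw /= -!/(fillw _ _) !(fillw1 _ hX) !(fillw1 _ hY) /v1 /v2 /=.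
  have po p : over p -> if psi p is Some q then over q else true.
    by rewrite /psi /clmap; case: ifP.
  have := po (Passage a sa true) isT; have := po (Passage b sb true) isT.
  case: (psi (Passage a sa true)) => [p|] //=; case: (psi (Passage b sb true)) => [q|] //= oq op.
  by case: (revh _ _ _); rewrite /rev /=; [rewrite pairs_oc | rewrite pairs_oc].
Qed.
End Invariance.

(** * The count on a tree *)

(* Holes 0, 1, 2 stand for the tail x, the head and the tail y of a tree. *)
Definition treew (rx rh ry : bool) (k : nat) : word :=
  let sx := ~~ (rx (+) rh) in let sy := ~~ (ry (+) rh) in
  nth [::]
    [:: rv rx [:: Passage 0 sx true; Passage 2 (~~ sx) true];
        rv rh [:: Passage 0 sx false; Passage 1 sy false;
                  Passage 2 (~~ sx) false; Passage 3 (~~ sy) false];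
        rv ry [:: Passage 1 sy true; Passage 3 (~~ sy) true]] k.

(** A check over all orders and orientations: the tree is counted exactly when its head is met
    between its tails. *)
Lemma pairs_treew rx rh ry ks : ks \in permutations (iota 0 3) ->
  pairs (flatten (map (treew rx rh ry) ks)) =
  sgb (~~ (rx (+) rh (+) ry)) *
    ((ks == [:: 2; 1; 0]%N)%:R - (ks == [:: 0; 1; 2]%N)%:R).
Proof.
pose bs := [:: true; false].
pose W rx rh ry ks := flatten (map (treew rx rh ry) ks).
have chk : all (fun ks => all (fun rx => all (fun rh => all (fun ry =>
    (cntpm true (W rx rh ry ks) + (if rx (+) rh (+) ry then ks == [:: 2; 1; 0] else ks == [:: 0; 1; 2]) ==
     cntpm false (W rx rh ry ks) + (if rx (+) rh (+) ry then ks == [:: 0; 1; 2] else ks == [:: 2; 1; 0]))%N)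
   bs) bs) bs) (permutations (iota 0 3)) by vm_compute.
have bM x : x \in bs by case: x.
move=> kp.
have /allP /(_ rx (bM _)) /allP /(_ rh (bM _)) /allP /(_ ry (bM _)) /eqP := allP chk _ kp.
rewrite pairs_cnt -/(W rx rh ry ks).
by case: (rx (+) rh (+) ry); rewrite /sgb /=; case: (ks == [:: 2; 1; 0]%N);
  case: (ks == [:: 0; 1; 2]%N); rewrite /=; lia.
Qed.

Section TreeValue.
Variables (n : nat) (R : complist n).
Hypothesis uR : uniq [seq x.1 | x <- R].
Variables (H : finType) (T : context n H).
Hypothesis lT : linear_context T.
Variables x h y : H.
Hypotheses (xh : x != h) (yh : y != h) (xy : x != y).
Variables l0 l1 l2 l3 : nat.
Let A : seq (nat * arrow H) :=
  [:: (l0, (x, h, true)); (l1, (y, h, true)); (l2, (x, h, false)); (l3, (y, h, false))].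
Hypothesis wA : wf_code (fill T (lw A)).

Definition order3 := [seq e <- clholes R T | e \in [:: x; h; y]].

Lemma pairs_tree : pairs (clword R (fill T (lw A))) =
  pairs (clword R (fill T (fun=> [::]))) +
  sgb (~~ (revh R T x (+) revh R T h (+) revh R T y)) *
    ((order3 == [:: y; h; x])%:R - (order3 == [:: x; h; y])%:R).
Proof.
have th q : q \in A -> q.2.1.1 != q.2.1.2.
  by rewrite !inE => /or4P [] /eqP ->.
have pw e : perm_eq (lw A e) (lw A e) by [].
rewrite (pairs_clfill uR lT wA pw th).
set v := (X in map X (clholes R T)); set M := fill T _.
have pv e : inR R T e -> v e = rv (revh R T e) (lw (clarrows R T A) e).
  by move=> eR; rewrite /v (pmap_lw lT wA pw eR).
have miss z : z \in [:: x; h; y] -> inR R T z = false ->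
    ((order3 == [:: y; h; x]) = false) * ((order3 == [:: x; h; y]) = false).
  move=> zS zR; have nz : z \notin order3 by rewrite mem_filter mem_clholes zR andbF.
  by split; apply: contraNF nz => /eqP ->; move: zS; rewrite !inE => /or3P [] /eqP ->; rewrite eqxx ?orbT.
have pv' e : e \in clholes R T -> perm_eq (v e) (lw (clarrows R T A) e).
  by rewrite mem_clholes => /pv ->; apply: perm_rv.
have ul : uniq (clholes R T) := uniq_clholes uR lT.
(* If exactly one tail is missing from the closure, the two remaining arrows are parallel and
   opposite and contribute nothing. *)
have opp t a b s : inR R T t -> inR R T h -> t != h ->
   clarrows R T A = [:: (a, (t, h, s)); (b, (t, h, ~~ s))] ->
   pairs (flatten (map v (clholes R T))) +
   \sum_(q <- clarrows R T A) sgb q.2.2 * kappa (clctx R T (clmap R M)) q.2.1.1 q.2.1.2 = 0.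
  move=> tR hR t_h cE; rewrite cE !big_cons big_nil /=.
  rewrite (pairs_opp (t := t) (h := h) (a := a) (b := b) (s := s)) ?mem_clholes //.
    by case: (s); rewrite /sgb /=; ring.
  by rewrite -cE.
have nil0 : clarrows R T A = [::] -> pairs (flatten (map v (clholes R T))) +
   \sum_(q <- clarrows R T A) sgb q.2.2 * kappa (clctx R T (clmap R M)) q.2.1.1 q.2.1.2 = 0.
  move=> c0; rewrite c0 big_nil addr0 (_ : flatten _ = [::]) ?pairs_nil //.
  elim: (clholes R T) pv' => //= e l IH pv1; rewrite IH; last first.
    by move=> e' el; apply: pv1; rewrite inE el orbT.
  by have := pv1 e (mem_head _ _); rewrite c0 => /perm_nil_l ->.
rewrite -addrA; congr (_ + _).
have xS : x \in [:: x; h; y] by rewrite !inE eqxx.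
have hS : h \in [:: x; h; y] by rewrite !inE eqxx orbT.
have yS : y \in [:: x; h; y] by rewrite !inE eqxx !orbT.
have [hR|/negbTE hR] := boolP (inR R T h); last first.
  rewrite !(miss h hS hR) subrr mulr0; apply: nil0.
  by rewrite /clarrows /= hR !andbF.
have [xR|/negbTE xR] := boolP (inR R T x); last first.
  rewrite !(miss x xS xR) subrr mulr0.
  have [yR|/negbTE yR] := boolP (inR R T y); last first.
    by apply: nil0; rewrite /clarrows /= xR yR.
  apply: (opp y l1 l3 (true (+) revh R T y (+) revh R T h)) => //.
  by rewrite /clarrows /= xR yR hR /=; case: (revh R T y) (revh R T h) => [] [].
have [yR|/negbTE yR] := boolP (inR R T y); last first.
  rewrite !(miss y yS yR) subrr mulr0.
  apply: (opp x l0 l2 (true (+) revh R T x (+) revh R T h)) => //.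
  by rewrite /clarrows /= xR yR hR /=; case: (revh R T x) (revh R T h) => [] [].
set rx := revh R T x; set rh := revh R T h; set ry := revh R T y.
have cE : clarrows R T A =
  [:: (l0, (x, h, ~~ (rx (+) rh))); (l1, (y, h, ~~ (ry (+) rh)));
      (l2, (x, h, rx (+) rh)); (l3, (y, h, ry (+) rh))].
  by rewrite /clarrows /= xR yR hR /= /rx /rh /ry; case: (revh R T x) (revh R T h) (revh R T y) => [] [] [].
(* Each arrow of a commutator occurs with both signs, so the pairs formed with old arrows cancel. *)
have -> : \sum_(q <- clarrows R T A) sgb q.2.2 * kappa (clctx R T (clmap R M)) q.2.1.1 q.2.1.2 = 0.
  rewrite cE !big_cons big_nil /=.
  by case: (rx (+) rh) (ry (+) rh) => [] []; rewrite /sgb /=; ring.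
rewrite addr0 (flatten_support (S := [:: x; h; y])); last first.
  move=> e el; rewrite !inE !negb_or => /and3P [ex eh ey]; apply: perm_nil_l.
  apply: (perm_trans (pv' e el)); rewrite cE /lw /piece /= ![_ == e]eq_sym.
  by rewrite (negbTE ex) (negbTE ey) (negbTE eh).
have uS : uniq [:: x; h; y] by rewrite /= !inE negb_or xh xy eq_sym yh.
have sS : {subset [:: x; h; y] <= clholes R T}.
  by move=> e; rewrite mem_clholes !inE => /or3P [] /eqP ->.
have [ks kp oE] := perm_word_tuple x ul uS sS; rewrite -/order3 in oE *.
move: (wA); rewrite wf_fillA // => /and3P [_ /= uA _].
have uL : uniq [:: l0; l1; l2; l3] by [].
have [g gi ge] : exists2 g : nat -> nat, injective g &
    {in [:: 0; 1; 2; 3]%N, (fun i => nth l0 [:: l0; l1; l2; l3] i) =1 g}.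
  apply: inj_extend => i j; rewrite !inE => hi hj /eqP.
  by rewrite nth_uniq //; [move/eqP | case/or4P: hi => /eqP -> | case/or4P: hj => /eqP ->].
have g0 : g 0%N = l0 by rewrite -ge.
have g1 : g 1%N = l1 by rewrite -ge.
have g2 : g 2%N = l2 by rewrite -ge.
have g3 : g 3%N = l3 by rewrite -ge.
have -> : flatten (map v order3) = map (rlp g) (flatten (map (treew rx rh ry) ks)).
  rewrite oE -map_comp map_flatten -map_comp; congr flatten; apply/eq_in_map => i ik.
  have : i \in iota 0 3 by move: kp; rewrite mem_permutations => /perm_mem <-.
  have mrv b u : map (rlp g) (rv b u) = rv b (map (rlp g) u) by case: b; rewrite /rv ?map_rev.
  have hx : (h == x) = false by rewrite eq_sym (negbTE xh).
  have hy : (h == y) = false by rewrite eq_sym (negbTE yh).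
  have yx : (y == x) = false by rewrite eq_sym (negbTE xy).
  rewrite mem_iota /=; case: i {ik} => [|[|[|//]]] _ /=; rewrite pv // cE /lw /piece /= /treew /=
    mrv /rlp /= ?g0 ?g1 ?g2 ?g3 ?eqxx ?(negbTE xh) ?(negbTE yh) ?(negbTE xy) ?hx ?hy ?yx /= ?negbK //.
rewrite pairs_relabel // pairs_treew //; congr (_ * _).
have pE : permutations (iota 0 3) = [:: [:: 1; 0; 2]; [:: 0; 1; 2]; [:: 2; 0; 1];
   [:: 0; 2; 1]; [:: 1; 2; 0]; [:: 2; 1; 0]]%N by vm_compute.
have inj3 k1 k2 : k1 \in permutations (iota 0 3) -> k2 \in permutations (iota 0 3) ->
    (map (nth x [:: x; h; y]) k1 == map (nth x [:: x; h; y]) k2) = (k1 == k2).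
  rewrite !mem_permutations => p1 p2; apply/eqP/eqP => [|-> //].
  have lt3 k i : perm_eq k (iota 0 3) -> i \in k -> (i < 3)%N.
    by move=> pk; rewrite (perm_mem pk) mem_iota.
  have := perm_size p1; rewrite -(perm_size p2).
  have := fun i => lt3 k1 i p1; have := fun i => lt3 k2 i p2; move=> {p1 p2}.
  elim: k1 k2 => [|i k1 IH] [|j k2] //= b2 b1 [sz] [/eqP e em].
  rewrite (IH k2) //; last 2 first.
  - by move=> i' hi; apply: b2; rewrite inE hi orbT.
  - by move=> i' hi; apply: b1; rewrite inE hi orbT.
  congr cons; apply/eqP; move: e; rewrite nth_uniq //.
  - by apply: b1; rewrite mem_head.
  - by apply: b2; rewrite mem_head.
have e1 : (order3 == [:: y; h; x]) = (ks == [:: 2; 1; 0]%N).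
  by rewrite oE -[[:: y; h; x]]/(map (nth x [:: x; h; y]) [:: 2; 1; 0]%N) inj3 // pE !inE eqxx !orbT.
have e2 : (order3 == [:: x; h; y]) = (ks == [:: 0; 1; 2]%N).
  by rewrite oE -[[:: x; h; y]]/(map (nth x [:: x; h; y]) [:: 0; 1; 2]%N) inj3 // pE !inE eqxx !orbT.
by rewrite e1 e2.
Qed.
End TreeValue.

(** * Finite type *)

(** Subsets with and without [j0] cancel in pairs. *)
Lemma alternating_sum0 k (A : zmodType) (F : {set 'I_k} -> A) j0 :
  (forall J : {set 'I_k}, j0 \notin J -> F (j0 |: J) = F J) ->
  \sum_(J : {set 'I_k}) F J *~ (-1) ^+ #|J| = 0.
Proof.
move=> e; rewrite (bigID (fun J : {set 'I_k} => j0 \in J)) /=.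
rewrite (reindex_onto (fun J => j0 |: J) (fun J => J :\ j0)) /=; last first.
  by move=> J jJ; rewrite finset.setD1K.
rewrite (eq_bigl (fun J : {set 'I_k} => j0 \notin J)); last first.
  move=> J; rewrite finset.setU11 /=; apply/eqP/idP => [<-|nJ]; first by rewrite finset.setD11.
  by rewrite finset.setU1K.
rewrite -big_split big1 //= => J nJ.
by rewrite e // cardsU1 nJ exprS mulN1r mulrNz addNr.
Qed.

(** A summand involves at most two crossings, so one of three given crossings can be virtualized
    without affecting it. *)
Lemma exists_avoiding (S : 3.-tuple nat) (a b : nat) : uniq S ->
  exists j : 'I_3, (tnth S j != a) && (tnth S j != b).
Proof.
move=> uS; pose l := [seq j <- enum 'I_3 | (tnth S j == a) || (tnth S j == b)].
have [j jl] : exists j : 'I_3, j \notin l.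
  apply/existsP; rewrite -negb_forall; apply/negP => /forallP al.
  have : (3 <= size (undup [:: a; b]))%N.
    suff : (size (map (tnth S) (enum 'I_3)) <= size (undup [:: a; b]))%N.
      by rewrite size_map size_enum_ord.
    apply: uniq_leq_size.
      by rewrite map_inj_uniq ?enum_uniq //; apply/tuple_uniqP.
    move=> x /mapP [j _ ->]; rewrite mem_undup !inE.
    by have := al j; rewrite mem_filter => /andP [].
  by move/leq_trans => /(_ _ (size_undup _)).
by exists j; rewrite -negb_or; move: jl; rewrite mem_filter mem_enum andbT.
Qed.

Section FiniteType.
Variable n : nat.
Implicit Types (L : diagram n).

Lemma sublabels (S : 3.-tuple nat) (J : {set 'I_3}) j0 l : tnth S j0 != l ->
  (l \in [seq tnth S j | j in j0 |: J]) = (l \in [seq tnth S j | j in J]).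
Proof.
move=> ne; apply/fintype.imageP/fintype.imageP => -[j jJ e]; exists j => //.
  by move: jJ; rewrite !inE => /orP [/eqP ej|//]; rewrite e ej eqxx in ne.
by rewrite !inE jJ orbT.
Qed.

Lemma mem_virtualize (S : seq nat) (C : code n) i p :
  (p \in virtualize_code S C i) = (lbl p \notin S) && (p \in C i).
Proof. by rewrite ffunE mem_filter. Qed.

Lemma finite_type_linking i j : finite_type 2 (fun L => linking L i j).
Proof.
move=> L S uS _.
have vE S' : linking (virtualize S' L) i j =
    \sum_(p <- dcode L i | over p && (mate p \in dcode L j)) sgb (pos p) * (lbl p \notin S')%:R.
  rewrite linkingE /= {1}/virtualize_code ffunE big_filter_cond /=.
  rewrite big_mkcond [RHS]big_mkcond; apply: eq_bigr => p _ /=.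
  rewrite mem_virtualize /=; case: (lbl p \in S'); case: (over p); case: (_ \in _) => //=;
    by rewrite ?mulr1 ?mulr0.
under eq_bigr do rewrite vE mulrzz big_distrl.
rewrite exchange_big big1 // => p _ /=.
have [j0 /andP [nj _]] := exists_avoiding (lbl p) (lbl p) uS.
under eq_bigr do rewrite -mulrzz.
by apply: (alternating_sum0 (j0 := j0)) => J _; rewrite sublabels.
Qed.

Variable R : complist n.

Lemma clword_virtualize S (C : code n) :
  clword R (virtualize_code S C) = [seq p <- clword R C | lbl p \notin S].
Proof.
rewrite /clword filter_flatten -map_comp; congr flatten; apply: eq_map => x /=.
have fr b u : [seq p <- rv b u | lbl p \notin S] = rv b [seq p <- u | lbl p \notin S].
  by case: b => //=; rewrite filter_rev.
rewrite fr ffunE; congr rv.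
elim: (C x.1) => //= p u IH.
have cE : lbl p \notin S -> clmap R (virtualize_code S C) p = clmap R C p.
  move=> lp; rewrite /clmap.
  have k : kept R (virtualize_code S C) (mate p) = kept R C (mate p).
    by apply: eq_has => y; rewrite mem_virtualize /= lp.
  have r : reversed R (virtualize_code S C) (mate p) = reversed R C (mate p).
    by apply: eq_has => y; rewrite mem_virtualize /= lp.
  have r' : reversed R (virtualize_code S C) p = reversed R C p.
    by apply: eq_has => y; rewrite mem_virtualize /= lp.
  by rewrite k r r'.
have lE q : clmap R C p = Some q -> lbl q = lbl p by rewrite /clmap; case: ifP => // _ [<-].
case: ifP => lp /=.
  rewrite cE // IH; case cp: (clmap R C p) => [q|] //=.
  by rewrite (lE q cp) lp.
rewrite IH; case cp: (clmap R C p) => [q|] //=.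
by rewrite (lE q cp) lp.
Qed.

Lemma pairs_filter (S : seq nat) w : pairs [seq p <- w | lbl p \notin S] =
  \sum_(p <- w | ~~ over p) \sum_(q <- w | ~~ over q)
    sgp p * sgp q * (pt (lbl p) (lbl q) w)%:R * ((lbl p \notin S) && (lbl q \notin S))%:R.
Proof.
rewrite /pairs big_filter_cond big_mkcond [RHS]big_mkcond; apply: eq_bigr => p _.
have [lp|/negbTE lp] := boolP (lbl p \notin S); last first.
  by rewrite /=; case: ifP => // _; rewrite big1 // => q _; rewrite mulr0.
rewrite /=; case: (over p) => //=.
rewrite big_filter_cond big_mkcond [RHS]big_mkcond; apply: eq_bigr => q _.
have [lq|/negbTE lq] := boolP (lbl q \notin S); last by rewrite /= mulr0; case: ifP.
rewrite /= mulr1; case: (over q) => //=; congr (_ * (nat_of_bool _)%:R).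
rewrite /pt; congr (_ && (map _ _ == _)); rewrite /flt -filter_predI.
apply: eq_filter => r /=; case: eqP => [->|_]; first by rewrite lp.
by case: eqP => [->|//]; rewrite lq.
Qed.

Lemma finite_type_pairs : finite_type 2 (fun L => pairs (clword R L)).
Proof.
move=> L S uS _.
under eq_bigr do rewrite /= clword_virtualize pairs_filter mulrzz big_distrl.
rewrite exchange_big big1 // => p _ /=.
under eq_bigr do rewrite big_distrl.
rewrite exchange_big big1 // => q _ /=.
have [j0 /andP [nj nj']] := exists_avoiding (lbl p) (lbl q) uS.
under eq_bigr do rewrite -mulrzz.
by apply: (alternating_sum0 (j0 := j0)) => J _; rewrite !sublabels.
Qed.

Lemma welded_pairs : uniq [seq x.1 | x <- R] ->
  welded_invariant (fun L => pairs (clword R L)).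
Proof.
move=> uR L L'; elim=> {L L'} [L L' m|//|L L' _ -> //|L L' L'' _ -> _ -> //].
by apply: pairs_clmove => //; exact: wf_dcode.
Qed.

Lemma perm_fill_strand (H : finType) (T : context n H) (w w' : H -> word) :
  (forall h, perm_eq (w h) (w' h)) -> forall i, perm_eq (fill T w i) (fill T w' i).
Proof.
move=> pw i; rewrite !ffunE -!/(fillw _ _); elim: (T i) => //= -[p|h] s IH.
  by rewrite /fillw /= -!/(fillw _ _) perm_cons.
by rewrite /fillw /= -!/(fillw _ _); apply: perm_cat.
Qed.

Lemma linking_move (C D : code n) i j : i != j -> wf_code C -> wf_code D ->
  welded_move C D -> linking C i j = linking D i j.
Proof.
move=> ij wC wD m; case: m wC wD => [{}C g gi|T a s o lT|T a b s d lT|T a b c sa sb sc d lT|T a b sa sb lT] wC wD.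
- rewrite !linkingE relabelE big_map; apply: eq_bigl => p /=; congr andb.
  rewrite relabelE -[mate (rlp g p)]/(rlp g (mate p)) mem_map //.
  by move=> [l1 s1 o1] [l2 s2 o2] [/gi -> -> ->].
- pose A : seq (nat * arrow 'I_1) := [:: (a, (ord0, ord0, s))].
  pose w (h : 'I_1) := [:: Passage a s o; Passage a s (~~ o)].
  have pw h : perm_eq (w h) (lw A h).
    rewrite (ord1 h) /lw /piece /= /w; case: (o) => //=.
    by rewrite (perm_catC [:: _] [:: _]).
  have wA : wf_code (fill T (lw A)).
    by rewrite wf_codeE -(perm_wfw (perm_fill T pw)) -wf_codeE.
  have pS := perm_fill_strand T pw.
  rewrite -/w (linking_perm pS) (linking_fill _ _ lT wA) !big_cons big_nil /=.
  case: ifP => [/andP [hi hj]|_]; last by rewrite addr0.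
  by have := hole_strand lT hi hj => e; rewrite e eqxx in ij.
- pose A : seq (nat * arrow bool) := [:: (a, (true, false, s)); (b, (true, false, ~~ s))].
  set w := fun o : bool => _.
  have pw h : perm_eq (w h) (lw A h).
    case: h; rewrite /w /lw /piece //= /order2; case: (d) => //.
    by rewrite (perm_catC [:: _] [:: _]).
  have wA : wf_code (fill T (lw A)).
    by rewrite wf_codeE -(perm_wfw (perm_fill T pw)) -wf_codeE.
  have pS := perm_fill_strand T pw.
  rewrite (linking_perm pS) (linking_fill _ _ lT wA) !big_cons big_nil /=.
  by case: (_ && _); rewrite ?addr0 //; case: (s); rewrite /sgb /=; ring.
- apply: linking_perm => i'; apply: perm_fill_strand.
  have pc x y p q : perm_eq (order2 x p q) (order2 y p q).
    by case: x y => [] [] //=; rewrite (perm_catC [:: _] [:: _]).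
  by case=> [[|[|[|//]]] hi]; apply: pc.
- apply: linking_perm => i'; apply: perm_fill_strand => h.
  by rewrite (perm_catC [:: _] [:: _]).
Qed.

Lemma welded_linking i j : i != j -> welded_invariant (fun L => linking L i j).
Proof.
move=> ij L L'; elim=> {L L'} [L L' m|//|L L' _ -> //|L L' L'' _ -> _ -> //].
by apply: linking_move => //; exact: wf_dcode.
Qed.
End FiniteType.

(** * The Alexander polynomial to second order *)

(** The Schur complement formula with the adjugate in place of the inverse; the resulting factor
    [\det D] is cancelled in the domain. *)
Lemma det_block1 (R : idomainType) n (a : R) (b : 'rV[R]_n) (c : 'cV[R]_n) (D : 'M[R]_n) :
  \det D != 0 ->
  \det (block_mx a%:M b c D) = a * \det D - (b *m \adj D *m c) 0 0.
Proof.
move=> dD; apply: (mulIf dD).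
have -> : \det (block_mx a%:M b c D : 'M_(1 + n)) * \det D =
    \det (block_mx a%:M b c D *m block_mx (\det D)%:M 0 (- (\adj D *m c)) 1%:M).
  by rewrite det_mulmx det_lblock det1 mulr1 det_scalar1.
rewrite mulmx_block !mulmx0 !mulmx1 !add0r !mulmxN !mulmxA mul_mx_adj.
rewrite [c *m _]mul_mx_scalar [_%:M *m c]mul_scalar_mx subrr det_ublock; congr (_ * _).
by rewrite det_mx11 !mxE big_ord1 !mxE eqxx !mulr1n.
Qed.

Section SecondOrder.

Definition det1X n (M : 'M[int]_n) : {poly int} := \det (1%:M + 'X *: map_mx polyC M).

(** Induction by splitting off the first row and column. The correction term of [det_block1] carries
    two factors X, so to second order only its constant term [b *m c] matters. Doubling the second
    coefficient keeps the formula over the integers. *)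
Lemma det1X_coef n (M : 'M[int]_n) :
  [/\ (det1X M)`_0 = 1, (det1X M)`_1 = \tr M
    & (det1X M)`_2 *+ 2 = \tr M ^+ 2 - \tr (M *m M)].
Proof.
elim: n M => [|n IH] M.
  rewrite /det1X det_mx00 !coef1 /= (flatmx0 M) mxtrace0 mul0mx mxtrace0.
  by rewrite expr0n subr0 mul0rn.
pose a := M 0 0; pose b : 'rV_n := ursubmx (M : 'M_(1 + n)).
pose c : 'cV_n := dlsubmx (M : 'M_(1 + n)).
pose D : 'M_n := drsubmx (M : 'M_(1 + n)).
have ME : M = block_mx a%:M b c D :> 'M_(1 + n).
  rewrite -[LHS](submxK (M : 'M_(1 + n))); congr block_mx.
  by apply/matrixP => i j; rewrite !ord1 !mxE eqxx mulr1n; congr (M _ _); apply/val_inj.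
have [I0 I1 I2] := IH D.
have dD : \det (1%:M + 'X *: map_mx polyC D) != 0.
  by apply/eqP => e; move: I0; rewrite /det1X e coef0.
have E : det1X M = (1 + a *: 'X) * det1X D -
   (('X *: map_mx polyC b) *m \adj (1%:M + 'X *: map_mx polyC D) *m ('X *: map_mx polyC c)) 0 0.
  rewrite /det1X -det_block1 //.
  suff -> : 1%:M + 'X *: map_mx polyC M = block_mx (1 + a *: 'X)%:M ('X *: map_mx polyC b)
      ('X *: map_mx polyC c) (1%:M + 'X *: map_mx polyC D) :> 'M_(1 + n) by [].
  transitivity (1%:M + 'X *: map_mx polyC (block_mx a%:M b c D)); first by rewrite -ME.
  rewrite map_block_mx scale_block_mx (scalar_mx_block _ _ (1 : {poly int})).
  rewrite add_block_mx !add0r; congr block_mx.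
  by apply/matrixP => i j; rewrite !ord1 !mxE eqxx !mulr1n -mul_polyC mulrC.
set s := (map_mx polyC b *m \adj (1%:M + 'X *: map_mx polyC D) *m map_mx polyC c) 0 0.
have s0 : s`_0 = (b *m c) 0 0.
  rewrite /s -horner_coef0.
  pose f := horner_eval (0 : int).
  have fM (A : 'M[{poly int}]_1) : (A 0 0).[0] = (map_mx f A) 0 0 by rewrite mxE.
  have fC k l (A : 'M[int]_(k, l)) : map_mx f (map_mx polyC A) = A.
    by apply/matrixP => i j; rewrite !mxE /f /horner_eval hornerC.
  rewrite fM !map_mxM /= !fC map_mx_adj map_mxD map_mx1 map_mxZ /=.
  by rewrite /f /horner_eval hornerX scale0r addr0 adj1 mulmx1.
have tM : \tr M = a + \tr D.
  transitivity (\tr (block_mx a%:M b c D)); first by rewrite -ME.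
  by rewrite mxtrace_block mxtrace_scalar.
have tMM : \tr (M *m M) = a ^+ 2 + ((b *m c) 0 0) *+ 2 + \tr (D *m D).
  transitivity (\tr (block_mx a%:M b c D *m block_mx a%:M b c D)); first by rewrite -ME.
  rewrite mulmx_block mxtrace_block !mxtraceD (mxtrace_mulC c b) -scalar_mxM mxtrace_scalar.
  by rewrite [\tr (b *m c)]trace_mx11 /=; ring.
have E2 : det1X M = (1 + a *: 'X) * det1X D - s * 'X^2.
  rewrite E; congr (_ - _); rewrite -scalemxAr -!scalemxAl.
  by rewrite [LHS]mxE [X in _ * X]mxE /s; ring.
have cE k : (det1X M)`_k = (det1X D)`_k + a * (if k is k'.+1 then (det1X D)`_k' else 0)
    - (if k is k'.+2 then s`_k' else 0).
  rewrite E2 coefB mulrDl mul1r coefD -scalerAl coefZ coefXM coefMXn.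
  by case: k => [|[|k]] //=; rewrite ?subn2.
split; rewrite cE /=.
- by rewrite I0 mulr0 addr0 subr0.
- by rewrite I0 I1 tM mulr1 subr0 addrC.
- by rewrite s0 I1 !mulrnDl mulNrn I2 tM tMM; ring.
Qed.
End SecondOrder.

(** ** Laurent polynomials *)

Lemma tvar_neq0 : tvar != 0.
Proof. by rewrite /tvar tofrac_eq0 polyX_eq0. Qed.
#[local] Hint Resolve tvar_neq0 : core.

Lemma tvarX_neq0 k : tvar ^+ k != 0.
Proof. by rewrite expf_neq0. Qed.
#[local] Hint Resolve tvarX_neq0 : core.

Lemma laurent_poly p : laurent (tofrac p).
Proof. by exists p, 0%N; rewrite expr0 divr1. Qed.

Lemma laurent_t k : laurent (tvar ^- k).
Proof. by exists 1, k; rewrite tofrac1 mul1r. Qed.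

Lemma laurentM x y : laurent x -> laurent y -> laurent (x * y).
Proof.
move=> [p [k ->]] [q [l ->]]; exists (p * q), (k + l)%N.
by rewrite tofracM exprD invfM mulrACA.
Qed.

Lemma laurentD x y : laurent x -> laurent y -> laurent (x + y).
Proof.
move=> [p [k ->]] [q [l ->]]; exists (p * 'X^l + q * 'X^k), (k + l)%N.
by rewrite tofracD !tofracM !tofracXn -/tvar exprD addf_div.
Qed.

Lemma laurentN x : laurent x -> laurent (- x).
Proof. by move=> [p [k ->]]; exists (- p), k; rewrite tofracN mulNr. Qed.

Lemma laurent_int (z : int) : laurent z%:~R.
Proof. by rewrite -(rmorph_int (@tofrac {poly int})); exact: laurent_poly. Qed.

Lemma laurent_sum (I : Type) (r : seq I) (P : pred I) (F : I -> ratfun) :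
  (forall i, laurent (F i)) -> laurent (\sum_(i <- r | P i) F i).
Proof.
by move=> lF; elim/big_rec: _ => [|i x _ lx]; [exact: (laurent_int 0)|exact: laurentD].
Qed.

Lemma laurent_prod (I : Type) (r : seq I) (P : pred I) (F : I -> ratfun) :
  (forall i, laurent (F i)) -> laurent (\prod_(i <- r | P i) F i).
Proof.
by move=> lF; elim/big_rec: _ => [|i x _ lx]; [exact: (laurent_int 1)|exact: laurentM].
Qed.

Lemma laurent_det n (A : 'M[ratfun]_n) : (forall i j, laurent (A i j)) -> laurent (\det A).
Proof.
move=> lA; apply: laurent_sum => s; apply: laurentM; last exact: laurent_prod.
by rewrite -signr_odd; case: odd; [rewrite expr1; exact: (laurent_int (-1))|exact: (laurent_int 1)].
Qed.

(** ** Units and normalization *)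

Lemma dvd_Xn (p q : {poly int}) N : p * q = 'X^N ->
  exists (s : bool) (k : nat), p = (-1) ^+ s * 'X^k.
Proof.
elim: N p q => [|N IH] p q e.
  have : p \is a GRing.unit by apply/unitrP; exists q; rewrite mulrC e expr0.
  rewrite poly_unitE => /andP [/eqP /eq_leq /size1_polyC -> u].
  have : (p`_0 == 1) || (p`_0 == -1) by move: u; rewrite coefC eqxx.
  by case/orP => /eqP ->; [exists false|exists true]; exists 0%N;
    rewrite /= !expr0 mulr1 // expr1 polyCN.
have : root (p * q) 0 by rewrite e /root !hornerE expr0n.
rewrite rootM => /orP [] /factor_theorem [r]; rewrite subr0 => rE.
  have : r * q = 'X^N.
    by apply: (mulIf (negbT (polyX_eq0 _))); rewrite -exprSr -e rE; ring.
  by case/IH => s [k kE]; exists s, k.+1; rewrite rE kE exprSr mulrA.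
apply: (IH p r); apply: (mulIf (negbT (polyX_eq0 _))).
by rewrite -exprSr -e rE mulrA.
Qed.

Lemma laurent_unit x y : laurent x -> laurent y -> x * y = 1 ->
  exists (s : bool) (k l : nat), x = (-1) ^+ s * tvar ^+ k / tvar ^+ l.
Proof.
move=> [p [k ->]] [q [l ->]] e.
have : p * q = 'X^(k + l).
  apply/eqP; rewrite -tofrac_eq tofracM tofracXn -/tvar exprD.
  by move: e; rewrite mulf_div => /divr1_eq ->.
case/dvd_Xn => s [m ->]; exists s, m, k.
by rewrite tofracM !tofracXn tofracN tofrac1.
Qed.

Lemma cross_fractions (F : fieldType) (q p s tk tl ta tb : F) :
  tl != 0 -> ta != 0 -> tb != 0 ->
  q / tb = s * tk / tl * (p / ta) -> q * (tl * ta) = s * (tk * tb * p).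
Proof.
move=> l0 a0 b0 e; rewrite -[q](divfK b0) e; field.
by rewrite l0 a0.
Qed.

(** The value 1 at 1 excludes the sign. As multiplication by a power of t adds its exponent to the
    derivative at 1, the derivative excludes the power. *)
Lemma normalized_unique D D' (s : bool) (k l : nat) :
  normalized_at1 D -> normalized_at1 D' ->
  D' = (-1) ^+ s * tvar ^+ k / tvar ^+ l * D -> D' = D.
Proof.
move=> [p [a [-> p1 p1']]] [q [b [-> q1 q1']]] e.
have E : q * ('X^l * 'X^a) = (-1) ^+ s * ('X^k * 'X^b * p).
  have := cross_fractions (tvarX_neq0 l) (tvarX_neq0 a) (tvarX_neq0 b) e.
  rewrite /tvar -[1]tofrac1 -tofracN -!tofracXn -!tofracM => /eqP.
  by rewrite tofrac_eq => /eqP.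
case: s E e => /= E.
  have := congr1 (horner^~ 1) E.
  by rewrite expr1 mulN1r hornerN !hornerM !hornerXn !expr1n q1 p1 !mulr1.
rewrite expr0 mul1r in E *; have := congr1 (horner^~ 1) (congr1 deriv E).
rewrite !derivM !derivXn !(hornerD, hornerM, hornerMn, hornerXn) !expr1n.
rewrite q1 p1 !mulr1 !mul1r => E'.
have kl : k = l.
  rewrite q1 mulr1 in q1'; rewrite p1 mulr1 in p1'.
  move/eqP: q1'; rewrite subr_eq0 => /eqP q1'; move/eqP: p1'; rewrite subr_eq0 => /eqP p1'.
  rewrite q1' p1' in E'; lia.
by rewrite kl divff // mul1r.
Qed.

(** ** Expansions *)

Lemma tofrac_int (z : int) : tofrac z%:P = z%:~R.
Proof. by rewrite -[in LHS](intz z) !rmorph_int. Qed.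

Lemma expansion_step (F : fieldType) (u U c t f r : F) : t != 0 -> 
  U * ((c * t + u * f) / t) - c * U = u * U * (f / t).
Proof. by move=> t0; field. Qed.

(** Writing p = p(1) X^k + (1 - X) q splits off the constant p(1) from p / t^k and leaves 1 - t
    times a fraction with the same denominator; this is iterated. *)
Lemma laurent_expansion x : laurent x -> exists a, expansion_at1 x a.
Proof.
move=> [p [k ->]].
have /boolp.choice [f fE] : forall p : {poly int}, exists q, p = p.[1]%:P * 'X^k + (1 - 'X) * q.
  move=> r; have : root (r - r.[1]%:P * 'X^k) 1.
    by rewrite /root hornerD hornerN hornerM hornerC hornerXn expr1n mulr1 subrr.
  case/factor_theorem => q qE; exists (- q).
  by rewrite -[LHS](subrK (r.[1]%:P * 'X^k)) qE; ring.
exists (fun m => (iter m f p).[1]) => N.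
exists (tofrac (iter N f p) / tvar ^+ k); first by exists (iter N f p), k.
elim: N => [|N IH]; first by rewrite big_ord0 subr0 expr0 mul1r.
rewrite big_ord_recr /= opprD addrA IH {1}(fE (iter N f p)).
rewrite tofracD !tofracM tofracB tofracXn tofrac1 -/tvar exprS.
by rewrite (tofrac_int (iter N f p).[1]); exact: expansion_step.
Qed.

(** [alpha] takes its expansion from [xget], so the coefficient must be the same for every
    expansion. Substituting 1 - X for X turns divisibility by a power of 1 - X into the vanishing of
    low coefficients. *)
Lemma expansion_coef2 D a (b : nat -> int) r : expansion_at1 D a -> laurent r ->
  D - \sum_(m < 3) (b m)%:~R * (1 - tvar) ^+ m = (1 - tvar) ^+ 3 * r -> a 2%N = b 2%N.
Proof.
move=> /(_ 3%N) [r' lr' e'] lr e.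
have [p [k pE]] : laurent (r - r') by apply: laurentD => //; apply: laurentN.
have E : (\sum_(m < 3) (a m - b m)%:P * (1 - 'X) ^+ m) * 'X^k = (1 - 'X) ^+ 3 * p.
  apply/eqP; rewrite -tofrac_eq !tofracM !tofracXn !tofracB tofrac1 -/tvar.
  rewrite -[X in _ == _ * X](divfK (tvarX_neq0 k)) -pE [_ * (_ * tvar ^+ k)]mulrA [_ ^+ 3 * _]mulrBr -e -e'.
  rewrite opprB [X in _ == X * _]addrC subrKA -sumrB rmorph_sum /=; apply/eqP; congr (_ * _).
  apply: eq_bigr => m _.
  by rewrite tofracM tofrac_int tofracXn tofracB tofrac1 -/tvar rmorphB /= mulrBl.
have {}E : (\sum_(m < 3) (a m - b m)%:P * 'X ^+ m) * (1 - 'X)^+k = 'X ^+ 3 * (p \Po (1 - 'X)).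
  have c1X : (1 - 'X : {poly int}) \Po (1 - 'X) = 'X.
    by rewrite rmorphB /= rmorph1 comp_polyX opprB addrC subrK.
  have := congr1 (fun q => q \Po (1 - 'X)) E.
  rewrite !rmorphM !rmorphXn /= comp_polyX c1X => <-.
  congr (_ * _); rewrite rmorph_sum /=; apply: eq_bigr => m _.
  by rewrite rmorphM rmorphXn /= comp_polyC c1X.
set S := \sum_(m < 3) _ in E; set q := (1 - 'X) ^+ k in E.
have q0 : q`_0 = 1 by rewrite -horner_coef0 /q horner_exp hornerD hornerN hornerX hornerC subr0 expr1n.
have SE m : (m < 3)%N -> S`_m = a m - b m.
  by case: m => [|[|[|//]]] _; rewrite /S !big_ord_recl big_ord0 !coefD !coefCM !coefXn coef0 /=; ring.
have C m : (m < 3)%N -> (S * q)`_m = 0 by move=> m3; rewrite E coefXnM m3.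
have /esym := C 0%N isT; rewrite coefM !big_ord_recl big_ord0 /= q0 SE // mulr1 addr0 => z0.
have /esym := C 1%N isT; rewrite coefM !big_ord_recl big_ord0 /= q0 !SE // -z0 mul0r mulr1 add0r addr0 => z1.
have /esym := C 2%N isT; rewrite coefM !big_ord_recl big_ord0 /= q0 !SE //.
rewrite -z0 -z1 !mul0r mulr1 !add0r addr0 => /esym /eqP; rewrite subr_eq0.
by move/eqP.
Qed.

Lemma laurent_nat n : laurent n%:R.
Proof. exact: (laurent_int n). Qed.

(** ** The first elementary ideal *)

Section Principal.
Variables (r : nat) (A : 'M[ratfun]_(r, r.+1)).
Hypothesis sumA : forall i, \sum_j A i j = 0.

Let B : 'M[ratfun]_r := mxsub id (lift ord0) A.
Let Z : 'M[ratfun]_(r, r.+1) := \matrix_(i, j) ((j == lift ord0 i)%:R - (j == ord0)%:R).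

(** As the rows sum to zero, the deleted column is minus the sum of the others; [Z] restores it. *)
Lemma factor_sum0 : A = B *m Z.
Proof.
apply/matrixP => i j; rewrite mxE.
under eq_bigr do rewrite !mxE mulrBr.
rewrite sumrB -mulr_suml.
have -> : \sum_k A (id i) (lift ord0 k) = - A i ord0.
  by move: (sumA i); rewrite big_ord_recl addrC => /eqP; rewrite addr_eq0 => /eqP.
rewrite mulNr opprK.
case: (unliftP ord0 j) => [k ->|->].
  rewrite (bigD1 k) //= eqxx mulr1 big1 ?addr0 => [|k' nk].
    by rewrite mulr0 addr0.
  by rewrite (inj_eq lift_inj) eq_sym (negbTE nk) mulr0.
by rewrite eqxx mulr1 big1 ?add0r // => k _; rewrite mulr0.
Qed.

Definition minors m (x : ratfun) : Prop :=
  exists c : {ffun 'I_m -> 'I_r} -> {ffun 'I_m -> 'I_r.+1} -> ratfun,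
    (forall f h, laurent (c f h)) /\ x = \sum_f \sum_h c f h * \det (mxsub f h A).

(** By the factorisation, choosing rows and columns of A multiplies [B] by a selection matrix on the
    left and by columns of [Z] on the right, so each maximal minor is a multiple of [\det B]. *)
Lemma minors_principal x : minors r x <-> exists2 a, laurent a & x = a * \det B.
Proof.
split=> [[c [lc ->]]|[a la ->]].
  have mE (f : {ffun 'I_r -> 'I_r}) (h : {ffun 'I_r -> 'I_r.+1}) : exists2 u, laurent u & \det (mxsub f h A) = u * \det B.
    exists (\det (rowsub f (1%:M : 'M_r)) * \det (colsub h Z)).
      apply: laurentM; apply: laurent_det => i j; rewrite !mxE.
        exact: laurent_nat.
      by apply: laurentD; [|apply: laurentN]; exact: laurent_nat.
    have -> : mxsub f h A = rowsub f 1%:M *m B *m colsub h Z.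
      rewrite {1}factor_sum0 mxsub_mul; congr (_ *m _); rewrite -{1}(mul1mx B) mxsub_mul.
      by congr (_ *m _); apply/matrixP => i j; rewrite !mxE.
    by rewrite !det_mulmx mulrAC.
  have {}mE (fh : {ffun 'I_r -> 'I_r} * {ffun 'I_r -> 'I_r.+1}) : exists u, laurent u /\ \det (mxsub fh.1 fh.2 A) = u * \det B.
    by case: (mE fh.1 fh.2) => u ? ?; exists u.
  have [u uE] := boolp.choice mE.
  exists (\sum_f \sum_h c f h * u (f, h)).
    apply: laurent_sum => f; apply: laurent_sum => h; apply: laurentM => //.
    by case: (uE (f, h)).
  rewrite mulr_suml; apply: eq_bigr => f _; rewrite mulr_suml; apply: eq_bigr => h _.
  by rewrite -mulrA; congr (_ * _); case: (uE (f, h)).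
pose f0 : {ffun 'I_r -> 'I_r} := [ffun i => i].
pose h0 : {ffun 'I_r -> 'I_r.+1} := [ffun i => lift ord0 i].
exists (fun f h => if (f == f0) && (h == h0) then a else 0); split=> [f h|].
  by case: ifP => _; last exact: (laurent_int 0).
rewrite (bigD1 f0) //= [X in _ + X]big1 ?addr0 => [|f /negbTE nf]; last first.
  by rewrite big1 // => h _; rewrite nf mul0r.
rewrite (bigD1 h0) //= [X in _ + X]big1 ?addr0 => [|h /negbTE nh]; last first.
  by rewrite nh andbF mul0r.
rewrite !eqxx /=; congr (_ * \det _).
by apply/matrixP => i j; rewrite !mxE !ffunE.
Qed.

Lemma elementary_ideal_principal x :
  elementary_ideal 1 A x <-> exists2 a, laurent a & x = a * \det B.
Proof.
rewrite -minors_principal.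
have -> : elementary_ideal 1 A x = minors (r.+1 - 1) x by [].
by rewrite subn1.
Qed.
End Principal.

(** ** The relation matrix of a long knot *)

(** [a], [k] and [o] stand for the indicators that the column belongs to the arc after the crossing,
    the arc before it and the over-arc. A unit is split off so that the other factor is polynomial
    in [t]. *)
Lemma fox_relation (F : fieldType) (t a k o : F) (s : bool) : t != 0 ->
  t^-1 * ((if ~~ s then o + t * (k + t * (if s then o + t * 0 else t^-1 * (0 - o)))
           else t^-1 * (k + t * (if s then o + t * 0 else t^-1 * (0 - o)) - o)) - a) =
  - t^-1 / (if s then t else 1) *
  ((if s then t else 1) * a - (if s then 1 else t) * k - (1 - t) * (if s then -1 else 1) * o).
Proof. by move=> t0; case: s => /=; field; rewrite ?oner_neq0 ?t0. Qed.

Section Matrix.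
Variable K : code 1.
Let w := K ord0.
Let r := size (unders K).
Definition under (k : nat) : passage := nth (Passage 0 true false) (unders K) k.
Definition over_arc (k : nat) : nat := arc_at K (index (mate (under k)) w).

Lemma over_arc_le k : (over_arc k <= r)%N.
Proof.
rewrite /over_arc /arc_at /r /unders size_filter -/w.
rewrite -[X in (_ <= count _ X)%N](cat_take_drop (index (mate (under k)) w)).
by rewrite count_cat leq_addr.
Qed.

Definition row_unit (k : nat) : ratfun := - tvar^-1 / (if pos (under k) then tvar else 1).

Lemma alexanderE k j : alexander_matrix K k j =
  row_unit k * ((if pos (under k) then tvar else 1) * (k.+1 == j)%:R
     - (if pos (under k) then 1 else tvar) * (k == j :> nat)%:R
     - (1 - tvar) * (if pos (under k) then -1 else 1) * (over_arc k == j)%:R).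
Proof.
rewrite -fox_relation //; rewrite mxE /wirtinger -/(under k) -/w -/(over_arc k) /=.
by case: (pos (under k)).
Qed.

(** The indicator of l < m is the sum of the indicators of the arc m over the columns after l, so
    differences in l recover single columns. *)
Definition eps (k l : nat) : int := (l < k)%N%:R - (l < over_arc k)%N%:R.
(* Rescaling the rows of the Alexander matrix by [row_unit] and undoing the
   difference of consecutive columns turns it into 1 + (1 - t) relM. *)
Definition relZ (k l : nat) : int :=
  - sgb (pos (under k)) * eps k l - (pos (under k))%:R * (k == l)%:R.
Definition relM : 'M[int]_r := \matrix_(k, l) relZ k l.
Definition relP (k l : nat) : {poly int} := (k == l)%:R + (1 - 'X) * (relZ k l)%:P.

Lemma relP_diff k j : relP k j - relP k j.+1 =
  (if pos (under k) then 'X else 1) * (k == j)%:R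
  - (if pos (under k) then 1 else 'X) * (k == j.+1)%:R
  - (1 - 'X) * (if pos (under k) then -1 else 1) * (over_arc k == j.+1)%:R.
Proof.
have e (m : nat) : (j < m)%N%:R = (m == j.+1)%:R + (j.+1 < m)%N%:R :> int.
  by rewrite leq_eqVlt eq_sym; case: eqP => [->|_] /=; rewrite ?ltnn ?addr0 ?add0r.
have nP (b : bool) : b%:R%:P = b%:R :> {poly int} by case: b.
rewrite /relP /relZ /eps !e /sgb.
by case: (pos _); rewrite !(polyCB, polyCD, polyCN, polyCM, nP, polyC1) /=; ring.
Qed.

(** Needed for the difference at the last column, whose successor lies outside the matrix. *)
Lemma relP_out (k : 'I_r) : relP k r = 0.
Proof.
have rk : (r < k)%N = false by rewrite ltnNge (ltnW (ltn_ord k)).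
have ro : (r < over_arc k)%N = false by rewrite ltnNge over_arc_le.
have z0 : relZ k r = 0.
  by rewrite /relZ /eps (ltn_eqF (ltn_ord k)) rk ro subrr !mulr0 subrr.
by rewrite /relP z0 (ltn_eqF (ltn_ord k)) polyC0 mulr0 addr0.
Qed.

Lemma det_alexander :
  \det (mxsub id (lift ord0) (alexander_matrix K)) =
  (\prod_(k < r) row_unit k) * tofrac (det1X relM \Po (1 - 'X)).
Proof.
pose Q : 'M[{poly int}]_r := \matrix_(k, l) relP k l.
(* [V] takes differences of consecutive columns and is unitriangular, so it does not change the
   determinant. *)
pose V : 'M[{poly int}]_r := \matrix_(l, j) ((l == j)%:R - (l == j.+1 :> nat)%:R).
have QV k (j : 'I_r) : (Q *m V) k j = relP k j - relP k j.+1.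
  rewrite mxE; under eq_bigr do rewrite !mxE mulrBr.
  rewrite sumrB (bigD1 j) //= eqxx mulr1 big1 ?addr0 => [|l /negbTE lj]; last first.
    by rewrite lj mulr0.
  congr (_ - _); have [jr|] := ltnP j.+1 r.
    rewrite (bigD1 (Ordinal jr)) //= eqxx mulr1 big1 ?addr0 // => l /negbTE lj.
    by rewrite -[_ == _]/(l == Ordinal jr) lj mulr0.
  rewrite leq_eqVlt ltnNge ltn_ord orbF => /eqP <-; rewrite relP_out big1 // => l _.
  by rewrite (ltn_eqF (ltn_ord l)) mulr0.
have dV : \det V = 1.
  rewrite det_trig; first by rewrite big1 // => k _; rewrite mxE eqxx (ltn_eqF (ltnSn k)) subr0.
  apply/is_trig_mxP => i j ij; rewrite mxE -val_eqE /= (ltn_eqF ij).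
  by rewrite (ltn_eqF (ltn_trans ij (ltnSn j))) subrr.
have dQ : \det Q = det1X relM \Po (1 - 'X).
  rewrite -[RHS]/(comp_poly (1 - 'X) (det1X relM)) /det1X -det_map_mx; congr (\det _).
  apply/matrixP => k l; rewrite !mxE /= rmorphD rmorphM /= comp_polyX comp_polyC.
  by rewrite rmorph_nat.
have -> : mxsub id (lift ord0) (alexander_matrix K) =
    diag_mx (\row_k row_unit k) *m map_mx (@tofrac {poly int}) (Q *m V).
  apply/matrixP => k j; rewrite [LHS]mxE alexanderE mul_diag_mx [RHS]mxE.
  rewrite [X in _ = X * _]mxE [X in _ = _ * X]mxE QV relP_diff lift0; congr (_ * _).
  rewrite !tofracB !tofracM !rmorph_nat /= tofracB tofrac1 -/tvar eqSS.
  by case: (pos _); rewrite ?tofracN tofrac1.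
rewrite (det_mulmx (diag_mx _)) det_diag det_map_mx (det_mulmx Q) dV mulr1 dQ; congr (_ * _).
by apply: eq_bigr => k _; rewrite mxE.
Qed.

End Matrix.

Lemma laurent_tX k : laurent (tvar ^+ k).
Proof. by rewrite /tvar -tofracXn; exact: laurent_poly. Qed.

Lemma laurent_tV : laurent tvar^-1.
Proof. exact: (laurent_t 1). Qed.

Lemma laurent_1 : laurent 1.
Proof. exact: (laurent_int 1). Qed.

Lemma unit_quotient_neq0 (F : fieldType) (t : F) (b : bool) :
  t != 0 -> - t^-1 / (if b then t else 1) != 0.
Proof.
move=> t0; rewrite mulf_neq0 ?oppr_eq0 ?invr_eq0 //.
by case: b; rewrite ?t0 ?oner_neq0.
Qed.

Lemma quotient_neq0 (F : fieldType) (x y : F) : x != 0 -> y != 0 -> x / y != 0.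
Proof. by move=> x0 y0; rewrite mulf_neq0 ?invr_eq0. Qed.

Lemma fraction_shift (F : fieldType) (p x y : F) : x != 0 -> y != 0 ->
  p = y / x * (x * p / y).
Proof. by move=> x0 y0; field; rewrite x0 y0. Qed.

Lemma unit_shift (F : fieldType) (c u x y D : F) : u != 0 -> x != 0 -> y != 0 ->
  c * D = c * (u^-1 * (x / y)) * (u * (y / x * D)).
Proof. by move=> u0 x0 y0; field; rewrite u0 x0 y0. Qed.

Lemma fraction_sub (F : fieldType) (x y z : F) : y != 0 -> x / y - z = (x - y * z) / y.
Proof. by move=> y0; field. Qed.

Lemma coef_1subX k (f := (1 - 'X : {poly int}) ^+ k) :
  [/\ f`_0 = 1, f`_1 = - k%:Z & f`_2 *+ 2 = k%:Z * (k%:Z - 1)].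
Proof.
rewrite /f {f}; elim: k => [|k [f0 f1 f2]]; first by rewrite expr0 !coef1 /= mul0r.
rewrite exprS mulrBl mul1r !coefB !coefXM /= f0 f1 subr0.
by split=> //; rewrite ?mulrnBl ?f2 intS; ring.
Qed.

Lemma divX3 (p : {poly int}) : (forall k, (k < 3)%N -> p`_k = 0) -> exists q, p = 'X^3 * q.
Proof.
move=> p0; exists (drop_poly 3 p); rewrite -[LHS](poly_take_drop 3) [RHS]mulrC.
suff -> : take_poly 3 p = 0 by rewrite add0r.
by apply/polyP => k; rewrite coef_take_poly coef0; case: ifP => // /p0.
Qed.

(** * The normalized polynomial and its second coefficient *)

Section Alpha.
Variable K : code 1.
Let r := size (unders K).
Let U : ratfun := \prod_(k < r) row_unit K k.

Lemma row_unit_laurent k : laurent (row_unit K k) /\ laurent (row_unit K k)^-1.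
Proof.
have lt := laurent_tX 1; have li := laurent_tV; have l1 := laurent_1.
rewrite expr1 in lt; rewrite /row_unit invfM invrN !invrK.
by case: (pos _); rewrite ?invr1; split; apply: laurentM => //; apply: laurentN.
Qed.

Lemma unit_laurent : [/\ laurent U, laurent U^-1 & U != 0].
Proof.
split; first by apply: laurent_prod => k; case: (row_unit_laurent k).
  by rewrite /U -prodfV; apply: laurent_prod => k; case: (row_unit_laurent k).
by apply/prodf_neq0 => k _; exact: unit_quotient_neq0 tvar_neq0.
Qed.

Lemma alexander_sum0 k : \sum_j alexander_matrix K k j = 0.
Proof.
under eq_bigr do rewrite alexanderE.
rewrite -mulr_sumr !sumrB -!mulr_sumr.
have sum1 m : (m < r.+1)%N -> \sum_(j < r.+1) (m == j)%:R = 1 :> ratfun.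
  move=> mr; rewrite (bigD1 (Ordinal mr)) //= eqxx big1 ?addr0 // => j /negbTE nj.
  by rewrite eq_sym -[_ == _]/(j == Ordinal mr) nj.
rewrite !sum1 ?ltnS ?over_arc_le //; last exact: ltnW.
by case: (pos _); rewrite !mulr1 ?mulrN1 ?opprK ?addrA ?subrK ?subrr ?mulr0 //.
Qed.

Let m : int := \tr (relM K).

(** The determinant has derivative -m at t = 1, which the factor t^m compensates; m may be negative,
    hence the difference a - b. Two generators of the ideal differ by a unit, so [normalized_unique]
    identifies the value of [xget]. *)
Lemma normalized_alexanderE (a b : nat) : m = a%:Z - b%:Z ->
  normalized_alexander K = tofrac ('X^a * (det1X (relM K) \Po (1 - 'X))) / tvar ^+ b.
Proof.
move=> mE; set P := det1X (relM K); set D := _ / _.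
have [P0 P1 _] := det1X_coef (relM K).
have PC1 : (P \Po (1 - 'X)).[1] = 1.
  by rewrite horner_comp hornerD hornerN hornerX hornerC subrr horner_coef0.
have dPC1 : ((P \Po (1 - 'X))^`()).[1] = - m.
  rewrite deriv_comp hornerM horner_comp derivB derivX -[1]/(1%:P) derivC sub0r.
  rewrite !hornerD !hornerN hornerX !hornerC subrr horner_coef0 coef_deriv P1.
  by rewrite mulrN1 mulr1n.
have ND : normalized_at1 D.
  exists ('X^a * (P \Po (1 - 'X))), b; split=> //.
    by rewrite hornerM hornerXn expr1n PC1 mulr1.
  rewrite derivM derivXn hornerM hornerD !hornerM hornerMn !hornerXn !expr1n PC1 dPC1 mE.
  by rewrite !mulr1 !mul1r natz natz opprB addrC; ring.
have D0 : D != 0.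
  apply: quotient_neq0; last exact: tvarX_neq0.
  rewrite tofrac_eq0; apply: mulf_neq0; first by rewrite expf_neq0 ?polyX_eq0.
  by apply/eqP => e; move: PC1; rewrite e hornerC.
have lD : laurent D by exists ('X^a * (P \Po (1 - 'X))), b.
have [lU lV U0] := unit_laurent.
have AD : alexander_polynomial K D.
  split=> // x; rewrite elementary_ideal_principal; last exact: alexander_sum0.
  rewrite det_alexander -/U -/P.
  have tP : tofrac (P \Po (1 - 'X)) = tvar ^+ b / tvar ^+ a * D.
    by rewrite /D tofracM tofracXn; apply: fraction_shift; exact: tvarX_neq0.
  rewrite tP; split=> -[c lc ->].
    exists (c * (U * (tvar ^+ b / tvar ^+ a))); last by rewrite !mulrA.
    by do 3!apply: laurentM => //; [exact: laurent_tX|exact: laurent_t].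
  exists (c * (U^-1 * (tvar ^+ a / tvar ^+ b))).
    by do 3!apply: laurentM => //; [exact: laurent_tX|exact: laurent_t].
  by apply: unit_shift; rewrite ?tvarX_neq0.
apply: xget_subset1 => // D1 D2 [A1 N1] [A2 N2].
suff gen D' : alexander_polynomial K D' -> normalized_at1 D' -> D' = D.
  exact: (etrans (gen D1 A1 N1) (esym (gen D2 A2 N2))).
move=> {A1 N1 A2 N2} [lD' AD'] ND'.
have [x lx xE] : exists2 x, laurent x & D' = x * D.
  by apply/(AD.2 D')/AD'; exists 1; [exact: laurent_1|rewrite mul1r].
have [y ly yE] : exists2 y, laurent y & D = y * D'.
  by apply/(AD' D)/AD.2; exists 1; [exact: laurent_1|rewrite mul1r].
have xy : x * y = 1.
  by apply: (mulIf D0); rewrite mul1r mulrAC -xE mulrC -yE.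
have [s [k [l xs]]] := laurent_unit lx ly xy.
exact: (normalized_unique ND ND' (etrans xE (congr1 (fun z => z * D) xs))).
Qed.

(** With u = 1 - t, this is the second coefficient of the product of t^m = 1 - m u + m (m - 1) / 2
    u^2 + ... and 1 + m u + (m^2 - tr M^2) / 2 u^2 + ..., doubled. *)
Lemma alpha2_tr : alpha 2 K *+ 2 = - \tr (relM K *m relM K) - m.
Proof.
have [a [b mE]] : exists a b : nat, m = a%:Z - b%:Z.
  by case: (intP m) => [|k|k]; [exists 0%N, 0%N|exists k.+1, 0%N|exists 0%N, k.+1];
    rewrite ?subr0 ?sub0r.
have [P0 P1 P2] := det1X_coef (relM K); set P := det1X (relM K) in P0 P1 P2.
have NE := normalized_alexanderE mE; rewrite -/P in NE.
have lN : laurent (normalized_alexander K).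
  by rewrite NE; exists ('X^a * (P \Po (1 - 'X))), b.
have ex : exists c, expansion_at1 (normalized_alexander K) c := laurent_expansion lN.
have exp := xgetPex (fun=> 0) ex.
have [f0 f1 f2] := coef_1subX a; have [g0 g1 g2] := coef_1subX b.
set f := (1 - 'X) ^+ a in f0 f1 f2; set g := (1 - 'X) ^+ b in g0 g1 g2.
(* Chosen so that t^a times the determinant and t^b (1 + al u^2), where u = 1 - t, agree below order
   3 in u. *)
pose al : int := f`_2 - a%:Z * P`_1 + P`_2 - g`_2.
have alE : al *+ 2 = - \tr (relM K *m relM K) - m.
  rewrite /al mulrnBl mulrnDl mulrnBl f2 g2 P2 P1 -/m mE; ring.
pose c (k : nat) : int := nth 0 [:: 1; 0; al] k.
have [q qE] : exists q, f * P - g * (1 + al%:P * 'X^2) = 'X^3 * q.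
  apply: divX3 => k k3.
  rewrite coefB mulrDr mulr1 coefD mulrA coefMXn [g * _]mulrC coefCM coefM.
  case: k k3 => [|[|[|//]]] _; rewrite !big_ord_recl big_ord0 /= ?subnn ?subn0.
  - by rewrite f0 P0 g0; ring.
  - by rewrite f0 f1 P0 P1 -/m g1 mE; ring.
  - by rewrite /al f0 f1 P0 g0 P1 /bump /=; ring.
rewrite -alE; congr (_ *+ 2).
have lr : laurent (tofrac (q \Po (1 - 'X)) / tvar ^+ b) by exists (q \Po (1 - 'X)), b.
apply: (expansion_coef2 (b := c) exp lr).
have {}qE : 'X^a * (P \Po (1 - 'X)) - 'X^b * (1 + al%:P * (1 - 'X) ^+ 2) =
    (1 - 'X) ^+ 3 * (q \Po (1 - 'X)).
  have c1X : (1 - 'X : {poly int}) \Po (1 - 'X) = 'X.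
    by rewrite rmorphB /= rmorph1 comp_polyX opprB addrC subrK.
  have := congr1 (fun s => s \Po (1 - 'X)) qE.
  rewrite /f /g rmorphB !rmorphM rmorphD rmorphM !rmorphXn /= c1X comp_polyX comp_polyC.
  by rewrite comp_polyC polyC1 => ->; rewrite !exprS expr0 mulr1.
rewrite NE !big_ord_recl big_ord0 /c /=.
have := congr1 (@tofrac {poly int}) qE.
rewrite tofracB !tofracM !tofracXn tofracD tofracM tofracXn tofracB tofrac1 -/tvar tofrac_int.
set x := tofrac _; set y := tofrac _ => E.
rewrite expr0 expr1 mulr0z mulr1z mul0r mulr1 add0r addr0.
have {}E : tvar ^+ a * x - tvar ^+ b * (1 + al%:~R * (1 - tvar) ^+ 2) = (1 - tvar) ^+ 3 * y := E.
rewrite [RHS]mulrA -E.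
exact: fraction_sub (tvarX_neq0 b).
Qed.
End Alpha.

(** * The second coefficient counts pairs of arrows *)

Section AlphaPairs.
Variable K : code 1.
Hypothesis wK : wf_code K.
Let w := K ord0.
Let r := size (unders K).

Lemma knot_wfw : wfw w.
Proof.
move: wK; rewrite wf_codeE /passages /codom /image_mem enum_ordSl enum_ord0 /=.
by rewrite cats0.
Qed.

Lemma knot_keys : uniq (map key w).
Proof. by case/andP: knot_wfw. Qed.

Lemma knot_uniq : uniq w.
Proof. exact: map_uniq knot_keys. Qed.

Lemma under_mem k : (k < r)%N -> (under K k \in w) && ~~ over (under K k).
Proof.
by move=> kr; have := mem_nth (Passage 0 true false) kr; rewrite mem_filter andbC.
Qed.

Lemma mate_mem k : (k < r)%N -> mate (under K k) \in w.
Proof. by move=> /under_mem /andP [kw _]; have /andP [_ /allP] := knot_wfw; apply. Qed.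

Lemma arc_under k : (k < r)%N -> arc_at K (index (under K k) w) = k.
Proof.
move=> kr; have /andP [kw ok] := under_mem kr.
have iE : index (under K k) (unders K) = k.
  by rewrite index_uniq // filter_uniq // knot_uniq.
rewrite -[RHS]iE /arc_at /unders -/w.
have kt : under K k \notin take (index (under K k) w) w.
  by rewrite in_take_leq ?ltnn // index_size.
rewrite -[in RHS](cat_take_drop (index (under K k) w) w) filter_cat index_cat mem_filter (negbTE kt).
rewrite andbF (drop_nth (under K k)) ?index_mem // nth_index //= ok /= eqxx addn0.
by rewrite size_filter.
Qed.

Lemma arc_mono i j : (i <= j)%N -> (arc_at K i <= arc_at K j)%N.
Proof.
move=> ij; rewrite /arc_at -(cat_take_drop i (take j w)) count_cat.
by rewrite -take_min (minn_idPl ij) leq_addr.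
Qed.

Lemma arc_le q k : q \in w -> over q -> (k < r)%N ->
  (arc_at K (index q w) <= k)%N = (index q w < index (under K k) w)%N.
Proof.
move=> qw oq kr; have /andP [kw ok] := under_mem kr.
apply/idP/idP => [|lt]; last by rewrite -[leqRHS](arc_under kr); apply: arc_mono; exact: ltnW.
rewrite ltnNge; apply: contraTN; rewrite leq_eqVlt => /orP [/eqP e|lt].
  by move: ok; rewrite (_ : under K k = q) ?oq // -(nth_index q kw) e nth_index.
rewrite -ltnNge; apply: leq_trans (arc_mono lt).
rewrite /arc_at (take_nth (under K k)) ?index_mem // nth_index // -cats1 count_cat /= ok.
by rewrite -[X in (X < _)%N](arc_under kr) /arc_at; lia.
Qed.

Lemma under_le k l : (k < r)%N -> (l < r)%N ->
  (k < l)%N = (index (under K k) w < index (under K l) w)%N.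
Proof.
move=> kr lr.
have hom i j : (i < r)%N -> (j < r)%N -> (i < j)%N ->
    (index (under K i) w < index (under K j) w)%N.
  move=> ir jr; rewrite !ltnNge; apply: contra => /arc_mono.
  by rewrite !arc_under.
apply/idP/idP => [|lt]; first exact: hom.
by rewrite ltnNge; apply: contraTN lt; rewrite -leqNgt leq_eqVlt => /orP [/eqP -> //|/hom/ltnW ->].
Qed.

(** An over-passage precedes the k-th under-passage exactly when its arc is at most k ([arc_le]), so
    the order of the four passages amounts to three comparisons of arc numbers. *)
Lemma pt_arcs k l : (k < r)%N -> (l < r)%N ->
  pt (lbl (under K k)) (lbl (under K l)) w =
  [&& (k < l)%N, (over_arc K l <= k)%N & (l < over_arc K k)%N].
Proof.
move=> kr lr; have /andP [kw ok] := under_mem kr; have /andP [lw ol] := under_mem lr.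
have kO := mate_mem kr; have lO := mate_mem lr.
have [<-|kl] := eqVneq k l; first by rewrite ltnn /pt eqxx.
have lkl : lbl (under K k) != lbl (under K l).
  apply: contra_neq kl => e; rewrite -(arc_under kr) -(arc_under lr).
  by congr (arc_at K (index _ w)); apply: (key_inj knot_keys) => //; rewrite /key e (negbTE ok) (negbTE ol).
rewrite (ltnNge l) /over_arc -/w !arc_le //= -leqNgt under_le //.
pose L := [:: mate (under K l); under K k; under K l; mate (under K k)].
have mL q : (q \in L) = (q \in flt (lbl (under K k)) (lbl (under K l)) w).
  rewrite mem_filter !inE; apply/idP/andP => [|[ql qw]].
    by case/or4P => /eqP ->; rewrite ?eqxx ?orbT.
  by case/orP: ql => /eqP /esym /(wfw_lbl knot_wfw _ qw) [//|->|->]; rewrite eqxx ?orbT.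
have uF : uniq (flt (lbl (under K k)) (lbl (under K l)) w) by rewrite filter_uniq // knot_uniq.
pose ix := index^~ w.
have sw : sorted (relpre ix ltn) w.
  rewrite -sorted_map (_ : map ix w = iota 0 (size w)) ?iota_ltn_sorted //.
  apply: (@eq_from_nth _ 0%N) => [|i]; rewrite size_map ?size_iota // => iw.
  by rewrite (nth_map (under K k)) // nth_iota // /ix index_uniq // knot_uniq.
have tr : transitive (relpre ix ltn) by move=> a b c; exact: ltn_trans.
have ir : irreflexive (relpre ix ltn) by move=> a; exact: ltnn.
have sF : sorted (relpre ix ltn) (flt (lbl (under K k)) (lbl (under K l)) w).
  exact: sorted_filter.
(* The filtered word consists of the same four passages sorted by position, so it is [L] exactly
   when [L] is sorted. *)
have FL : (flt (lbl (under K k)) (lbl (under K l)) w == L) = sorted (relpre ix ltn) L.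
  apply/eqP/idP => [<- //|sL]; exact: (irr_sorted_eq tr ir sF sL (fun q => esym (mL q))).
have -> : pt (lbl (under K k)) (lbl (under K l)) w =
    (flt (lbl (under K k)) (lbl (under K l)) w == L).
  rewrite /pt lkl /= -(_ : map (keyto (lbl (under K l))) L = pat); last first.
    by rewrite /keyto /= (negbTE lkl) eqxx (negbTE ok) (negbTE ol).
  apply/eqP/eqP => [|-> //]; apply: (inj_in_map (A := mem L)).
  - move=> p q; rewrite !mL !mem_filter /keyto => /andP [pl pw] /andP [ql qw] [el eo].
    apply: (key_inj knot_keys) => //; rewrite /key eo; congr pair.
    case/orP: pl ql el => /eqP -> /orP [] /eqP -> //; rewrite eqxx (negbTE lkl) //.
  - by apply/allP => q qF; have := qF; rewrite -mL.
  - by apply/allP.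
rewrite FL /= andbT /ix.
have e : (index (mate (under K k)) w == index (under K l) w) = false.
  apply/negbTE/eqP => e; have := nth_index (under K k) kO; rewrite e nth_index // => e'.
  by move: lkl; rewrite e' eqxx.
rewrite [in RHS](leq_eqVlt (index (under K l) w)) eq_sym e /=.
by rewrite andbCA !andbA.
Qed.

Lemma sum_unders (F : passage -> int) : \sum_(p <- w | ~~ over p) F p = \sum_(k < r) F (under K k).
Proof. by rewrite -big_filter (big_nth (Passage 0 true false)) big_mkord. Qed.

(** Diagonal entries of [relM] are 0 or -1, so their squares cancel the trace. For k < l the product
    of the entries (k, l) and (l, k) is, up to the factor -1, the product of the signs times the
    condition of [pt_arcs]. *)
Lemma alpha2_pairs : alpha 2 K = pairs w.
Proof.
pose e (k : 'I_r) : int := sgp (under K k).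
pose Q (k l : 'I_r) : int := [&& (k < l)%N, (over_arc K l <= k)%N & (l < over_arc K k)%N]%:R.
have pE : pairs w = \sum_k \sum_l e k * e l * Q k l.
  rewrite /pairs sum_unders; apply: eq_bigr => k _; rewrite sum_unders; apply: eq_bigr => l _.
  by rewrite pt_arcs.
have two (x y : int) : x *+ 2 = y *+ 2 -> x = y by lia.
apply: two; rewrite alpha2_tr pE.
have -> : (\sum_k \sum_l e k * e l * Q k l) *+ 2 =
    \sum_k \sum_l e k * e l * (Q k l + Q l k).
  rewrite mulr2n {2}exchange_big -big_split; apply: eq_bigr => k _ /=.
  rewrite -big_split; apply: eq_bigr => l _ /=; ring.
rewrite -opprD /mxtrace -big_split -sumrN; apply: eq_bigr => k _.
rewrite /= mxE (bigD1 k) //= [RHS](bigD1 k) //= addrAC opprD -sumrN.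
have -> : relM K k k * relM K k k + relM K k k = 0.
  rewrite !mxE /relZ /eps !ltnn eqxx /sgb.
  by case: (pos _); case: (k < _)%N => /=; ring.
have -> : Q k k = 0 by rewrite /Q ltnn.
rewrite addr0 mulr0 oppr0 !add0r; apply: eq_bigr => l /negbTE lk.
have nlk : (l == k :> nat) = false by [].
have nkl : (k == l :> nat) = false by rewrite eq_sym.
rewrite !mxE /relZ /eps nlk nkl /e /sgp /Q.
case: (ltngtP k l) => [kl|kl|kl]; last by move: nlk; rewrite kl eqxx.
  rewrite (leqNgt _ k) /=.
  by case: (l < _)%N; case: (k < _)%N => /=; ring.
rewrite (leqNgt _ l) /=.
by case: (l < _)%N; case: (k < _)%N => /=; ring.
Qed.
End AlphaPairs.

(** * Trees are of higher degree *)

Section Difference.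
Variables (A : zmodType).
Implicit Types (f : seq nat -> A) (S B : seq nat).

(** Iterated differences replace alternating sums over subsets, so that whole groups of crossings
    can be virtualized in place of single ones. *)
Definition difference S f B : A := f B - f (B ++ S).

Definition extensional f := forall B B', B =i B' -> f B = f B'.

Lemma difference_ext S f : extensional f -> extensional (difference S f).
Proof.
move=> ef B B' e; rewrite /difference (ef _ _ e); congr (_ - _).
by apply: ef => x; rewrite !mem_cat e.
Qed.

Lemma differenceC S S' f B : extensional f ->
  difference S (difference S' f) B = difference S' (difference S f) B.
Proof.
move=> ef; rewrite /difference !opprD addrACA; congr (_ + (_ - - _)); apply: ef => x.
by rewrite !mem_cat -!orbA; congr orb; rewrite orbC.
Qed.

Lemma difference_cons a S f B : difference (a :: S) f B =
  difference [:: a] f B + difference S f (B ++ [:: a]).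
Proof. by rewrite /difference -catA addrA subrK. Qed.

Lemma eq_difference S f g B : f =1 g -> difference S f B = difference S g B.
Proof. by move=> e; rewrite /difference !e. Qed.

Variables (X : pred nat) (f : seq nat -> A).
Hypothesis ef : extensional f.
Hypothesis f3 : forall B a b c, uniq (B ++ [:: a; b; c]) -> all X [:: a; b; c] ->
  difference [:: a] (difference [:: b] (difference [:: c] f)) B = 0.

(** [difference_cons] telescopes the difference along a list into differences along single
    crossings. Since differences commute, the three lists can be broken up one after the other. *)
Lemma difference3 S S' S'' B : uniq (B ++ S ++ S' ++ S'') -> all X (S ++ S' ++ S'') ->
  difference S (difference S' (difference S'' f)) B = 0.
Proof.
have D0 g C : difference [::] g C = 0 by rewrite /difference cats0 subrr.
have shift C a T T' : uniq (C ++ (a :: T) ++ T') -> uniq ((C ++ [:: a]) ++ T ++ T').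
  by rewrite -!catA.
have drop C a (T T' : seq nat) : uniq (C ++ (a :: T) ++ T') -> uniq (C ++ [:: a] ++ T').
  apply: subseq_uniq; apply: cat_subseq => //; apply: cat_subseq => //.
  by rewrite sub1seq mem_head.
have s1 b c T C : uniq (C ++ T ++ [:: b; c]) -> all X (T ++ [:: b; c]) ->
    difference T (difference [:: b] (difference [:: c] f)) C = 0.
  elim: T C => [|a T IH] C uC; first by rewrite D0.
  rewrite [all _ _]/= => /andP [Xa XT]; rewrite difference_cons IH ?addr0 //; last exact: shift.
  apply: f3; first exact: drop uC.
  by move: XT; rewrite all_cat /= Xa => /andP [_ ->].
have perm3 (C T T' T'' : seq nat) : perm_eq (C ++ T ++ T' ++ T'') (C ++ T' ++ T ++ T'').
  by rewrite perm_cat2l perm_catCA.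
have s2 c S1 T C : uniq (C ++ S1 ++ T ++ [:: c]) -> all X (S1 ++ T ++ [:: c]) ->
    difference S1 (difference T (difference [:: c] f)) C = 0.
  elim: S1 C => [|a S1 IH] C uC; first by rewrite D0.
  rewrite [all _ _]/= => /andP [Xa XT]; rewrite difference_cons IH ?addr0 //; last exact: shift.
  rewrite differenceC; last exact: difference_ext.
  apply: s1; first by have := drop _ _ _ _ uC; rewrite (perm_uniq (perm3 _ _ _ _)).
  by move: XT; rewrite !all_cat /= Xa => /andP [_ ->].
elim: S B => [|a S IH] B uC; first by rewrite D0.
rewrite [all _ _]/= => /andP [Xa XT]; rewrite difference_cons IH ?addr0 //; last exact: shift.
rewrite differenceC; last exact: difference_ext.
rewrite (eq_difference _ _ (fun C => differenceC [:: a] S'' C ef)).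
apply: s2.
  have := drop _ _ _ _ uC; rewrite (perm_uniq (_ : perm_eq _ (B ++ S' ++ S'' ++ [:: a]))) //.
  by rewrite perm_cat2l perm_catC -catA.
by move: XT; rewrite !all_cat /= Xa => /and3P [_ -> ->].
Qed.
End Difference.

Section FiniteType2.
Variables (n : nat) (A : zmodType) (nu : diagram n -> A).
Implicit Types (L : diagram n) (S : seq nat).

Lemma diagram_eq L L' : (L : code n) = L' -> L = L'.
Proof.
by case: L L' => C wC [C' wC'] /= e; subst C'; congr Diagram; exact: bool_irrelevance.
Qed.

Lemma virtualize_ext L : extensional (fun S => nu (virtualize S L)).
Proof.
move=> S S' e; congr nu; apply: diagram_eq; apply/ffunP => i; rewrite !ffunE.
by apply: eq_filter => p; rewrite e.
Qed.

Lemma virtualize_cat L S S' : virtualize S' (virtualize S L) = virtualize (S ++ S') L.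
Proof.
apply: diagram_eq; apply/ffunP => i; rewrite !ffunE -filter_predI; apply: eq_filter => p /=.
by rewrite mem_cat negb_or andbC.
Qed.

Lemma crossings_virtualize L S a :
  (a \in crossings (virtualize S L)) = (a \notin S) && (a \in crossings L).
Proof.
rewrite /crossings passages_virtualize; apply/mapP/andP => [[p]|[aS /mapP [p pL e]]].
  by rewrite mem_filter => /andP [pS pL] ->; split=> //; apply: map_f.
by exists p => //; rewrite mem_filter -e aS.
Qed.

Hypothesis ft : finite_type 2 nu.

Lemma finite_type_difference L B a b c :
  uniq (B ++ [:: a; b; c]) -> all (mem (crossings L)) [:: a; b; c] ->
  difference [:: a] (difference [:: b] (difference [:: c] (fun S => nu (virtualize S L)))) B = 0.
Proof.
rewrite cat_uniq => /and3P [_ dB uS] /allP cL.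
have sS : {subset [tuple a; b; c] <= crossings (virtualize B L)}.
  move=> x xS; rewrite crossings_virtualize [_ \in crossings _](cL x xS) andbT.
  by apply: contra dB => xB; apply/hasP; exists x.
have := ft (L := virtualize B L) uS sS.
(* Subsets of three crossings are indexed by triples of booleans, which lets the alternating sum be
   written out. *)
pose phi (x : bool * bool * bool) : {set 'I_3} := [set i : 'I_3 | nth false [:: x.1.1; x.1.2; x.2] i].
pose psi (J : {set 'I_3}) := (inord 0 \in J, inord 1 \in J, inord 2 \in J).
rewrite (reindex phi) /=; last first.
  exists psi => [[[x y] z] _|J _].
    by rewrite /psi !inE /= !inordK.
  apply/setP => i; rewrite !inE /psi /=.
  by case: i => [[|[|[|//]]] hi] /=; congr (_ \in J); apply: val_inj; rewrite /= inordK.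
pose pick (x : bool) (s : nat) := if x then [:: s] else [::].
pose F x y z := nu (virtualize (B ++ pick z a ++ pick y b ++ pick x c) L).
rewrite (eq_bigr (fun t : bool * bool * bool =>
    F t.2 t.1.2 t.1.1 *~ (-1) ^+ (t.1.1 + t.1.2 + t.2)%N)); last first.
  move=> [[x y] z] _ /=.
  have -> : nu (virtualize [seq tnth [tuple a; b; c] j | j in phi (x, y, z)] (virtualize B L)) =
     F z y x.
    rewrite virtualize_cat; apply: virtualize_ext => l; rewrite !mem_cat; congr orb.
    apply/fintype.imageP/idP => [[j]|].
      rewrite inE => + ->; case: j => [[|[|[|//]]] hj] /= h; rewrite (tnth_nth a) /= /pick h ?mem_head ?orbT //.
    have M x' i (hi : (i < 3)%N) e : l \in pick x' e -> nth false [:: x; y; z] i = x' ->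
        nth a [:: a; b; c] i = e ->
        exists2 j, j \in phi (x, y, z) & l = tnth [tuple a; b; c] j.
      case: x' => //=; rewrite inE => /eqP -> h he; exists (Ordinal hi); first by rewrite inE.
      by rewrite (tnth_nth a).
    by case/or3P => h; [exact: (M x 0%N isT a h)|exact: (M y 1%N isT b h)|exact: (M z 2%N isT c h)].
  have -> : #|phi (x, y, z)| = (x + y + z)%N.
    rewrite cardsE -sum1_card big_mkcond !big_ord_recl big_ord0 /=.
    by rewrite -!topredE /=; case: x y z => [] [] [].
  by [].
rewrite -(pair_bigA _ (fun xy z => F z xy.2 xy.1 *~ (-1) ^+ (xy.1 + xy.2 + z))) /=.
rewrite -(pair_bigA _ (fun x y => \sum_z F z y x *~ (-1) ^+ (x + y + z))) /=.
rewrite !big_bool /= /F /difference /pick !cats0 -!catA /=.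
rewrite !addn0 !add0n !addn1 (expr0 (-1 : int)) !exprS expr0 !mulN1r !opprK mulr1z !mulrN1z.
move=> <-; rewrite !opprB [RHS]addrC; congr (_ + _).
  by rewrite [RHS]addrC; congr (_ + _); rewrite addrC.
by congr (_ + _); rewrite addrC.
Qed.
End FiniteType2.

Section Trees.
Variables (n l : nat) (P : nat -> Prop).
Notation T0 := (wtree 'I_l).

Lemma expansion_neg (r : bool) (t : T0) :
  expansion (~~ r) t = rev [seq (q.1, ~~ q.2) | q <- expansion r t].
Proof.
elim: t r => [tw h|tw X IX Y IY] r /=; first by case: r; case: tw.
rewrite addNb; case: (r (+) tw) => /=.
  by rewrite !map_cat !rev_cat -!IX -!IY -!catA.
by rewrite !map_cat !rev_cat -!IX -!IY -!catA.
Qed.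

Variable X : pred 'I_l.
Definition remaining (E : seq ('I_l * bool)) : seq (arrow (option 'I_l)) :=
  letters Some None [seq q <- E | ~~ X q.1].

Lemma remaining_neg r (t : T0) : remaining (expansion (~~ r) t) = inv (remaining (expansion r t)).
Proof.
rewrite expansion_neg /remaining /inv /letters filter_rev filter_map map_rev -!map_comp.
by congr rev; apply: eq_map.
Qed.

Lemma remaining_cat E F : remaining (E ++ F) = remaining E ++ remaining F.
Proof. by rewrite /remaining filter_cat letters_cat. Qed.

(* The expansions of a tree from both sides of its strand are inverse to each
   other, so a tree is a commutator, trivial as soon as one entry is. *)
Lemma remaining_tree r (t : T0) : has X (tails t) -> aeq n P (remaining (expansion r t)) [::].
Proof.
elim: t r => [tw h|tw U IU V IV] r /=.
  by rewrite orbF /remaining /= => ->; reflexivity.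
have gen s a b : aeq n P (remaining (expansion (~~ s) a)) [::] ->
    aeq n P (remaining (expansion s a)) [::] ->
    aeq n P (remaining (expansion s a ++ expansion s b ++
        expansion (~~ s) a ++ expansion (~~ s) b)) [::] /\
    aeq n P (remaining (expansion s b ++ expansion s a ++
        expansion (~~ s) b ++ expansion (~~ s) a)) [::].
  move=> e e'; rewrite !remaining_cat; split; rewrite e e' /= ?cats0;
    by rewrite remaining_neg; apply: aeq_invr.
rewrite has_cat => /orP [/IU|/IV] h.
  by have [g g'] := gen true U V (h _) (h _); case: (r (+) tw).
by have [g g'] := gen true V U (h _) (h _); case: (r (+) tw).
Qed.
End Trees.

Lemma virtualize_fill n (H : finType) (T : context n H) (W : seq (nat * arrow H)) S :
  {in S, forall x, x \notin map lbl (bT T)} ->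
  virtualize_code S (fill T (lw W)) = fill T (lw [seq q <- W | q.1 \notin S]).
Proof.
move=> dS; have lE h : [seq p <- lw W h | lbl p \notin S] = lw [seq q <- W | q.1 \notin S] h.
  elim: W => //= q W' IHW; rewrite lw_cons filter_cat IHW.
  have pE : [seq p <- piece q h | lbl p \notin S] = if q.1 \notin S then piece q h else [::].
    rewrite (eq_in_filter (a2 := fun=> q.1 \notin S)) => [|p]; last first.
      by rewrite mem_piece => /andP [/eqP -> _].
    by case: ifP => _; [apply: filter_predT|apply: filter_pred0].
  by rewrite pE; case: ifP; rewrite ?lw_cons.
apply/ffunP => i; rewrite !ffunE -!/(fillw _ _).
have bS p : inl p \in T i -> lbl p \notin S.
  by move=> /mem_bT pb; apply/negP => /dS; rewrite map_f.
elim: (T i) bS => // -[p|h] s IH bS; rewrite /fillw /= -!/(fillw _ _).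
  rewrite bS ?mem_head // IH // => q qs; apply: bS; by rewrite inE qs orbT.
by rewrite filter_cat IH ?lE // => q qs; apply: bS; rewrite inE qs orbT.
Qed.

Section Degree2.
Variables (n : nat) (A : zmodType) (nu : diagram n -> A).
Hypotheses (wi : welded_invariant nu) (ft : finite_type 2 nu).

(** The crossings at three different tails form three disjoint groups, and virtualizing any nonempty
    union of groups gives back [L] up to welded moves. The alternating sum over the eight unions is
    therefore nu L' - nu L. *)
Lemma surgery_invariant l (L L' : diagram n) : (3 <= l)%N -> surgery l L L' -> nu L = nu L'.
Proof.
move=> l3 [T [r [t [g [lT pt LE LE']]]]].
set E := expansion r t in LE'.
pose W := zip (map g (iota 0 (size E))) (letters (@Some 'I_l) None E).
have {}LE' : dcode L' = fill T (lw W).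
  by rewrite LE'; apply: eq_fill => h; rewrite surgery_lw.
have wL' : wf_code (fill T (lw W)) by rewrite -LE'; exact: wf_dcode.
have /and3P [wT uW /allP dW] : [&& wfw (bT T), uniq (unzip1 W) &
    all (fun x => x \notin map lbl (bT T)) (unzip1 W)] by rewrite -wf_fillA.
have W2 : unzip2 W = letters Some None E by rewrite unzip2_zip // !size_map size_iota.
pose Xo (X : pred 'I_l) (a : arrow (option 'I_l)) := if a.1.1 is Some x then X x else false.
pose S (X : pred 'I_l) := [seq q.1 | q <- W & Xo X q.2].
have SE X q : q \in W -> (q.1 \in S X) = Xo X q.2.
  move=> qW; apply/mapP/idP => [[q' ]|Xq]; last by exists q; rewrite // mem_filter Xq.
  by rewrite mem_filter => /andP [Xq' q'W] /(map_uniq_inj uW qW q'W) ->.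
have Sw X x : x \in S X -> exists2 q, q \in W & x = q.1 /\ Xo X q.2.
  by move=> /mapP [q]; rewrite mem_filter => /andP [Xq qW] ->; exists q.
have vE (X : pred 'I_l) : has X (tails t) -> nu (virtualize (S X) L') = nu L.
  move=> hX; apply: wi.
  have : ceq (fun=> False) (virtualize (S X) L') L.
    have dSX : {in S X, forall x, x \notin map lbl (bT T)}.
      by move=> x /Sw [q qW [-> _]]; apply: dW; apply: map_f.
    have vC : dcode (virtualize (S X) L') = fill T (lw [seq q <- W | q.1 \notin S X]).
      by rewrite /= LE' virtualize_fill.
    have wv := wf_dcode (virtualize (S X) L'); have wL := wf_dcode L.
    rewrite vC in wv *; rewrite LE in wL *.
    apply: (aeq_use (B := [::])) => //.
    have -> : unzip2 [seq q <- W | q.1 \notin S X] = remaining X E.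
      rewrite (eq_in_filter (a2 := fun q => ~~ Xo X q.2)) => [|q qW]; last by rewrite SE.
      transitivity [seq a <- unzip2 W | ~~ Xo X a]; first by rewrite filter_map.
      by rewrite W2 /remaining /letters filter_map.
    exact: remaining_tree.
  move/ceqE; elim=> [C D [m|[? []]]|C|C D _ h|C D F _ h _ h'].
  - exact: rst_step.
  - exact: rst_refl.
  - exact: rst_sym h.
  - exact: rst_trans h h'.
have cS (X Y : pred 'I_l) : S (predU X Y) =i S X ++ S Y.
  move=> x; rewrite mem_cat; apply/idP/orP.
    move=> /Sw [q qW [-> Xq]]; rewrite !SE //; apply/orP.
    by move: Xq; rewrite /Xo; case: q.2.1.1.
  by case=> /Sw [q qW [-> Xq]]; rewrite SE //; move: Xq; rewrite /Xo; case: q.2.1.1 => //= a ->;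
    rewrite ?orbT.
have uS X : uniq (S X) by apply: subseq_uniq uW; apply: map_subseq; exact: filter_subseq.
have dS (X Y : pred 'I_l) : (forall x, X x -> ~~ Y x) -> ~~ has (mem (S X)) (S Y).
  move=> d; apply/hasPn => x /Sw [q qW [-> Yq]]; rewrite inE SE //.
  by move: Yq; rewrite /Xo; case: q.2.1.1 => // a Ya; apply/negP => /d; rewrite Ya.
have crS X : all (mem (crossings L')) (S X).
  apply/allP => x /Sw [q qW [-> _]]; rewrite inE /crossings LE'.
  rewrite (perm_mem (perm_map _ (perm_passages_fill _ lT))) map_cat mem_cat.
  rewrite (perm_mem (perm_map _ (perm_lw _))) lbl_ends orbC.
  by rewrite map_f.
have o k : (k < 3)%N -> (k < l)%N by move=> /leq_trans; apply.
pose X0 := pred1 (Ordinal (o 0%N isT)); pose X1 := pred1 (Ordinal (o 1%N isT)).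
pose X2 := pred1 (Ordinal (o 2%N isT)).
have hX k (hk : (k < 3)%N) : has (pred1 (Ordinal (o k hk))) (tails t).
  by rewrite has_pred1 (perm_mem pt) mem_enum.
have hU X Y : has X (tails t) -> has (predU X Y) (tails t).
  by move=> /hasP [x xt Xx]; apply/hasP; exists x => //=; rewrite Xx.
have ext := virtualize_ext nu L'.
have uSS : uniq (S X0 ++ S X1 ++ S X2).
  by rewrite !cat_uniq !uS has_cat negb_or !dS //= => x /eqP ->.
have D0 := @difference3 _ (mem (crossings L')) _ ext (finite_type_difference ft (L := L')) _ _ _ [::] uSS.
have {}D0 := D0 _; rewrite !all_cat !crS in D0; have {}D0 := D0 isT.
have n0 : nu (virtualize [::] L') = nu L'.
  congr nu; apply: diagram_eq; apply/ffunP => i; rewrite ffunE.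
  by apply/all_filterP/allP.
have c3 : S (predU (predU X0 X1) X2) =i (S X0 ++ S X1) ++ S X2.
  by move=> x; rewrite cS !mem_cat cS mem_cat.
move: D0; rewrite /difference !cat0s n0.
rewrite -(ext _ _ c3) -!(ext _ _ (cS _ _)) !vE ?hU ?hX //.
by rewrite !subrr !subr0 => /eqP; rewrite subr_eq0 => /eqP.
Qed.

Lemma w_equiv_invariant (L L' : diagram n) : w_equiv 3 L L' -> nu L = nu L'.
Proof.
elim=> {L L'} [L L' [m|[l l3 s]]|//|L L' _ -> //|L L' L'' _ -> _ -> //].
  by apply: wi; exact: rst_step.
exact: surgery_invariant l3 s.
Qed.
End Degree2.

(** * Closure invariants separate trees *)

Section Detection.
Variable n : nat.
Local Notation P3 := (fun l => is_true (3 <= l)%N).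
Implicit Types (g : gen n) (R : complist n).

Lemma closure_invariantE R (L : diagram n) : uniq [seq x.1 | x <- R] ->
  closure_invariant R 2 L = pairs (clword R L).
Proof.
by move=> uR; rewrite /closure_invariant alpha2_pairs ?closureE //; exact: wf_closure.
Qed.

Definition end_order R : seq (eh n) := flatten [seq rv x.2 (eholes x.1) | x <- R].
Definition overlined R i := has (fun x => x.2 && (x.1 == i)) R.

Definition tree_value R g : int :=
  let x := g.1.1 in let y := g.1.2 in let h := (g.2, None) in
  let o := [seq e <- end_order R | e \in [:: x; h; y]] in
  sgb (~~ (overlined R x.1 (+) overlined R g.2 (+) overlined R y.1)) *
  ((o == [:: y; h; x])%:R - (o == [:: x; h; y])%:R).

Lemma holes_TM (M : code n) i : holes (TM M i) = eholes i.
Proof. by rewrite ffunE holes_cat holes_inl holes_inr. Qed.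

Section Value.
Variable R : complist n.
Hypothesis uR : uniq [seq x.1 | x <- R].

Lemma pairs_stack_trg M g : wf_code M -> allowed g ->
  pairs (clword R (stack M (trg g))) = pairs (clword R M) + tree_value R g.
Proof.
case: g => [[x y] k] wM /and4P [/andP [/= cx cy] xy _ _].
have lT := linear_TM M.
have xh := ctail_head k cx; have yh := ctail_head k cy.
have wA : wf_code (stack M (trg (x, y, k))) by exact: wf_stack.
have revE e : revh R (TM M) e = overlined R e.1.
  apply: eq_has => z; rewrite holes_TM; congr andb.
  by case: e => i b; rewrite /eholes !inE !xpair_eqE /= eq_sym; case: (_ == _) => //; case: b => [[]|].
have oE : clholes R (TM M) = end_order R.
  by congr flatten; apply: eq_map => z; rewrite holes_TM.
have ME : fill (TM M) (fun=> [::]) = M by rewrite -dg_nil -/(stack M [::]) stack_nil.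
have := pairs_tree uR lT xh yh xy wA.
by rewrite ME !revE /order3 oE.
Qed.

Lemma pairs_ceq C D : ceq P3 C D -> pairs (clword R C) = pairs (clword R D).
Proof.
case=> h [h' e].
exact: (w_equiv_invariant (welded_pairs uR) (finite_type_pairs R) e).
Qed.

(** The value of a tree does not depend on the diagram below it, so the values of stacked trees add
    up. *)
Lemma pairs_stack (L : diagram n) W : all (@allowed n) W ->
  pairs (clword R (stack L (trs W))) = pairs (clword R L) + \sum_(g <- W) tree_value R g.
Proof.
elim/last_ind: W => [_|W g IH].
  by rewrite stack_nil big_nil addr0.
rewrite all_rcons => /andP [ag aW]; rewrite -cats1 trs_cat trs1 big_cat big_seq1 /= addrA -IH //.
have /andP [cg _] := ag.
apply: (etrans (esym (pairs_ceq (stack_trg (trs W) (wf_dcode L) cg)))).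
exact: (pairs_stack_trg (wf_stack (trs W) (wf_dcode L)) ag).
Qed.
End Value.

Lemma tree_value_swap R g : tree_value R (swap g) = - tree_value R g.
Proof.
case: g => [[x y] k]; rewrite /tree_value /=.
rewrite (eq_filter (a2 := mem [:: x; (k, None); y])) => [|e].
  rewrite -mulrN opprB; congr (sgb (~~ _) * _).
  by case: overlined; case: overlined; case: overlined.
by rewrite !inE; do 3!case: (_ == _).
Qed.

Lemma tree_value_mem R g : tree_value R g != 0 ->
  [/\ g.1.1 \in end_order R, (g.2, None) \in end_order R & g.1.2 \in end_order R].
Proof.
case: g => [[x y] k]; rewrite /tree_value /=; set o := filter _ _.
have mo l e : o == l -> e \in l -> e \in end_order R.
  by move=> /eqP <-; rewrite mem_filter => /andP [].
have [h1|_] := boolP (o == [:: y; (k, None); x]).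
  by move=> _; split; apply: (mo _ _ h1); rewrite !inE eqxx ?orbT.
have [h1|_] := boolP (o == [:: x; (k, None); y]).
  by move=> _; split; apply: (mo _ _ h1); rewrite !inE eqxx ?orbT.
by rewrite subrr mulr0 eqxx.
Qed.

Lemma mem_end_order R (e : eh n) : (e \in end_order R) = (e.1 \in [seq x.1 | x <- R]).
Proof.
rewrite /end_order; elim: R => //= x R IH; rewrite mem_cat IH inE; congr orb.
rewrite (perm_mem (perm_rv _ _)) /eholes !inE; case: e {IH} => i b; rewrite !xpair_eqE /=.
by case: (_ == _) => //; case: b => [[]|].
Qed.

Section Excess.
Variable W : seq (gen n).
Hypothesis aW : all (@allowed n) W.
(** The multiplicity of a tree after cancellation against its inverse. *)
Definition excess g : int := (count_mem g W)%:Z - (count_mem (swap g) W)%:Z.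

Lemma excess_swap g : excess (swap g) = - excess g.
Proof. by rewrite /excess swapK opprB. Qed.

Lemma excess_allowed g : excess g != 0 -> allowed g.
Proof.
apply: contraR => ag; have z f : ~~ allowed f -> count_mem f W = 0%N.
  by move=> af; apply/count_memPn; apply: contra af => /(allP aW).
by rewrite /excess (z g ag) (z (swap g)) ?allowed_swap ?subrr.
Qed.

Lemma sum_excess R : (\sum_(g <- W) tree_value R g) *+ 2 = \sum_g excess g * tree_value R g.
Proof.
have e (V : seq (gen n)) (F : gen n -> int) : \sum_(g <- V) F g = \sum_g (count_mem g V)%:Z * F g.
  elim: V => [|g V IH]; first by rewrite big_nil big1 // => g _; rewrite mul0r.
  rewrite big_cons IH [RHS](bigD1 g) // [in LHS](bigD1 g) //= eqxx addrA PoszD mulrDl mul1r.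
  by congr (_ + _); apply: eq_bigr => f /negbTE nf; rewrite eq_sym nf.
rewrite e mulr2n {2}(reindex_inj (inv_inj (@swapK n))) -big_split /=.
have m (a b v : int) : a * v + b * - v = (a - b) * v by ring.
by apply: eq_bigr => g _; rewrite tree_value_swap; exact: m.
Qed.

(** One step of the triangular system: every other tree seen by the closure [R] is already known to
    have excess 0. A tree and its inverse contribute equally, hence the doubling in [sum_excess]. *)
Lemma detect R g0 : \sum_(g <- W) tree_value R g = 0 -> tree_value R g0 != 0 -> g0.1.1 != g0.1.2 ->
  (forall g, tree_value R g != 0 -> excess g != 0 -> g = g0 \/ g = swap g0) -> excess g0 = 0.
Proof.
move=> s0 v0 xy only; have := sum_excess R; rewrite s0 mul0rn.
have ns : swap g0 != g0.
  by case: g0 xy {v0 only} => [[x y] k] /= xy; rewrite /swap !xpair_eqE /= eq_sym (negbTE xy).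
rewrite (bigD1 g0) //= (bigD1 (swap g0)) //= [X in _ + (_ + X)]big1 => [|g /andP [n1 n2]].
  rewrite excess_swap tree_value_swap mulrNN addr0 => e.
  have /eqP : excess g0 * tree_value R g0 = 0 by lia.
  by rewrite mulf_eq0 (negbTE v0) orbF => /eqP.
have [->|v] := eqVneq (tree_value R g) 0; first by rewrite mulr0.
have [->|ne] := eqVneq (excess g) 0; first by rewrite mul0r.
by case: (only g v ne) => e; rewrite e eqxx in n1 n2.
Qed.

(* Unlike [filter], this form does not double under simplification. *)
Lemma filter_nseq (T : Type) (p : pred T) s : filter p s = flatten [seq nseq (p x) x | x <- s].
Proof. by elim: s => //= x s ->; case: (p x). Qed.

Ltac tree_value_simpl E :=
  rewrite /tree_value filter_nseq /end_order /overlined /rv /eholes /rev /= !inE !xpair_eqE ?E ?eqxx /=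
    ?eqseq_cons ?xpair_eqE ?E ?eqxx /= ?andbF ?eqseq_cons ?xpair_eqE ?E ?eqxx /= ?andbF //.

Hypothesis s1 : forall i, \sum_(g <- W) tree_value [:: (i, false)] g = 0.

Lemma excessA k : excess ((k, Some true), (k, Some false), k) = 0.
Proof.
apply: (detect (s1 k)) => [||[[[a b] [a' b']] h] /tree_value_mem [] /=].
- by tree_value_simpl (eqxx k).
- by rewrite /= !xpair_eqE eqxx.
rewrite !mem_end_order /= !inE => /eqP -> /eqP -> /eqP -> /excess_allowed /and4P [/andP []].
rewrite /ctail /= => cb cb' /= ne _ _.
by case: b cb ne => [[]|] //; case: b' cb' => [[]|] // _ _; rewrite ?eqxx //; [left|right].
Qed.

Hypothesis s2 : forall i j : 'I_n, (i < j)%N ->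
  [/\ \sum_(g <- W) tree_value [:: (j, false); (i, false)] g = 0,
      \sum_(g <- W) tree_value [:: (i, false); (j, true)] g = 0
    & \sum_(g <- W) tree_value [:: (i, true); (j, false)] g = 0].

Lemma excess_rev x y k : excess (x, y, k) = 0 -> excess (y, x, k) = 0.
Proof. by move=> e; rewrite -[(y, x, k)]/(swap (x, y, k)) excess_swap e oppr0. Qed.

Let rA k := excess_rev (excessA k).

Ltac strand_cases :=
  let H := fresh in
  move=> H; repeat (match type of H with is_true (_ || _) => case/orP: H => H end);
  move/eqP: H => H.

(** [s] is the vanishing sum, [E] collects the comparisons of strands, and [Z] the excesses already
    known to vanish. All positions of tails and head are run through. *)
Ltac detect_tree s E Z :=
  let a := fresh in let b := fresh in let a' := fresh in let b' := fresh in
  let h := fresh in let v := fresh in let ne := fresh in let al := fresh in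
  apply: (detect s) => [||[[[a b] [a' b']] h] v ne] /=;
  [by tree_value_simpl E | by rewrite !xpair_eqE ?E ?eqxx |
   have [] := tree_value_mem v; rewrite !mem_end_order /= !inE;
   have := excess_allowed ne; rewrite /allowed /cgen /ctail /bad_pair /= !xpair_eqE;
   move=> al; strand_cases; strand_cases; strand_cases; subst; move: al v ne;
   rewrite ?E ?eqxx /=;
   case: b => [[]|] //=; case: b' => [[]|] //=; rewrite ?E ?eqxx ?andbF //= => _;
   first [by left | by right | by rewrite ?Z eqxx | by tree_value_simpl E]].

(** For i < j the closure with [i] overlined, followed by [j], sees this tree, those of [excessA],
    and the counterpart with head on [j], which [allowed] excludes. For j < i the tree itself is
    excluded. *)
Lemma excessB i j : i != j -> excess ((i, Some false), (j, Some true), i) = 0.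
Proof.
move=> nij; have ij := negbTE nij; have ji : (j == i) = false by rewrite eq_sym.
case: (ltngtP i j) => [lij|lji|/val_inj e]; last by rewrite e eqxx in nij.
  have nji : (j < i)%N = false by apply/negbTE; rewrite -leqNgt ltnW.
  have [_ _ s] := s2 lij.
  detect_tree s (ij, ji, nji, lij) (excessA i, excessA j, rA i, rA j).
apply/eqP; apply: contraT => /excess_allowed.
by rewrite /allowed /bad_pair /= !eqxx lji /= ?andbF.
Qed.

Let rB i j nij := excess_rev (@excessB i j nij).

(** The closure (l, k) sees only the tree with head on [l] among the two considered here. The
    closure of i followed by the overlined j sees both, so [C1] has to come first. *)
Lemma excessC i j : i != j -> excess ((i, Some true), (j, Some true), i) = 0.
Proof.
have C1 (k l : 'I_n) : (k < l)%N -> excess ((l, Some true), (k, Some true), l) = 0.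
  move=> lkl; have nkl : k != l by rewrite neq_ltn lkl.
  have kl := negbTE nkl; have nlk : l != k by rewrite eq_sym.
  have lk := negbTE nlk.
  have [s _ _] := s2 lkl.
  detect_tree s (kl, lk) ((excessA k, excessA l, rA k, rA l), (excessB nkl, excessB nlk, rB nkl, rB nlk)).
move=> nij; case: (ltngtP i j) => [lij|lji|/val_inj e]; [|exact: C1|by rewrite e eqxx in nij].
have ij := negbTE nij; have nji : j != i by rewrite eq_sym.
have ji := negbTE nji; have [_ s _] := s2 lij; have c1 := C1 _ _ lij.
detect_tree s (ij, ji) ((excessA i, excessA j, rA i, rA j), (c1, excess_rev c1)).
Qed.

Let rC i j nij := excess_rev (@excessC i j nij).

Lemma excess_distinct x y k : excess (x, y, k) != 0 ->
  exists a a', [/\ x = (a, Some true), y = (a', Some true), a != a', a != k & a' != k].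
Proof.
case: x y => [a b] [a' b'] ne.
have /and4P [/andP []] := excess_allowed ne; rewrite /ctail /= => cb cb' nab _ _.
have z x y : excess (x, y, k) = 0 -> (excess (x, y, k) != 0) = false by move=> ->; rewrite eqxx.
move: ne; case: b cb nab => [[]|] // cb; case: b' cb' => [[]|] // cb'; rewrite xpair_eqE.
- rewrite andbT => aa; case: (eqVneq a k) aa => [->|ak] aa; first by rewrite z ?excessC.
  case: (eqVneq a' k) aa => [->|a'k] aa; first by rewrite z ?rC // eq_sym.
  by exists a, a'.
- rewrite (eqP cb') => _; case: (eqVneq a k) => [->|ak]; first by rewrite z ?excessA.
  by rewrite z ?rB // eq_sym.
- rewrite (eqP cb) => _; case: (eqVneq a' k) => [->|ak]; first by rewrite z ?rA.
  by rewrite z ?excessB // eq_sym.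
by rewrite (eqP cb) (eqP cb') eqxx.
Qed.

Hypothesis s3 : forall i j k : 'I_n, i != j -> i != k -> (j < k)%N ->
  \sum_(g <- W) tree_value [:: (j, true); (i, false); (k, true)] g = 0.

(** With [j] and [k] reversed on the outside, the head of an outer strand has only its own strand on
    one side. So among trees on three strands only those with head on [i] are seen. *)
Lemma excessD (i j k : 'I_n) : i != j -> i != k -> (j < k)%N ->
  excess ((j, Some true), (k, Some true), i) = 0.
Proof.
move=> nij nik ljk; have njk : j != k by rewrite neq_ltn ljk.
pose E := (negbTE nij, negbTE nik, negbTE njk).
have E' : ((j == i) = false) * ((k == i) = false) * ((k == j) = false).
  by rewrite !(eq_sym _ i) (eq_sym k) !E.
apply: (detect (s3 nij nik ljk)) => [||[[x y] h] v ne] /=.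
- by tree_value_simpl (E, E').
- by rewrite !xpair_eqE !E.
have [a [a' [ex ey aa' ah a'h]]] := excess_distinct ne; subst x y.
have [] := tree_value_mem v; rewrite !mem_end_order /= !inE {ne}.
strand_cases; strand_cases; strand_cases; subst; move: v aa' ah a'h; rewrite ?eqxx // => v _ _ _;
  first [by left | by right | by move: v; tree_value_simpl (E, E')].
Qed.

Lemma excess0 g : excess g = 0.
Proof.
case: g => [[x y] k]; apply/eqP; apply: contraT => ne.
have [a [a' [ex ey aa' ak a'k]]] := excess_distinct ne; subst x y.
have z x y : excess (x, y, k) = 0 -> (excess (x, y, k) != 0) = false by move=> ->; rewrite eqxx.
have ka : k != a by rewrite eq_sym.
have ka' : k != a' by rewrite eq_sym.
case: (ltngtP a a') => [l|l|/val_inj e]; last by rewrite e eqxx in aa'.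
  by rewrite z ?excessD in ne.
by rewrite z // in ne; apply/excess_rev/excessD.
Qed.

End Excess.
End Detection.

(** * The equivalence of the three conditions *)

Section Main.
Variable n : nat.
Implicit Types L : diagram n.

Definition same_finite_type L L' := forall (A : zmodType) (nu : diagram n -> A),
  welded_invariant nu -> finite_type 2 nu -> nu L = nu L'.

Lemma invariants_finite_type L L' (R : complist n) : uniq [seq x.1 | x <- R] ->
  same_finite_type L L' ->
  closure_invariant R 2 L = closure_invariant R 2 L'.
Proof.
move=> uR ft; rewrite !closure_invariantE //.
exact: (ft int _ (welded_pairs uR) (finite_type_pairs R)).
Qed.

Definition same_closures L L' :=
  [/\ forall i j : 'I_n, i != j -> linking L i j = linking L' i j,
      forall i : 'I_n,
        closure_invariant [:: (i, false)] 2 L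
        = closure_invariant [:: (i, false)] 2 L',
      forall i j : 'I_n, (i < j)%N ->
        [/\ closure_invariant [:: (j, false); (i, false)] 2 L
            = closure_invariant [:: (j, false); (i, false)] 2 L',
            closure_invariant [:: (i, false); (j, true)] 2 L
            = closure_invariant [:: (i, false); (j, true)] 2 L'
          & closure_invariant [:: (i, true); (j, false)] 2 L
            = closure_invariant [:: (i, true); (j, false)] 2 L']
    & forall i j k : 'I_n, i != j -> i != k -> (j < k)%N ->
        closure_invariant [:: (j, true); (i, false); (k, true)] 2 L
        = closure_invariant [:: (j, true); (i, false); (k, true)] 2 L'].

Lemma finite_type_closures L L' : same_finite_type L L' -> same_closures L L'.
Proof.
move=> ft; split=> [i j ij|i|i j lij|i j k ij ik ljk].
- exact: (ft int _ (welded_linking ij) (finite_type_linking i j)).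
- exact: invariants_finite_type ft.
- have nij : i != j by rewrite neq_ltn lij.
  by split; apply: invariants_finite_type ft; rewrite /= inE andbT // eq_sym.
apply: invariants_finite_type ft.
by rewrite /= !inE negb_or eq_sym ij ik neq_ltn ljk.
Qed.

Lemma closures_w3 L L' : same_closures L L' -> w_equiv 3 L L'.
Proof.
case=> lk c1 c2 c3; have [W aW e] := linking_trees lk.
have S R : uniq [seq x.1 | x <- R] -> closure_invariant R 2 L = closure_invariant R 2 L' ->
    \sum_(g <- W) tree_value R g = 0.
  move=> uR; rewrite !closure_invariantE // (pairs_ceq uR e) (pairs_stack uR L aW) => /eqP.
  by rewrite -{1}[pairs _]addr0 (inj_eq (addrI _)) => /eqP.
have ne (i j : 'I_n) : (i < j)%N -> i != j by move=> lij; rewrite neq_ltn lij.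
have N0 g : excess W g = 0.
  apply: (excess0 aW) => [i|i j lij|i j k ij ik ljk].
  - exact: S (c1 i).
  - have nij := ne _ _ lij; have [e1 e2 e3] := c2 _ _ lij.
    by split; apply: S => //=; rewrite inE andbT // eq_sym.
  - apply: S (c3 _ _ _ ij ik ljk).
    by rewrite /= !inE negb_or eq_sym ij ne // ik.
have c : ceq (fun l => is_true (3 <= l)%N) L L'.
  apply: ceq_sym; apply: (ceq_trans e); rewrite -[X in ceq _ _ X]stack_nil.
  apply: stack_aeq; first exact: wf_dcode.
  apply: trs_cancel => // g _; apply/eqP; have := N0 g.
  by rewrite /excess => /eqP; rewrite subr_eq0.
by have [h _] := ceqE (fun l => is_true (3 <= l)%N) L L'; apply: h.
Qed.
End Main.

Theorem corollary4p4 (n : nat) (hn : (1 <= n)%N) (L L' : diagram n) :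
  (w_equiv 3 L L'
   <->
   (forall (A : zmodType) (nu : diagram n -> A),
      welded_invariant nu -> finite_type 2 nu -> nu L = nu L'))
  /\
  ((forall (A : zmodType) (nu : diagram n -> A),
      welded_invariant nu -> finite_type 2 nu -> nu L = nu L')
   <->
   [/\ forall i j : 'I_n, i != j -> linking L i j = linking L' i j,
       forall i : 'I_n,
         closure_invariant [:: (i, false)] 2 L
         = closure_invariant [:: (i, false)] 2 L',
       forall i j : 'I_n, (i < j)%N ->
         [/\ closure_invariant [:: (j, false); (i, false)] 2 L
             = closure_invariant [:: (j, false); (i, false)] 2 L',
             closure_invariant [:: (i, false); (j, true)] 2 L
             = closure_invariant [:: (i, false); (j, true)] 2 L'
           & closure_invariant [:: (i, true); (j, false)] 2 L
             = closure_invariant [:: (i, true); (j, false)] 2 L']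
     & forall i j k : 'I_n, i != j -> i != k -> (j < k)%N ->
         closure_invariant [:: (j, true); (i, false); (k, true)] 2 L
         = closure_invariant [:: (j, true); (i, false); (k, true)] 2 L']).
Proof.
have i12 : w_equiv 3 L L' -> same_finite_type L L'.
  by move=> e A nu wi ft; exact: (w_equiv_invariant wi ft e).
have i23 := @finite_type_closures n L L'; have i31 := @closures_w3 n L L'.
split; split; [exact: i12 | exact: (fun h => i31 (i23 h)) | exact: i23 |].
exact: (fun h => i12 (i31 h)).
Qed.
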